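(* Let $\tau_1\ge\tau_0>0$, $a\in(-1,1)$, $b\in\mathbb{R}$ with $b\neq 0$, and let $N:[0,\tau_0]\to\mathbb{R}$ and $M:[0,\tau_1]\to\mathbb{R}$ be piecewise continuously differentiable. Assume spectral controllability: for all $s\in\mathbb{C}$, $\operatorname{rank}[F_0(s),F_1(s)]=1$ (that is, $F_0$ and $F_1$ have no common zero in $\mathbb{C}$). Let $f:[0,\tau_0]\to\mathbb{R}$ and $g:[0,\tau_1]\to\mathbb{R}$ be the piecewise continuously differentiable functions (which exist and are unique, up to equality almost everywhere) such that $I_1(\nu)=0$ for all $\nu\in[0,\tau_0]$, $I_2(\nu)=0$ for all $\nu\in(\tau_0,\tau_1]$, and $I_3(\nu)=0$ for all $\nu\in[\tau_1,\tau_0+\tau_1]$. Then the closed-loop system consisting of the plant $$x(t)=a\,x(t-\tau_0)+\int_0^{\tau_0}N(\nu)x(t-\nu)\,d\nu+b\,U(t-\tau_1)+\int_0^{\tau_1}M(\nu)U(t-\nu)\,d\nu,\qquad t\ge 0,$$ and the control law $$U(t)=\int_0^{\tau_0}f(\nu)x(t-\nu)\,d\nu+\int_0^{\tau_1}g(\nu)U(t-\nu)\,d\nu,\qquad t\ge 0,$$ is exponentially stable.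
   Context: A function on a compact interval is piecewise continuously differentiable if the interval can be split into finitely many subintervals on the interior of each of which the function is $C^1$, with the function and its derivative extending continuously to the closed subinterval. The holomorphic functions $F_0,F_1:\mathbb{C}\to\mathbb{C}$ are $$F_0(s)=1-a e^{-\tau_0 s}-\int_0^{\tau_0}N(\nu)e^{-\nu s}\,d\nu,\qquad F_1(s)=b e^{-\tau_1 s}+\int_0^{\tau_1}M(\nu)e^{-\nu s}\,d\nu .$$ Given $f:[0,\tau_0]\to\mathbb{R}$ and $g:[0,\tau_1]\to\mathbb{R}$, the functions $I_1,I_2,I_3$ (for $\nu$ in $[0,\tau_0]$, $[\tau_0,\tau_1]$, $[\tau_1,\tau_0+\tau_1]$ respectively) are $$I_1(\nu)=g(\nu)+N(\nu)+\int_0^\nu f(\eta)M(\nu-\eta)\,d\eta-\int_0^\nu g(\eta)N(\nu-\eta)\,d\eta,$$ $$I_2(\nu)=g(\nu)-a\,g(\nu-\tau_0)+\int_0^{\tau_0}f(\eta)M(\nu-\eta)\,d\eta-\int_{\nu-\tau_0}^{\nu}g(\eta)N(\nu-\eta)\,d\eta,$$ $$I_3(\nu)=b\,f(\nu-\tau_1)+\int_{\nu-\tau_1}^{\tau_0}f(\eta)M(\nu-\eta)\,d\eta-a\,g(\nu-\tau_0)-\int_{\nu-\tau_0}^{\tau_1}g(\eta)N(\nu-\eta)\,d\eta .$$ For $\tau>0$, $C^{pw}_\tau$ is the space of piecewise continuous functions $[-\tau,0]\to\mathbb{R}$ with the sup norm, and for a function $\phi$ on $[-\tau,\infty)$, $\phi_{[t]}(\theta)=\phi(t+\theta)$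 for $-\tau\le\theta\le 0$, so $\|\phi_{[t]}\|_{C^{pw}_\tau}=\sup_{\theta\in[-\tau,0]}|\phi(t+\theta)|$. Initial data are $x^0\in C^{pw}_{\tau_0}$ and $U^0\in C^{pw}_{\tau_1}$; a solution of the closed loop is a pair $x:[-\tau_0,\infty)\to\mathbb{R}$, $U:[-\tau_1,\infty)\to\mathbb{R}$ having these as initial data (histories) and satisfying both equations for $t\ge0$. The closed-loop system is exponentially stable if there exist $\kappa>0$ and $C_0>0$ such that for all initial data $(x^0,U^0)$, all solutions satisfy, for all $t\ge 0$, $$\|x_{[t]}\|_{C^{pw}_{\tau_0}}+\|U_{[t]}\|_{C^{pw}_{\tau_1}}\le C_0e^{-\kappa t}\left(\|x^0\|_{C^{pw}_{\tau_0}}+\|U^0\|_{C^{pw}_{\tau_1}}\right).$$ *)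

(* Defs.v *)
From HB Require Import structures.
From mathcomp Require Import all_boot all_order all_algebra.
From mathcomp Require Import complex.
From mathcomp Require Import all_classical all_reals all_analysis.

Set Implicit Arguments.
Unset Strict Implicit.
Unset Printing Implicit Defensive.

Import Order.TTheory GRing.Theory Num.Theory.
Import numFieldNormedType.Exports.

Local Open Scope classical_set_scope.
Local Open Scope ring_scope.
Local Open Scope complex_scope.

(* All functions on a compact interval are represented by total functions
   R -> R; every notion below only inspects their values on that interval. *)
Section Piecewise.
Variable R : realType.
Implicit Types (u v : R) (f h : R -> R).

Definition extends_continuously u v f :=
  exists h, {within `[u, v], continuous h} /\ {in `]u, v[, f =1 h}.

Definition C1_piece u v f :=
  [/\ {in `]u, v[, forall x, derivable f x 1},
      {in `]u, v[, continuous (derive1 f)},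
      extends_continuously u v f
    & extends_continuously u v (derive1 f)].

(* The subdivision is u = s_0 < s_1 < ... < s_n = v with s the list
   [s_1; ...; s_n]; values at the subdivision points are unconstrained. *)
Definition piecewise (P : R -> R -> Prop) u v :=
  exists s : seq R, itv_partition u v s /\
    forall i, (i < size s)%N -> P (nth v (u :: s) i) (nth v s i).

Definition piecewise_continuous u v f :=
  piecewise (fun p q => extends_continuously p q f) u v.

Definition piecewise_C1 u v f := piecewise (fun p q => C1_piece p q f) u v.

End Piecewise.

Section ComplexFunctions.
Variable R : realType.

Definition cexp (z : R[i]) : R[i] :=
  (expR (complex.Re z))%:C * (cos (complex.Im z) +i* sin (complex.Im z)).

Definition cintegral (D : set R) (h : R -> R[i]) : R[i] :=
  (\int[lebesgue_measure]_(x in D) complex.Re (h x))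
  +i* (\int[lebesgue_measure]_(x in D) complex.Im (h x)).

End ComplexFunctions.

Section ClosedLoop.
Variables (R : realType) (tau0 tau1 a b : R) (N M : R -> R).
Local Notation mu := (@lebesgue_measure R).

Definition F0 (s : R[i]) : R[i] :=
  1 - a%:C * cexp (- (tau0%:C * s))
    - cintegral `[0, tau0] (fun nu => (N nu)%:C * cexp (- (nu%:C * s))).

Definition F1 (s : R[i]) : R[i] :=
  b%:C * cexp (- (tau1%:C * s))
    + cintegral `[0, tau1] (fun nu => (M nu)%:C * cexp (- (nu%:C * s))).

Definition spectrally_controllable :=
  forall s : R[i], \rank (row_mx (F0 s)%:M (F1 s)%:M : 'M[R[i]]_(1, 1 + 1)) = 1%N.

Section Kernels.
Variables f g : R -> R.

Definition I1 (nu : R) : R :=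
  g nu + N nu + \int[mu]_(eta in `[0, nu]) (f eta * M (nu - eta))
  - \int[mu]_(eta in `[0, nu]) (g eta * N (nu - eta)).

Definition I2 (nu : R) : R :=
  g nu - a * g (nu - tau0)
  + \int[mu]_(eta in `[0, tau0]) (f eta * M (nu - eta))
  - \int[mu]_(eta in `[nu - tau0, nu]) (g eta * N (nu - eta)).

Definition I3 (nu : R) : R :=
  b * f (nu - tau1)
  + \int[mu]_(eta in `[nu - tau1, tau0]) (f eta * M (nu - eta))
  - a * g (nu - tau0)
  - \int[mu]_(eta in `[nu - tau0, tau1]) (g eta * N (nu - eta)).

Definition feedback_kernels :=
  [/\ piecewise_C1 0 tau0 f /\ piecewise_C1 0 tau1 g,
      forall nu, 0 <= nu <= tau0 -> I1 nu = 0,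
      forall nu, tau0 < nu <= tau1 -> I2 nu = 0
    & forall nu, tau1 <= nu <= tau0 + tau1 -> I3 nu = 0].

Definition plant_eq (x U : R -> R) (t : R) :=
  x t = a * x (t - tau0) + \int[mu]_(nu in `[0, tau0]) (N nu * x (t - nu))
        + b * U (t - tau1) + \int[mu]_(nu in `[0, tau1]) (M nu * U (t - nu)).

Definition control_eq (x U : R -> R) (t : R) :=
  U t = \int[mu]_(nu in `[0, tau0]) (f nu * x (t - nu))
        + \int[mu]_(nu in `[0, tau1]) (g nu * U (t - nu)).

Definition history (phi : R -> R) (t : R) : R -> R := fun theta => phi (t + theta).

Definition Cpw (tau : R) (phi : R -> R) := piecewise_continuous (- tau) 0 phi.

(* The set is bounded whenever phi is in Cpw tau, so [sup] is the supremum. *)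
Definition Cpw_norm (tau : R) (phi : R -> R) : R :=
  sup [set `|phi theta| | theta in `[- tau, 0]].

(* The history is prescribed on [-tau, 0[ only: at time 0 the equations already
   determine x and U, and a jump with respect to the initial data is allowed. *)
Definition closed_loop_solution (x0 U0 x U : R -> R) :=
  [/\ (forall theta, - tau0 <= theta < 0 -> x theta = x0 theta),
      (forall theta, - tau1 <= theta < 0 -> U theta = U0 theta),
      (forall t, 0 <= t -> Cpw tau0 (history x t) /\ Cpw tau1 (history U t))
    & (forall t, 0 <= t -> plant_eq x U t /\ control_eq x U t)].

Definition exponentially_stable :=
  exists kappa C0 : R, [/\ 0 < kappa, 0 < C0 &
    forall x0 U0 : R -> R, Cpw tau0 x0 -> Cpw tau1 U0 ->
    forall x U : R -> R, closed_loop_solution x0 U0 x U ->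
    forall t : R, 0 <= t ->
      Cpw_norm tau0 (history x t) + Cpw_norm tau1 (history U t)
      <= C0 * expR (- (kappa * t)) * (Cpw_norm tau0 x0 + Cpw_norm tau1 U0)].

End Kernels.
End ClosedLoop.

(* Main.v *)
From HB Require Import structures.
Require Import Defs.
From mathcomp Require Import all_boot all_order all_algebra.
From mathcomp Require Import complex.
From mathcomp Require Import all_classical all_reals all_analysis.
From mathcomp Require Import measurable_realfun.
From mathcomp Require Import ring lra.

(** Extend n = N, f by zero outside ]0, tau0] and m = M, g by zero outside
    ]0, tau1], and write ** for convolution and S_p for the delay p. Put
      D g = g - a S_tau0 g - n ** g,   E f = b S_tau1 f + m ** f;
    these are multiplication by F0 and F1 in the Laplace domain. The equations
    I1 = I2 = I3 = 0 are the single equation n + D g + E f = 0, up to the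
    values of f and g at 0 ([feedback_identity], [identity_feedback]).
    Equivalently, F0 (1 - g^) - F1 f^ = 1 - a exp (- tau0 s), with ^ for the
    Laplace transform: the feedback places the characteristic function of the
    closed loop.

    Stability. Eliminating U or x from the closed loop D x = E U,
    U = f ** x + g ** U leaves x(t) = a x(t - tau0) and U(t) = a U(t - tau0)
    past time tau1, once the initial data have left the equations
    ([closed_loop_difference]). Solutions thus decay geometrically, since
    |a| < 1, and it remains to bound them up to time tau1 by the initial data.
    Measured against a weight exp (ga t) with ga large, delays and integrals
    are contractions, which gives this bound ([solution_decay]).

    Existence and uniqueness of the kernels. In D g + E f = r the terms without
    integrals are solved explicitly, by a geometric series in a S_tau0
    ([principalK]). The integral terms have a Lipschitz image, because N and M
    are piecewise C^1, so that they are approximated by operators of finite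
    rank. The Fredholm alternative follows: the kernel of (f, g) |-> D g + E f
    is finite-dimensional, and when it is trivial the equation is solvable for
    every r supported in ]0, tau0 + tau1] ([kernel_finite_dim],
    [bezout_solvable]). The solution gains regularity from the equation itself
    ([bezout_regular]).

    Triviality of the kernel ([kernel_trivial]). It consists of the pairs with
    F0 g^ + F1 f^ = 0. If (f^, g^) is one of them then so is
    ((f^ + c F0) / s, (g^ - c F1) / s), and for a suitable c the numerators
    vanish at s = 0, so that the quotients are again transforms of functions of
    bounded support. This linear action on a finite-dimensional space has an
    eigenvector if the space is not zero, over the complex numbers. For an
    eigenvalue mu = 1 / lam the eigenvector is, up to a factor 1 / mu, a
    multiple C of (D e, - E e) with e = exp (lam t) ([eigen_exponential]). Past
    the supports D e = F0(lam) e and E e = F1(lam) e, and by spectral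
    controllability one of them is not zero; hence C = 0. The eigenvalue 0 is
    excluded directly. *)

Set Implicit Arguments.
Unset Strict Implicit.
Unset Printing Implicit Defensive.
Import Order.TTheory GRing.Theory Num.Theory.
Import numFieldNormedType.Exports.

Local Open Scope classical_set_scope.
Local Open Scope ring_scope.

(** * Integrals of bounded functions with bounded support *)

Section Integrals.
Variable R : realType.
Local Notation mu := (@lebesgue_measure R).
Implicit Types f g : R -> R.

Lemma integrable_window f (C p q : R) : measurable_fun setT f ->
  (forall t, `|f t| <= C) -> (forall t, ~ (p <= t <= q) -> f t = 0) ->
  mu.-integrable setT (EFin \o f).
Proof.
move=> mf fC fs.
have -> : EFin \o f = (EFin \o f) \_ `[p, q].
  apply/funext => t; rewrite patchE; case: ifPn => // /negP tpq.
  by rewrite /= fs// => tpq'; apply: tpq; rewrite inE/= in_itv.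
apply: (iffLR (@integrable_mkcond _ _ _ mu `[p, q] (EFin \o f) _)) => //.
apply: measurable_bounded_integrable => //.
- by rewrite /= lebesgue_measure_itv/=; case: ifPn => //; rewrite -EFinD ltry.
- exact: measurable_funTS.
- exists C; split; first by rewrite num_real.
  by move=> M CM t _; exact: le_trans (fC t) (ltW CM).
Qed.

Lemma le_Rintegral_window f (C p q : R) : measurable_fun setT f -> p <= q ->
  (forall t, `|f t| <= C) -> (forall t, ~ (p <= t <= q) -> f t = 0) ->
  `|\int[mu]_t f t| <= C * (q - p).
Proof.
move=> mf pq fC fs.
have fi := integrable_window mf fC fs.
apply: le_trans (le_normr_Rintegral _ fi) _ => //.
have -> : C * (q - p) = \int[mu]_(t in `[p, q]) C.
  rewrite Rintegral_cst//= lebesgue_measure_itv/= lte_fin.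
  by case: ltgtP pq => //= ->; rewrite subrr ?mulr0.
rewrite [leRHS]Rintegral_mkcond; apply: le_Rintegral => //.
- exact: (integrable_abse fi).
- have C0 : 0 <= C by apply: le_trans (fC 0).
  apply: (@integrable_window _ C p q).
  + by apply/(measurable_restrictT _ _).1 => //; exact: measurable_cst.
  + by move=> t; rewrite patchE; case: ifP; rewrite ?normr0 // ger0_norm.
  + move=> t tpq; rewrite patchE; case: ifPn => //.
    by rewrite inE/= in_itv/= => /tpq.
- move=> t _; rewrite patchE; case: ifPn => // tpq.
  by rewrite fs ?normr0// => tpq'; move: tpq; rewrite notin_setE/= in_itv.
Qed.

Lemma reflect_measurable (c : R) : measurable_fun setT (fun y : R => c - y).
Proof. by exact: measurable_funB. Qed.

Definition reflect (c : R) : measurableTypeR R -> measurableTypeR R :=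
  fun y => c - y.
HB.instance Definition _ c :=
  isMeasurableFun.Build _ _ _ _ (reflect c) (@reflect_measurable c).

Lemma lebesgue_measure_reflect (c : R) (A : set (measurableTypeR R)) :
  measurable A -> pushforward mu (reflect c) A = mu A.
Proof.
move=> mA; apply/esym/lebesgue_measure_unique => //= _ [[a b]] _ <-.
rewrite /pushforward /=.
have -> : reflect c @^-1` `]a, b] = `[c - b, c - a[%classic.
  apply/seteqP; split=> y /=; rewrite /reflect !in_itv/=.
    by move=> /andP[? ?]; apply/andP; split; lra.
  by move=> /andP[? ?]; apply/andP; split; lra.
rewrite !lebesgue_measure_itv/= !lte_fin ltrD2l ltrN2.
by case: ifP => // _; rewrite -!EFinB; congr (_%:E); lra.
Qed.

Lemma Rintegral_reflect f (c : R) : mu.-integrable setT (EFin \o f) ->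
  \int[mu]_y f (c - y) = \int[mu]_y f y.
Proof.
move=> fi.
have mf : measurable_fun setT f by apply/measurable_EFinP; exact: measurable_int fi.
congr fine.
rewrite [RHS](eq_measure_integral (pushforward mu (reflect c))); last first.
  by move=> A mA _; exact/esym/lebesgue_measure_reflect.
rewrite integral_pushforward//; first exact/measurable_EFinP.
apply/integrableP; split.
  by apply/measurable_EFinP; apply: measurableT_comp => //; exact: reflect_measurable.
move/integrableP : fi => [_]; apply: le_lt_trans.
rewrite [leRHS](eq_measure_integral (pushforward mu (reflect c))) /=; last first.
  by move=> A mA _; exact/esym/lebesgue_measure_reflect.
rewrite ge0_integral_pushforward//.
by apply/measurable_EFinP; exact: measurableT_comp.
Qed.
End Integrals.

Section DoubleIntegrals.
Variable R : realType.
Local Notation mu := (@lebesgue_measure R).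
Implicit Types f g h : R -> R.

Lemma Rintegral_translate f (c : R) : mu.-integrable setT (EFin \o f) ->
  \int[mu]_y f (y - c) = \int[mu]_y f y.
Proof.
move=> fi; rewrite -[RHS](Rintegral_reflect 0 fi).
have mf : measurable_fun setT f by apply/measurable_EFinP; exact: measurable_int fi.
have fi' : mu.-integrable setT (EFin \o (fun y => f (0 - y))).
  apply/integrableP; split.
    by apply/measurable_EFinP; apply: measurableT_comp => //; exact: reflect_measurable.
  move/integrableP : fi => [_]; apply: le_lt_trans.
  rewrite [leRHS](eq_measure_integral (pushforward mu (reflect 0))) /=; last first.
    by move=> A mA _; exact/esym/lebesgue_measure_reflect.
  rewrite ge0_integral_pushforward//.
  by apply/measurable_EFinP; exact: measurableT_comp.
rewrite -(Rintegral_reflect c fi').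
by apply: eq_Rintegral => y _; congr f; ring.
Qed.

(** A bounded function supported in a square is integrable on the plane. *)
Lemma Rfubini (k : R -> R -> R) (C p q : R) :
  measurable_fun setT (fun z : R * R => k z.1 z.2) ->
  (forall x y, `|k x y| <= C) ->
  (forall x y, ~ (p <= x <= q /\ p <= y <= q) -> k x y = 0) ->
  \int[mu]_x \int[mu]_y k x y = \int[mu]_y \int[mu]_x k x y.
Proof.
move=> mk kC ks.
have mk1 x : measurable_fun setT (k x) by exact: (measurableT_comp mk (pair1_measurable x)).
have mk2 y : measurable_fun setT (k ^~ y) by exact: (measurableT_comp mk (pair2_measurable y)).
have C0 : 0 <= C by apply: le_trans (kC 0 0).
have ik1 x : mu.-integrable setT (EFin \o k x).
  by apply: (@integrable_window _ _ C p q) => // t tpq; apply: ks => -[].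
have ik2 y : mu.-integrable setT (EFin \o k ^~ y).
  by apply: (@integrable_window _ _ C p q) => // t tpq; apply: ks => -[].
have pk : (mu \x mu)%E.-integrable setT (fun z => (k z.1 z.2)%:E).
  have -> : (fun z : R * R => (k z.1 z.2)%:E) =
            (EFin \o (fun z => k z.1 z.2)) \_ (`[p, q] `*` `[p, q]).
    apply/funext => -[x y]; rewrite patchE; case: ifPn => // /negP.
    by rewrite inE/= !in_itv/= => xy; rewrite ks.
  apply: (iffLR (@integrable_mkcond _ _ _ (mu \x mu)%E (`[p, q] `*` `[p, q]) _ _)).
    exact: measurableX.
  apply: measurable_bounded_integrable => //.
  - exact: measurableX.
  - apply: (@le_lt_trans _ _ (mu `[p, q] * mu `[p, q])%E).
      by rewrite le_eqVlt; apply/orP; left; apply/eqP; exact: product_measure1E.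
    rewrite lte_mul_pinfty//.
    + by rewrite lebesgue_measure_itv/=; case: ifPn => //; rewrite -EFinD.
    + by rewrite lebesgue_measure_itv/=; case: ifPn => //; rewrite -EFinD ltry.
  - exact: measurable_funTS.
  - exists C; split; first by rewrite num_real.
    by move=> M CM t _; exact: le_trans (kC _ _) (ltW CM).
have e1 x : (\int[mu]_y k x y)%:E = (\int[mu]_y (k x y)%:E)%E.
  by rewrite /Rintegral fineK//; exact: (integrable_fin_num measurableT (ik1 x)).
have e2 y : (\int[mu]_x k x y)%:E = (\int[mu]_x (k x y)%:E)%E.
  by rewrite /Rintegral fineK//; exact: (integrable_fin_num measurableT (ik2 y)).
congr fine.
under eq_integral do rewrite e1.
under [RHS]eq_integral do rewrite e2.
exact: (Fubini pk).
Qed.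

Lemma measurable_Rintegral2 (k : R -> R -> R) :
  measurable_fun setT (fun z : R * R => k z.1 z.2) ->
  measurable_fun setT (fun x => \int[mu]_y k x y).
Proof.
move=> mk; apply: (measurableT_comp (fine_measurable measurableT)) => //.
have mE : measurable_fun setT (fun z : R * R => (k z.1 z.2)%:E) by exact/measurable_EFinP.
have -> : (fun x => \int[mu]_y (k x y)%:E)%E =
  ((fun x => \int[mu]_y ((fun z : R * R => (k z.1 z.2)%:E)^\+ (x, y)))
   \- (fun x => \int[mu]_y ((fun z : R * R => (k z.1 z.2)%:E)^\- (x, y))))%E.
  apply/funext=> x; rewrite [LHS]integralE.
  congr (_ - _)%E.
    by apply: eq_integral => y _; rewrite !unlock.
  by apply: eq_integral => y _; rewrite !unlock.
apply: emeasurable_funB.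
- apply: (measurable_fun_fubini_tonelli_F (m2 := mu)) => //.
  exact: measurable_funepos.
- apply: (measurable_fun_fubini_tonelli_F (m2 := mu)) => //.
  exact: measurable_funeneg.
Qed.

End DoubleIntegrals.

(** * Causal functions *)

Section CausalFunctions.
Variable R : realType.
Implicit Types f g h : R -> R.

(** Causal functions vanish at 0 too. Kernels thus live on intervals ]0, tau],
    whose translates by the delays are adjacent without overlapping, and the
    equations between kernels hold everywhere instead of almost everywhere. *)
Definition is_causal f := [/\ measurable_fun setT f,
  forall t, t <= 0 -> f t = 0 &
  forall T, exists C, forall t, t <= T -> `|f t| <= C].

Definition causal_pred : {pred R -> R} := mem [set f | is_causal f].

Lemma causal_submod_closed : submod_closed causal_pred.
Proof.
split.
  rewrite inE; split => //; first exact: measurable_cst.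
  by move=> T; exists 0 => t _; rewrite normr0.
move=> a f g; rewrite !inE => -[mf f0 fb] [mg g0 gb]; split.
- apply: measurable_funD => //.
  by apply: measurable_funM => //; exact: measurable_cst.
- by move=> t t0; rewrite !fctE f0// g0// scaler0 addr0.
- move=> T; have [C fC] := fb T; have [D gD] := gb T.
  exists (`|a| * C + D) => t tT; rewrite !fctE.
  by rewrite (le_trans (ler_normD _ _))// lerD ?gD// normrZ ler_wpM2l// fC.
Qed.
HB.instance Definition _ := GRing.isSubmodClosed.Build _ _ causal_pred
  causal_submod_closed.

Record cfun := CFun { cval :> R -> R; cvalP : cval \in causal_pred }.
HB.instance Definition _ := [isSub for cval].
HB.instance Definition _ := [Choice of cfun by <:].
HB.instance Definition _ := [SubChoice_isSubLmodule of cfun by <:].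

Lemma cfunP (f g : cfun) : f =1 g -> f = g.
Proof. by move=> fg; apply/val_inj/funext. Qed.

Lemma cfunD (f g : cfun) t : (f + g) t = f t + g t. Proof. by []. Qed.
Lemma cfunN (f : cfun) t : (- f) t = - f t. Proof. by []. Qed.
Lemma cfunZ a (f : cfun) t : (a *: f) t = a * f t. Proof. by []. Qed.
Lemma cfun0 t : (0 : cfun) t = 0. Proof. by []. Qed.
Definition cfunE := (cfunD, cfunN, cfunZ, cfun0).
Lemma cfun_sum I (r : seq I) P (F : I -> cfun) t :
  (\sum_(i <- r | P i) F i) t = \sum_(i <- r | P i) F i t.
Proof. by elim/big_rec2: _ => // i y1 y2 _ <-. Qed.

Lemma mkcfun f : is_causal f -> f \in causal_pred.
Proof. by rewrite inE. Qed.
Lemma cfun_causal (f : cfun) : is_causal f.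
Proof. by have := cvalP f; rewrite inE. Qed.
Lemma cfun_measurable (f : cfun) : measurable_fun setT f.
Proof. by case: (cfun_causal f). Qed.
Lemma cfun_le0 (f : cfun) t : t <= 0 -> f t = 0.
Proof. by case: (cfun_causal f) => _ f0 _; exact: f0. Qed.
Lemma cfun_bounded (f : cfun) T : exists2 C, 0 <= C & forall t, t <= T -> `|f t| <= C.
Proof.
have [_ _ /(_ T)[C fC]] := cfun_causal f; exists C => //.
by apply: le_trans (fC (Num.min T 0) _) => //; rewrite ge_min lexx.
Qed.

End CausalFunctions.

(** * Convolution *)

Section Convolution.
Variable R : realType.
Local Notation mu := (@lebesgue_measure R).
Local Notation cfun := (cfun R).
Implicit Types f g h : cfun.

(** End points are negligible. This reconciles the closed intervals of the
    plant and of the control law with the half-open supports of causal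
    functions. *)
Lemma Rintegral_cc (p q : R) (k h : R -> R) : measurable_fun setT h ->
  (forall t, p < t < q -> h t = k t) -> (forall t, t < p \/ q < t -> h t = 0) ->
  \int[mu]_(t in `[p, q]) k t = \int[mu]_t h t.
Proof.
move=> mh hk h0.
have eqo : {in `]p, q[%classic, k =1 h}.
  by move=> t; rewrite inE/= in_itv/= => /hk.
have mk : measurable_fun `]p, q[ k.
  apply: (eq_measurable_fun h); last exact: measurable_funTS.
  by move=> t tpq; rewrite eqo.
have mkc : measurable_fun `[p, q[ k by exact: (measurable_fun_itv_co mk).
transitivity (\int[mu]_(t in `]p, q[) k t).
  congr fine; rewrite -integral_itv_bndo_bndc; last exact/measurable_EFinP.
  by rewrite -integral_itv_obnd_cbnd//; apply/measurable_EFinP.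
transitivity (\int[mu]_(t in `]p, q[) h t); first exact: eq_Rintegral.
rewrite (_ : \int[mu]_t h t = \int[mu]_(t in `[p, q]) h t); last first.
  rewrite [RHS]Rintegral_mkcond; apply: eq_Rintegral => t _.
  rewrite patchE; case: ifPn => //; rewrite notin_setE/= in_itv/= => /negP.
  by rewrite negb_and -!ltNge => /orP /h0.
congr fine; rewrite -[RHS]integral_itv_bndo_bndc; last exact/measurable_EFinP/measurable_funTS.
by rewrite -[RHS]integral_itv_obnd_cbnd//; exact/measurable_EFinP/measurable_funTS.
Qed.

Definition convf (f g : cfun) (t : R) := \int[mu]_y (f y * g (t - y)).

Lemma measurable_convk f g :
  measurable_fun setT (fun z : R * R => f z.2 * g (z.1 - z.2)).
Proof.
apply: measurable_funM.
  by apply: measurableT_comp; [exact: cfun_measurable|exact: measurable_snd].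
apply: measurableT_comp; first exact: cfun_measurable.
by apply: measurable_funB; [exact: measurable_fst|exact: measurable_snd].
Qed.

Lemma measurable_conv_integrand f g t :
  measurable_fun setT (fun y => f y * g (t - y)).
Proof. exact: (measurableT_comp (measurable_convk f g) (pair1_measurable t)). Qed.

Lemma conv_integrand0 f g t y : ~ (0 <= y <= t) -> f y * g (t - y) = 0.
Proof.
move=> /negP; rewrite negb_and -!ltNge => /orP[y0|ty].
  by rewrite cfun_le0 ?mul0r// ltW.
by rewrite (@cfun_le0 _ g) ?mulr0// subr_le0 ltW.
Qed.

Lemma conv_integrand_le f g t A B : 0 <= A ->
  (forall s, s <= t -> `|f s| <= A) -> (forall s, s <= t -> `|g s| <= B) ->
  forall y, `|f y * g (t - y)| <= A * B.
Proof.
move=> A0 fA gB y; have [yt|yt] := boolP (0 <= y <= t).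
  move: yt => /andP[y0 yt]; rewrite normrM ler_pM ?fA ?gB// lerBlDr.
  by rewrite lerDl.
rewrite conv_integrand0; last exact/negP.
by rewrite normr0 mulr_ge0// (le_trans _ (gB t _)).
Qed.

Lemma conv_integrable f g t :
  mu.-integrable setT (EFin \o (fun y => f y * g (t - y))).
Proof.
have [A A0 fA] := cfun_bounded f t; have [B B0 gB] := cfun_bounded g t.
apply: (@integrable_window _ _ (A * B) 0 t).
- exact: measurable_conv_integrand.
- exact: conv_integrand_le.
- exact: conv_integrand0.
Qed.

Lemma convf_le f g t A B : 0 <= A -> 0 <= t ->
  (forall s, s <= t -> `|f s| <= A) -> (forall s, s <= t -> `|g s| <= B) ->
  `|convf f g t| <= A * B * t.
Proof.
move=> A0 t0 fA gB; rewrite -[t in leRHS]subr0.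
apply: le_Rintegral_window => //.
- exact: measurable_conv_integrand.
- exact: conv_integrand_le.
- exact: conv_integrand0.
Qed.

Lemma convf_causal f g : is_causal (convf f g).
Proof.
have c0 t : t <= 0 -> convf f g t = 0.
  move=> t0; rewrite /convf; under eq_Rintegral => y _.
    have -> : f y * g (t - y) = 0.
      have [y0|y0] := lerP y 0; first by rewrite cfun_le0// mul0r.
      by rewrite (@cfun_le0 _ g) ?mulr0// subr_le0 (le_trans t0)// ltW.
    over.
  by rewrite Rintegral_cst// mul0r.
split => //.
- exact: measurable_Rintegral2 (measurable_convk f g).
- move=> T; have [A A0 fA] := cfun_bounded f T; have [B B0 gB] := cfun_bounded g T.
  exists (A * B * `|T|) => t tT; have [t0|t0] := lerP t 0.
    by rewrite c0// normr0 !mulr_ge0.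
  apply: le_trans (convf_le A0 (ltW t0) _ _) _.
  + by move=> s st; apply: fA; exact: le_trans tT.
  + by move=> s st; apply: gB; exact: le_trans tT.
  + by rewrite ler_wpM2l ?mulr_ge0// (le_trans tT)// ler_norm.
Qed.

Definition conv f g : cfun := CFun (mkcfun (convf_causal f g)).
Local Notation "f ** g" := (conv f g) (at level 40, left associativity).

Lemma conv_le f g t A B : 0 <= A -> 0 <= t ->
  (forall s, s <= t -> `|f s| <= A) -> (forall s, s <= t -> `|g s| <= B) ->
  `|(f ** g) t| <= A * B * t.
Proof. exact: convf_le. Qed.

Lemma convC f g : f ** g = g ** f.
Proof.
apply: cfunP => t; rewrite /= /convf -(Rintegral_reflect t (conv_integrable g f t)).
by apply: eq_Rintegral => y _; rewrite mulrC; congr (g _ * f _); ring.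
Qed.

(** Both sides are the integral of f(z) g(y - z) h(t - y) over the simplex 0 <
    z < y < t. *)
Lemma convA f g h : f ** (g ** h) = f ** g ** h.
Proof.
apply: cfunP => t; rewrite /= /convf.
have [A A0 fA] := cfun_bounded f t; have [B B0 gB] := cfun_bounded g t.
have [C C0 hC] := cfun_bounded h t.
pose k (z y : R) := f z * g (y - z) * h (t - y).
transitivity (\int[mu]_z \int[mu]_y k z y).
  apply: eq_Rintegral => z _ /=; rewrite /convf.
  rewrite -(Rintegral_translate z (conv_integrable g h (t - z))).
  rewrite -RintegralZl//.
    apply: eq_Rintegral => y _; rewrite /k mulrA; congr (_ * h _); ring.
  have gi := conv_integrable g h (t - z).
  have [D D0 gD] := cfun_bounded g (t - z).
  have [E E0 hE] := cfun_bounded h (t - z).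
  apply: (@integrable_window _ _ (D * E) z t).
  - have m := measurable_conv_integrand g h (t - z).
    by apply: (measurableT_comp m); apply: measurable_funB => //; exact: measurable_cst.
  - by move=> y; exact: conv_integrand_le.
  - move=> y zyt; apply: conv_integrand0 => /andP[yz1 yz2]; apply: zyt.
    by apply/andP; split; lra.
transitivity (\int[mu]_y \int[mu]_z k z y); last first.
  apply: eq_Rintegral => y _; rewrite /= /convf -RintegralZr//.
  exact: conv_integrable.
have k0 z y : ~ (0 <= z <= t /\ 0 <= y <= t) -> k z y = 0.
  move=> zy; rewrite /k.
  have [z0|z0] := lerP z 0; first by rewrite cfun_le0// !mul0r.
  have [yz|yz] := lerP y z; first by rewrite (@cfun_le0 _ g) ?mulr0 ?mul0r// subr_le0.
  have [ty|ty] := lerP t y; first by rewrite (@cfun_le0 _ h) ?mulr0// subr_le0.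
  by exfalso; apply: zy; split; apply/andP; split; lra.
apply: (@Rfubini _ k (A * B * C) 0 t) => //.
- apply: measurable_funM.
    have -> : (fun z : R * R => f z.1 * g (z.2 - z.1)) =
      (fun z : R * R => f z.2 * g (z.1 - z.2)) \o (fun z => (z.2, z.1)) by [].
    apply: measurableT_comp; first exact: measurable_convk.
    by apply: measurable_fun_pair; [exact: measurable_snd|exact: measurable_fst].
  apply: measurableT_comp; first exact: cfun_measurable.
  by apply: measurable_funB; [exact: measurable_cst|exact: measurable_snd].
- move=> z y; have [[/andP[z0 zt] /andP[y0 yt]]|zy] := pselect (0 <= z <= t /\ 0 <= y <= t).
    rewrite /k !normrM !ler_pM ?mulr_ge0 ?fA ?gB ?hC//; lra.
  by rewrite k0// normr0 !mulr_ge0.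
Qed.

Lemma conv_is_linear f : linear (conv f).
Proof.
move=> a g h; apply: cfunP => t; rewrite !cfunE /= /convf -RintegralZl//; last first.
  exact: conv_integrable.
rewrite -RintegralD//.
- by apply: eq_Rintegral => y _; rewrite !cfunE; ring.
- have := conv_integrable f (a *: g) t; apply: eq_integrable => // y _ /=.
  by have -> : a * (f y * g (t - y)) = f y * (a * g (t - y)) by ring.
- exact: conv_integrable.
Qed.
HB.instance Definition _ f := GRing.isLinear.Build _ _ _ _ (conv f) (conv_is_linear f).

Lemma convDr f g h : f ** (g + h) = f ** g + f ** h. Proof. exact: linearD. Qed.
Lemma convBr f g h : f ** (g - h) = f ** g - f ** h. Proof. exact: linearB. Qed.
Lemma convZr a f g : f ** (a *: g) = a *: (f ** g). Proof. exact: linearZ. Qed.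
Lemma conv0r f : f ** 0 = 0. Proof. exact: linear0. Qed.
Lemma convNr f g : f ** (- g) = - (f ** g). Proof. exact: linearN. Qed.
Lemma convDl f g h : (g + h) ** f = g ** f + h ** f.
Proof. by rewrite convC convDr !(convC f). Qed.
Lemma convBl f g h : (g - h) ** f = g ** f - h ** f.
Proof. by rewrite convC convBr !(convC f). Qed.
Lemma convZl a f g : (a *: g) ** f = a *: (g ** f).
Proof. by rewrite convC convZr (convC f). Qed.
Lemma convNl f g : (- f) ** g = - (f ** g).
Proof. by rewrite convC convNr convC. Qed.
Lemma convCA f g h : f ** (g ** h) = g ** (f ** h).
Proof. by rewrite !convA (convC f). Qed.

Definition supp_le (T : R) f := forall t, T < t -> f t = 0.

Lemma supp_conv f g p q : supp_le p f -> supp_le q g -> supp_le (p + q) (f ** g).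
Proof.
move=> fp gq t tpq; rewrite /= /convf; under eq_Rintegral => y _.
  have -> : f y * g (t - y) = 0.
    have [py|yp] := ltP p y; first by rewrite fp// mul0r.
    by rewrite gq ?mulr0//; lra.
  over.
by rewrite Rintegral_cst// mul0r.
Qed.

(** Finitely many values, such as those at the jumps of a kernel, do not
    influence its convolutions. *)
Lemma conv_ae (D : seq R) f g h :
  (forall t, t \notin D -> f t = g t) -> f ** h = g ** h.
Proof.
move=> fg; apply: cfunP => t; congr fine.
apply: ae_eq_integral => //.
- exact: measurable_int (conv_integrable f h t).
- exact: measurable_int (conv_integrable g h t).
- exists [set` D]; split.
  + exact/countable_measurable/finite_set_countable/finite_seq.
  + exact/countable_lebesgue_measure0/finite_set_countable/finite_seq.
  + move=> y /= ney; apply: contrapT => yD; apply: ney => _.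
    by rewrite fg//; apply/negP.
Qed.

(** For p < 0 this shifts to the left and forgets the part of f that leaves
    the positive half-line. *)
Definition shiftf (p : R) (f : R -> R) (t : R) := if 0 < t then f (t - p) else 0.
Lemma shiftf_causal p f : is_causal (shiftf p f).
Proof.
split.
- apply: measurable_fun_ifT; [|apply: measurableT_comp|exact: measurable_cst].
  + by apply: measurable_fun_ltr => //; exact: measurable_cst.
  + exact: cfun_measurable.
  + by apply: measurable_funB => //; exact: measurable_cst.
- by move=> t t0; rewrite /shiftf ltNge t0.
- move=> T; have [A A0 fA] := cfun_bounded f (T - p); exists A => t tT.
  by rewrite /shiftf; case: ifP => _; rewrite ?normr0// fA// lerB.
Qed.
Definition shift p f : cfun := CFun (mkcfun (shiftf_causal p f)).

Lemma shiftE p f t : 0 <= p -> shift p f t = f (t - p).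
Proof.
move=> p0; rewrite /= /shiftf; case: ltP => // t0.
by rewrite cfun_le0// subr_le0 (le_trans t0).
Qed.

Lemma shift_is_linear p : linear (shift p).
Proof.
move=> a g h; apply: cfunP => t; rewrite /= /shiftf !fctE /=.
by case: ifP => // _; rewrite scaler0 addr0.
Qed.
HB.instance Definition _ p := GRing.isLinear.Build _ _ _ _ (shift p) (shift_is_linear p).

Lemma shift_conv p f g : 0 <= p -> f ** shift p g = shift p (f ** g).
Proof.
move=> p0; apply: cfunP => t; rewrite shiftE//= /convf.
by apply: eq_Rintegral => y _; rewrite shiftE//; congr (_ * g _); ring.
Qed.

Definition winf (p q : R) (f : R -> R) (t : R) := if p < t <= q then f t else 0.
Lemma winf_causal p q f : is_causal (winf p q f).
Proof.
split.
- apply: measurable_fun_ifT; [|exact: cfun_measurable|exact: measurable_cst].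
  apply: measurable_and; first by apply: measurable_fun_ltr => //; exact: measurable_cst.
  by apply: measurable_fun_ler => //; exact: measurable_cst.
- by move=> t t0; rewrite /winf cfun_le0// if_same.
- move=> T; have [A A0 fA] := cfun_bounded f T; exists A => t tT.
  by rewrite /winf; case: ifP => _; rewrite ?normr0// fA.
Qed.
Definition win p q f : cfun := CFun (mkcfun (winf_causal p q f)).

Lemma win_is_linear p q : linear (win p q).
Proof.
move=> a g h; apply: cfunP => t; rewrite /= /winf !fctE /=.
by case: ifP => // _; rewrite scaler0 addr0.
Qed.
HB.instance Definition _ p q := GRing.isLinear.Build _ _ _ _ (win p q) (win_is_linear p q).

(** Convolution with this Heaviside function is integration from 0. *)
Definition heavf (t : R) : R := if 0 < t then 1 else 0.
Lemma heavf_causal : is_causal heavf.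
Proof.
split.
- apply: measurable_fun_ifT; [|exact: measurable_cst..].
  by apply: measurable_fun_ltr => //; exact: measurable_cst.
- by move=> t t0; rewrite /heavf ltNge t0.
- by exists 1 => t _; rewrite /heavf; case: ifP; rewrite ?normr0 ?normr1.
Qed.
Definition heav : cfun := CFun (mkcfun heavf_causal).

Lemma heav_convE f t : (heav ** f) t = \int[mu]_(y in `[0, t]) f y.
Proof.
rewrite convC /= /convf; apply/esym/Rintegral_cc.
- exact: (measurable_conv_integrand f heav t).
- by move=> y /andP[y0 yt]; rewrite /= /heavf subr_gt0 yt mulr1.
- by move=> y yt; apply: conv_integrand0; case: yt => ? /andP[]; lra.
Qed.

Lemma convE f g t : (f ** g) t = \int[mu]_y (f y * g (t - y)). Proof. by []. Qed.
Lemma winE p q f t : win p q f t = if p < t <= q then f t else 0. Proof. by []. Qed.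
Lemma heavE t : heav t = if 0 < t then 1 else 0. Proof. by []. Qed.
Lemma shift0E p f t : shift p f t = if 0 < t then f (t - p) else 0. Proof. by []. Qed.

End Convolution.
Arguments cval : simpl never.
Notation "f ** g" := (conv f g) (at level 40, left associativity).

(** * The Fredholm alternative *)

Section Fredholm.
Variable R : realType.
Local Notation cfun := (cfun R).
Implicit Types (u v : cfun).

Lemma le_half_pow_eq0 (x D : R) : (forall n, `|x| <= D / 2 ^+ n) -> x = 0.
Proof.
move=> xD; apply/eqP; apply: contraT => x0.
have xp : 0 < `|x| by rewrite normr_gt0.
have D0 : 0 <= D by have := xD 0%N; rewrite expr0 divr1; apply: le_trans.
have := archi_boundP (divr_ge0 D0 (ltW xp)).
set n := Num.bound _ => Dn.
have := xD n; rewrite leNgt => /negP[]; rewrite ltr_pdivrMr ?exprn_gt0//.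
rewrite ltr_pdivrMr// in Dn.
apply: (lt_le_trans Dn); rewrite mulrC ler_wpM2l//.
by rewrite -natrX ler_nat ltnW// ltn_expl.
Qed.

Lemma supp_bounded T (u : cfun) : supp_le T u ->
  exists2 C, 0 <= C & forall t, `|u t| <= C.
Proof.
move=> uT; have [C C0 uC] := cfun_bounded u T; exists C => // t.
by have [tT|tT] := leP t T; [exact: uC|rewrite uT// normr0].
Qed.

Lemma supp_opp T (u : cfun) : supp_le T u -> supp_le T (- u).
Proof. by move=> uT t tT; rewrite cfunE uT// oppr0. Qed.

Lemma supp_add T (u v : cfun) : supp_le T u -> supp_le T v -> supp_le T (u + v).
Proof. by move=> uT vT t tT; rewrite cfunE uT// vT// addr0. Qed.

Lemma supp_scale T (a : R) (u : cfun) : supp_le T u -> supp_le T (a *: u).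
Proof. by move=> uT t tT; rewrite cfunE uT// mulr0. Qed.

Lemma supp_sum T n (F : 'I_n -> cfun) : (forall i, supp_le T (F i)) ->
  supp_le T (\sum_i F i).
Proof. by move=> FT t tT; rewrite cfun_sum big1// => i _; rewrite FT. Qed.

Section Neumann.
Variables (T : R) (L : {linear cfun -> cfun}).
Hypothesis Lsupp : forall u, supp_le T u -> supp_le T (L u).
Hypothesis Lhalf : forall u (c : R), supp_le T u -> (forall t, `|u t| <= c) ->
  forall t, `|L u t| <= c / 2.

(** Iterating u = - L u halves the bound on u for ever. *)
Lemma neumann_inj u : supp_le T u -> u + L u = 0 -> u = 0.
Proof.
move=> uT /eqP; rewrite addr_eq0 => /eqP uL; apply: cfunP => t.
have [C C0 uC] := supp_bounded uT.
suff H : forall n s, `|u s| <= C / 2 ^+ n by apply: (@le_half_pow_eq0 _ C) => n; exact: H.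
elim=> [|n IH] s; first by rewrite expr0 divr1.
rewrite uL cfunE normrN exprSr invfM mulrA; exact: Lhalf.
Qed.

Variable r : cfun.
Hypothesis rT : supp_le T r.
Let w n := iter n (fun u => - L u) r.
Let s n := \sum_(i < n) w i.

Let wT n : supp_le T (w n).
Proof. by elim: n => [|n IH] //=; exact/supp_opp/Lsupp. Qed.

Let sT n : supp_le T (s n). Proof. exact: supp_sum. Qed.

Let sS n : s n.+1 = r - L (s n).
Proof.
rewrite /s big_ord_recl /=; congr (_ + _).
by rewrite linear_sum -sumrN; apply: eq_bigr.
Qed.

(** The series r - L r + L (L r) - ... converges uniformly, its n-th term
    being bounded by C / 2^n; a uniform limit is again causal and supported in
    ]0, T], and this is used both to define the sum and to pass to the limit
    in the equation. *)
Lemma neumann_surj : exists2 u : cfun, supp_le T u & u + L u = r.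
Proof.
have [C C0 rC] := supp_bounded rT.
have wC n t : `|w n t| <= C / 2 ^+ n.
  elim: n t => [|n IH] t; first by rewrite expr0 divr1.
  by rewrite [w _]/(- L (w n)) cfunE normrN exprSr invfM mulrA; exact: Lhalf.
have sC n k t : `|s (n + k)%N t - s n t| <= 2 * C / 2 ^+ n - 2 * C / 2 ^+ (n + k).
  elim: k => [|k IH]; first by rewrite addn0 !subrr normr0.
  have -> : s (n + k.+1)%N t = s (n + k)%N t + w (n + k)%N t.
    by rewrite addnS /s big_ord_recr /= cfunE.
  rewrite addrAC; apply: (le_trans (ler_normD _ _)).
  have := wC (n + k)%N t; move: IH.
  rewrite addnS exprS.
  have p0 : (0 : R) < 2 ^+ (n + k) by rewrite exprn_gt0.
  rewrite invfM mulrA (_ : 2 * C * 2^-1 = C); first lra.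
  by field.
have sS1 n k t : `|s (n + k)%N t - s n t| <= 2 * C / 2 ^+ n.
  by apply: le_trans (sC n k t) _; rewrite lerBlDr lerDl divr_ge0 ?mulr_ge0//.
have cs t : cvgn (fun n => s n t).
  have -> : (fun n => s n t) = series (fun n => w n t).
    by apply/funext => n; rewrite /s cfun_sum /series /= big_mkord.
  apply: normed_cvg.
  apply: (@series_le_cvg _ _ (geometric C (2^-1))) => //.
  - by move=> n; exact: normr_ge0.
  - by move=> n; rewrite /= mulr_ge0// exprn_ge0// invr_ge0.
  - by move=> n; rewrite /= exprVn.
  - by apply: is_cvg_geometric_series; rewrite ger0_norm ?invr_ge0// invf_lt1// ltr1n.
pose U t := limn (fun n => s n t).
have UC t n : `|U t - s n t| <= 2 * C / 2 ^+ n.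
  apply/ler_addgt0Pr => e e0.
  have /cvgrPdist_le/(_ _ e0)[N _ /(_ (n + N)%N)] := cs t.
  rewrite /= leq_addl => /(_ isT) UN.
  have := sS1 n N t; rewrite -/(U t) in UN.
  have -> : U t - s n t = (U t - s (n + N)%N t) + (s (n + N)%N t - s n t) by ring.
  move=> h; apply: (le_trans (ler_normD _ _)); rewrite addrC; exact: lerD.
have U0 t : (forall n, s n t = 0) -> U t = 0.
  move=> h; apply: (@le_half_pow_eq0 _ (2 * C)) => n.
  by have := UC t n; rewrite h subr0.
have Uc : is_causal U.
  split.
  - apply: (@measurable_fun_cvg _ _ _ _ (fun n => s n : R -> R)) => //.
    + by move=> n; exact: cfun_measurable.
  - by move=> t t0; apply: U0 => n; rewrite cfun_le0.
  - move=> S; exists (2 * C) => t _; have := UC t 0%N.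
    by rewrite /s big_ord0 cfun0 subr0 expr0 divr1.
pose u : cfun := CFun (mkcfun Uc).
have uT : supp_le T u by move=> t tT; apply: U0 => n; exact: sT.
exists u => //; apply: cfunP => t.
apply/eqP; rewrite -subr_eq0; apply/eqP.
apply: (@le_half_pow_eq0 _ (2 * C)) => n.
have -> : (u + L u) t - r t = (u - s n.+1) t + (L (u - s n)) t.
  by rewrite linearB !cfunE sS !cfunE; ring.
apply: le_trans (ler_normD _ _) _.
have h1 : `|(u - s n.+1) t| <= 2 * C / 2 ^+ n.+1 by exact: UC.
have h2 : `|L (u - s n) t| <= 2 * C / 2 ^+ n / 2.
  apply: Lhalf; first by apply: supp_add => //; exact: supp_opp.
  by move=> t'; exact: UC.
apply: le_trans (lerD h1 h2) _; rewrite exprS invfM.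
have p0 : (2 : R) ^+ n != 0 by rewrite expf_neq0.
by rewrite le_eqVlt; apply/orP; left; apply/eqP; field.
Qed.
End Neumann.

Section Alternative.
Variables (T : R) (K : {linear cfun -> cfun}).
Hypothesis T0 : 0 < T.
Hypothesis Ksupp : forall u, supp_le T u -> supp_le T (K u).
Hypothesis Klip : exists2 C : R, 0 <= C & forall u (c : R), supp_le T u ->
  (forall t, `|u t| <= c) -> forall s t, 0 <= s <= t -> t <= T ->
  `|K u t - K u s| <= C * c * (t - s).

Section Grid.
Variables (h : R) (n : nat).
Hypothesis h0 : 0 < h.
Hypothesis hn : n%:R * h = T.

Let e (j : nat) : cfun := win (j%:R * h) (j.+1%:R * h) (heav R).
(** An operator of finite rank which is uniformly close to the identity on
    Lipschitz functions. *)
Definition sample u : cfun := \sum_(j < n) u (j%:R * h) *: e j.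

Let eE j t : 0 < t -> e j t = if j%:R * h < t <= j.+1%:R * h then 1 else 0.
Proof. by move=> t0; rewrite /e winE heavE t0. Qed.

Lemma grid_cell t : 0 < t <= T -> exists2 j : 'I_n, j%:R * h < t <= j.+1%:R * h &
  forall i : 'I_n, i%:R * h < t <= i.+1%:R * h -> i = j.
Proof.
move=> /andP[t0 tT].
have [j jt] : exists j : 'I_n, j%:R * h < t <= j.+1%:R * h.
  suff H m : t <= m%:R * h -> exists2 j, (j < m)%N & j%:R * h < t <= j.+1%:R * h.
    by have [|j jn jt] := H n; [rewrite hn|exists (Ordinal jn)].
  elim: m => [|m IH] tm; first by move: tm; rewrite mul0r leNgt t0.
  have [/IH[j jm jt]|tm'] := leP t (m%:R * h); first by exists j => //; exact: ltnW.
  by exists m => //; rewrite tm' tm.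
exists j => // i /andP[it ti]; case/andP: jt => jt tj.
have ij : (i < j.+1)%N by rewrite -(ltr_nat R) -(ltr_pM2r h0) (lt_le_trans it tj).
have ji : (j < i.+1)%N by rewrite -(ltr_nat R) -(ltr_pM2r h0) (lt_le_trans jt ti).
by apply/val_inj/eqP; rewrite eqn_leq; apply/andP.
Qed.

Lemma sampleE u t (j : 'I_n) : 0 < t <= T -> j%:R * h < t <= j.+1%:R * h ->
  sample u t = u (j%:R * h).
Proof.
move=> t0T jt; have /andP[t0 _] := t0T; have [k kt kU] := grid_cell t0T.
rewrite /sample cfun_sum (bigD1 j)//= big1 ?addr0.
  by rewrite !cfunE eE// jt mulr1.
move=> i ij; rewrite !cfunE eE//; case: ifP; rewrite ?mulr0// => it.
by move: ij; rewrite (kU _ it) (kU _ jt) eqxx.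
Qed.

Lemma sample_is_linear : linear sample.
Proof.
move=> a u v; rewrite /sample scaler_sumr -big_split /=; apply: eq_bigr => j _.
by rewrite !cfunE scalerDl scalerA.
Qed.

Lemma sample_supp u : supp_le T (sample u).
Proof.
apply: supp_sum => j t tT; rewrite cfunE winE; case: ifP; rewrite ?mulr0//.
move=> /andP[_ tj]; move: tT; rewrite ltNge (le_trans tj)// -hn.
by rewrite ler_wpM2r ?(ltW h0)// ler_nat.
Qed.

Lemma sample_dist u c : supp_le T u ->
  (forall s t, 0 <= s <= t -> t <= T -> `|u t - u s| <= c * (t - s)) -> 0 <= c ->
  forall t, `|u t - sample u t| <= c * h.
Proof.
move=> uT ul c0 t; have [t0|t0] := lerP t 0.
  by rewrite !cfun_le0// subrr normr0 mulr_ge0// ltW.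
have [tT|tT] := leP t T; last first.
  by rewrite uT// sample_supp// subrr normr0 mulr_ge0// ltW.
have t0T : 0 < t <= T by rewrite t0.
have [j jt _] := grid_cell t0T; rewrite (sampleE _ t0T jt).
case/andP: jt => jt tj; apply: le_trans (ul _ _ _ tT) _.
  by rewrite (ltW jt) andbT mulr_ge0// ltW.
by rewrite ler_wpM2l//; move: tj; rewrite -natr1 mulrDl mul1r; lra.
Qed.
End Grid.

HB.instance Definition _ h n := GRing.isLinear.Build _ _ _ _ (sample h n)
  (sample_is_linear h n).

(** For a step of size h, the oscillation of the Lipschitz function K u on a
    cell is at most C c h, which is at most c / 2 for h small. *)
Let grid : exists h n, [/\ 0 < h, n%:R * h = T &
  forall u (c : R), supp_le T u -> (forall t, `|u t| <= c) ->
  forall t, `|(K u - sample h n (K u)) t| <= c / 2].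
Proof.
have [C C0 KC] := Klip.
(* This many cells make C c T / n at most c / 2. *)
pose n := (Num.bound (2 * C * T)).+1.
have n0 : (0 : R) < n%:R by rewrite ltr0n.
exists (T / n%:R), n; split; first by rewrite divr_gt0.
  by rewrite mulrC divfK// gt_eqF.
move=> u c uT uc t.
have c0 : 0 <= c by apply: le_trans (uc 0).
rewrite !cfunE; apply: (@le_trans _ _ (C * c * (T / n%:R))).
  apply: sample_dist; rewrite ?divr_gt0 ?mulr_ge0//.
  - by rewrite mulrC divfK// gt_eqF.
  - exact: Ksupp.
  - by move=> s t' st tT; exact: KC.
have : 2 * C * T <= n%:R.
  rewrite ltW// (lt_le_trans (archi_boundP _))//.
    by rewrite !mulr_ge0// ltW.
  by rewrite ler_nat.
move=> CTn; rewrite mulrA ler_pdivrMr//.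
have : c * (2 * C * T) <= c * n%:R by rewrite ler_wpM2l.
lra.
Qed.

(** The coordinates are the values of K u on the grid: when they vanish, K u
    is its own distance to its step interpolation, so that u is in the kernel
    of a perturbation of the identity of norm at most 1 / 2. *)
Lemma fredholm_kernel : exists n (phi : cfun -> 'rV[R]_n), linear phi /\
  forall u, supp_le T u -> u + K u = 0 -> phi u = 0 -> u = 0.
Proof.
have [h [n [h0 hn KQ]]] := grid.
exists n, (fun u => \row_j K u (j%:R * h)); split.
  by move=> a u v; apply/rowP => j; rewrite !mxE linearP !cfunE.
move=> u uT uK phi0.
have Q0 : sample h n (K u) = 0.
  rewrite /sample big1// => j _.
  by move/rowP/(_ j) : phi0; rewrite !mxE => ->; rewrite scale0r.
apply: (@neumann_inj T (K \- (sample h n \o K))) => //.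
by rewrite /= [X in _ + X](_ : _ = K u - sample h n (K u))// Q0 subr0.
Qed.

(** Put L = K - sample o K, so that 1 + L is invertible. With e j the
    indicator of the j-th cell and s j = (1 + L)^-1 (e j), the equation u + K
    u = r becomes a square linear system for the values of K u on the grid.
    Injectivity of 1 + K makes this system invertible. *)
Lemma fredholm_surj : (forall u, supp_le T u -> u + K u = 0 -> u = 0) ->
  forall r, supp_le T r -> exists2 u : cfun, supp_le T u & u + K u = r.
Proof.
move=> Kinj r rT; have [h [n [h0 hn KQ]]] := grid.
have [L LE] : exists L : {linear cfun -> cfun}, forall u, L u = K u - sample h n (K u).
  by exists (K \- (sample h n \o K)).
have Lsupp u : supp_le T u -> supp_le T (L u).
  move=> uT; rewrite LE; apply: supp_add; first exact: Ksupp.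
  by apply: supp_opp; exact: sample_supp.
have Lhalf u (c : R) : supp_le T u -> (forall t, `|u t| <= c) ->
  forall t, `|L u t| <= c / 2 by rewrite LE; exact: KQ.
pose e (j : 'I_n) : cfun := win (j%:R * h) (j.+1%:R * h) (heav R).
have eT j : supp_le T (e j).
  move=> t tT; rewrite winE; case: ifP => // /andP[_ tj].
  move: tT; rewrite ltNge (le_trans tj)// -hn.
  by rewrite ler_wpM2r ?(ltW h0)// ler_nat.
have [s sP] : exists s : 'I_n -> cfun, forall j, supp_le T (s j) /\ s j + L (s j) = e j.
  suff H j : exists u : cfun, supp_le T u /\ u + L u = e j.
    by have [s sP] := boolp.choice H; exists s.
  by have [u uT uE] := neumann_surj Lsupp Lhalf (eT j); exists u.
have [s0 s0T s0E] := neumann_surj Lsupp Lhalf rT.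
pose A : 'M[R]_n := \matrix_(j, i) K (s j) (i%:R * h).
pose comb (y : 'rV[R]_n) := \sum_j y 0 j *: s j.
have combT y : supp_le T (comb y).
  by apply: supp_sum => j; apply: supp_scale; case: (sP j).
have combL y : comb y + L (comb y) = \sum_j y 0 j *: e j.
  rewrite /comb linear_sum -big_split /=; apply: eq_bigr => j _.
  by rewrite linearZ -scalerDr; case: (sP j) => _ ->.
have combK (y : 'rV[R]_n) (i : 'I_n) : K (comb y) (i%:R * h) = (y *m A) 0 i.
  rewrite /comb linear_sum cfun_sum mxE; apply: eq_bigr => j _.
  by rewrite linearZ cfunE mxE.
have KE u : u + K u = (u + L u) + \sum_(j < n) K u (j%:R * h) *: e j.
  by rewrite LE -[\sum_(j < n) _]/(sample h n (K u)) -addrA subrK.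
have Aunit : 1%:M + A \in unitmx.
  rewrite -row_free_unit; apply: inj_row_free => y.
  rewrite mulmxDr mulmx1 => /eqP; rewrite addr_eq0 => /eqP yA.
  have u0 : - comb y = 0.
    apply: Kinj; first exact: supp_opp.
    rewrite linearN -opprD KE combL -big_split big1 ?oppr0//= => j _.
    have yj : y 0 j = - (y *m A) 0 j by rewrite {1}yA mxE.
    by rewrite combK yj -scalerDl addNr scale0r.
  apply/rowP => i; rewrite yA mxE -combK.
  by move/eqP : u0; rewrite oppr_eq0 => /eqP ->; rewrite linear0 cfun0 oppr0 mxE.
pose y := (\row_i K s0 (i%:R * h)) *m invmx (1%:M + A).
have yE i : y 0 i + (y *m A) 0 i = K s0 (i%:R * h).
  have : y *m (1%:M + A) = \row_i K s0 (i%:R * h) by rewrite mulmxKV.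
  by rewrite mulmxDr mulmx1 => /rowP/(_ i); rewrite !mxE.
exists (s0 - comb y); first by apply: supp_add => //; exact: supp_opp.
rewrite KE linearB addrACA -opprD combL s0E.
rewrite -addrA -[RHS]addr0; congr (_ + _).
rewrite -sumrN -big_split big1//= => j _.
rewrite linearB !cfunE combK -yE addrK.
by rewrite addNr.
Qed.

End Alternative.
End Fredholm.

(** * Piecewise regular functions *)

Section PiecewiseClasses.
Variable R : realType.
Local Notation mu := (@lebesgue_measure R).
Implicit Types (f g : R -> R) (p q u v t : R).

Lemma extends_sub p q p' q' f : p <= p' -> q' <= q ->
  extends_continuously p q f -> extends_continuously p' q' f.
Proof.
move=> pp qq [h [ch fh]]; exists h; split.
  apply: continuous_subspaceW ch => t /=; rewrite !in_itv/= => /andP[? ?].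
  by apply/andP; split; lra.
move=> t; rewrite in_itv/= => /andP[? ?]; apply: fh; rewrite in_itv/=.
by apply/andP; split; lra.
Qed.

Lemma extends_eq p q f g : {in `]p, q[, f =1 g} ->
  extends_continuously p q f -> extends_continuously p q g.
Proof.
by move=> fg [h [ch fh]]; exists h; split => // t tpq; rewrite -fg// fh.
Qed.

Lemma extends_lin p q a f g : extends_continuously p q f ->
  extends_continuously p q g -> extends_continuously p q (fun t => a * f t + g t).
Proof.
move=> [h [ch fh]] [k [ck gk]]; exists ((cst a \* h) + k); split.
  apply: within_continuousD => // x; apply: cvgM; first exact: cvg_cst.
  exact: ch.
by move=> t tpq /=; rewrite fh// gk.
Qed.

Lemma extends_continuous p q f : {within `[p, q], continuous f} ->
  extends_continuously p q f.
Proof. by exists f. Qed.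

Lemma extends_cont_at p q f t : extends_continuously p q f -> p < t < q ->
  {for t, continuous f}.
Proof.
move=> [h [ch fh]] tpq; have pq : p < q by move/andP: tpq => [? ?]; lra.
have ht : {for t, continuous h}.
  by apply: (within_continuous_continuous pq ch); rewrite in_itv.
have nt : \forall s \near t, h s = f s.
  have := near_in_itvoo; move=> /(_ _ p q t); rewrite in_itv/= => /(_ tpq).
  by apply: filterS => s sp; rewrite fh.
rewrite /prop_for /continuous_at -(nbhs_singleton nt).
by apply: cvg_trans ht; exact: near_eq_cvg.
Qed.

Lemma extends_window p q f : p < q -> extends_continuously p q f ->
  measurable_fun setT (winf p q f) /\ exists C, forall t, `|winf p q f t| <= C.
Proof.
move=> pq [h [ch fh]].
have mh : measurable_fun `[p, q] h.
  by apply: subspace_continuous_measurable_fun => //; exact: measurable_itv.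
have E : winf p q f = (h \_ `]p, q[) \+ (fun t => f q * \1_[set q] t).
  apply/funext => t; rewrite /winf /= patchE indicE.
  have [->|tq] := eqVneq t q.
    rewrite pq lexx/= memNset ?add0r; last by rewrite /= in_itv/= ltxx andbF.
    by rewrite mem_set// mulr1.
  rewrite [t \in [set q]]memNset/= ?mulr0 ?addr0; last exact/eqP.
  case: ifPn => tpq.
    have tpq' : t \in `]p, q[ by rewrite in_itv/= [t < q]lt_neqAle tq; move/andP: tpq => [-> ->].
    by rewrite mem_set//= fh.
  rewrite memNset//= in_itv/= => /andP[pt tq']; move: tpq.
  by rewrite pt ltW.
split.
  rewrite E; apply: measurable_funD.
    apply/(measurable_restrictT _ _).1 => //.
    by apply: measurable_funS mh => //; exact: subset_itv_oo_cc.
  by apply: measurable_funM; [exact: measurable_cst|exact: measurable_indic].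
have /compact_bounded[M [_ hM]] : compact (h @` `[p, q]).
  by apply: continuous_compact => //; exact: segment_compact.
exists (`|M| + 1 + `|f q|) => t; rewrite E /=.
apply: le_trans (ler_normD _ _) _; apply: lerD.
  rewrite patchE; case: ifPn => [|_]; last by rewrite normr0 addr_ge0.
  rewrite inE/= => tpq; apply: (hM (`|M| + 1)).
    by rewrite ltr_pwDr// ler_norm.
  by exists t => //; exact: subset_itv_oo_cc.
by rewrite normrM ler_piMr// indicE; case: (_ \in _); rewrite ?normr0 ?normr1.
Qed.

Lemma winf_cat p q u f : p <= q -> q <= u ->
  winf p u f = winf p q f \+ winf q u f.
Proof.
move=> pq qu; apply/funext => t; rewrite /winf /=.
have [pt|tp] := ltP p t; have [tq|qt] := leP t q => /=; rewrite ?addr0 ?add0r.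
- by rewrite (le_trans tq).
- by [].
- by have : t <= u by lra; move=> ->; rewrite ?ltNge ?tq.
- lra.
Qed.

(** Induction on the subdivision, for a property Q of intervals that follows
    from P and is stable under juxtaposition. *)
Lemma piecewise_glue (P Q : R -> R -> Prop) u v :
  (forall p q, u <= p -> q <= v -> p < q -> P p q -> Q p q) ->
  (forall p q r, u <= p -> p < q -> q < r -> Q p q -> Q q r -> Q p r) ->
  u < v -> piecewise P u v -> Q u v.
Proof.
move=> PQ QQ uv [s [su sP]].
elim: s u uv su sP PQ QQ => [|x s IH] u uv su sP PQ QQ.
  by move: uv; rewrite (itv_partition_nil su) ltxx.
have ux : u < x by case: su => /= /andP[].
have sx := itv_partition_cons su.
have xv := itv_partition_le sx.
have Qux : Q u x by apply: PQ => //; exact: (sP 0%N).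
have [xv'|xv'] := eqVneq x v; first by rewrite -xv'.
have {}xv : x < v by rewrite lt_neqAle xv' xv.
apply: (QQ u x v) => //; apply: IH => //.
- by move=> i i_s; exact: (sP i.+1).
- by move=> p q xp; apply: PQ; lra.
- by move=> p q r xp; apply: QQ; lra.
Qed.

Definition free_of (D : seq R) p q := forall d, d \in D -> ~ (p < d < q).
(** The property P holds on every interval that avoids some finite set of
    break points. Contrary to the subdivisions of a given interval, such sets
    can be translated and merged freely, which makes the classes below stable
    under sums, delays and truncations. *)
Definition pwC (P : R -> R -> Prop) :=
  exists D : seq R, forall p q, p < q -> free_of D p q -> P p q.
Definition pwC0 f := pwC (fun p q => extends_continuously p q f).
Definition pwC1 f := pwC (fun p q => C1_piece p q f).

Lemma pwC2 (P Q S : R -> R -> Prop) (E : seq R) :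
  (forall p q, p < q -> free_of E p q -> P p q -> Q p q -> S p q) ->
  pwC P -> pwC Q -> pwC S.
Proof.
move=> H [D PD] [D' QD]; exists (E ++ D ++ D') => p q pq fr.
have fr1 : free_of E p q by move=> d dE; apply: fr; rewrite !mem_cat dE.
have fr2 : free_of D p q by move=> d dE; apply: fr; rewrite !mem_cat dE orbT.
have fr3 : free_of D' p q by move=> d dE; apply: fr; rewrite !mem_cat dE !orbT.
by apply: H => //; [exact: PD|exact: QD].
Qed.

Lemma pwC_imp (P S : R -> R -> Prop) (E : seq R) :
  (forall p q, p < q -> free_of E p q -> P p q -> S p q) -> pwC P -> pwC S.
Proof. by move=> H PP; apply: (@pwC2 P P S E) => // p q pq fr _; exact: H. Qed.

(** A derivative given by an arbitrary function is easier to transport than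
    the one computed by derive1. *)
Lemma C1_pieceP p q f : C1_piece p q f <-> exists d : R -> R,
  [/\ {in `]p, q[, forall t, is_derive t 1 f (d t)},
     extends_continuously p q f & extends_continuously p q d].
Proof.
split=> [[f1 f2 f3 f4]|[d [fd fe de]]].
  by exists (derive1 f); split => // t tpq; apply: DeriveDef; [exact: f1|rewrite derive1E].
have dE : {in `]p, q[, d =1 derive1 f}.
  by move=> t /fd [_ <-]; rewrite derive1E.
have fe' := extends_eq dE de.
split => //; first by move=> t /fd [].
by move=> t; rewrite in_itv/= => tpq; exact: (extends_cont_at fe' tpq).
Qed.

Lemma C1_piece_eq p q f g : {in `]p, q[, f =1 g} -> C1_piece p q f -> C1_piece p q g.
Proof.
move=> fg /C1_pieceP[d [fd fe de]]; apply/C1_pieceP; exists d; split => //.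
  move=> t tpq; apply: near_eq_is_derive (fd _ tpq) => //.
  have := near_in_itvoo tpq; apply: filterS => s sp; exact: fg.
exact: extends_eq fe.
Qed.

Lemma C1_piece_lin p q a f g : C1_piece p q f -> C1_piece p q g ->
  C1_piece p q (fun t => a * f t + g t).
Proof.
move=> /C1_pieceP[d [fd fe de]] /C1_pieceP[d' [gd ge de']].
apply/C1_pieceP; exists (fun t => a * d t + d' t); split.
- move=> t tpq; have h1 := fd _ tpq; have h2 := gd _ tpq.
  exact: (is_deriveD (is_deriveZ a h1) h2).
- exact: extends_lin.
- exact: extends_lin.
Qed.

Lemma C1_piece_sub p q p' q' f : p <= p' -> q' <= q ->
  C1_piece p q f -> C1_piece p' q' f.
Proof.
move=> pp qq /C1_pieceP[d [fd fe de]]; apply/C1_pieceP; exists d; split.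
- move=> t; rewrite in_itv/= => /andP[? ?]; apply: fd; rewrite in_itv/=.
  by apply/andP; split; lra.
- exact: extends_sub fe.
- exact: extends_sub de.
Qed.

Lemma within_continuous_shift p q a (m : R -> R) :
  {within `[p - a, q - a], continuous m} ->
  {within `[p, q], continuous (fun t => m (t - a))}.
Proof.
move=> /subspace_continuousP cm; apply/subspace_continuousP => x /=.
rewrite in_itv/= => /andP[px xq].
have xa : `[p - a, q - a]%classic (x - a).
  by rewrite /= in_itv/=; apply/andP; split; lra.
have cx : (fun t : R => t - a) @ x --> x - a.
  by apply: cvgB; [exact: cvg_id|exact: cvg_cst].
apply/cvgrPdist_lt => e e0; have /cvgrPdist_lt/(_ e e0) := cm _ xa.
rewrite !near_withinE => /cx; rewrite nbhs_simpl /=; apply: filterS => t H tpq.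
apply: H; move: tpq; rewrite /= !in_itv/= => /andP[? ?].
by apply/andP; split; lra.
Qed.

Lemma extends_shift p q a f : extends_continuously (p - a) (q - a) f ->
  extends_continuously p q (fun t => f (t - a)).
Proof.
move=> [h [ch fh]]; exists (fun t => h (t - a)); split.
  exact: within_continuous_shift.
move=> t; rewrite in_itv/= => /andP[? ?]; apply: fh; rewrite in_itv/=.
by apply/andP; split; lra.
Qed.

Lemma C1_piece_shift p q a f : C1_piece (p - a) (q - a) f ->
  C1_piece p q (fun t => f (t - a)).
Proof.
move=> /C1_pieceP[d [fd fe de]].
apply/C1_pieceP; exists (fun t => d (t - a)); split; last 2 first.
- exact: extends_shift.
- exact: extends_shift.
move=> t; rewrite in_itv/= => /andP[? ?].
have h1 : is_derive (t - a) 1 f (d (t - a)).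
  by apply: fd; rewrite in_itv/=; apply/andP; split; lra.
have h2 : is_derive t (1 : R) (fun t : R => t - a) 1.
  by have := @is_derive_shift R t 1 (- a).
have := is_derive1_comp (f := f) (g := fun t : R => t - a) h1 h2.
by rewrite mulr1.
Qed.

Lemma pwC0_lin a f g : pwC0 f -> pwC0 g -> pwC0 (fun t => a * f t + g t).
Proof. by apply: (@pwC2 _ _ _ [::]) => p q _ _; exact: extends_lin. Qed.
Lemma pwC1_lin a f g : pwC1 f -> pwC1 g -> pwC1 (fun t => a * f t + g t).
Proof. by apply: (@pwC2 _ _ _ [::]) => p q _ _; exact: C1_piece_lin. Qed.

Lemma pwC_eq (P : (R -> R) -> R -> R -> Prop) (E : seq R) f g :
  (forall p q, {in `]p, q[, f =1 g} -> P f p q -> P g p q) ->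
  (forall t, t \notin E -> f t = g t) -> pwC (P f) -> pwC (P g).
Proof.
move=> H fg; apply: (@pwC_imp _ _ E) => p q pq fr; apply: H => t.
by rewrite in_itv/= => tpq; apply: fg; apply/negP => /fr; apply.
Qed.
Lemma pwC0_eq (E : seq R) f g : (forall t, t \notin E -> f t = g t) -> pwC0 f -> pwC0 g.
Proof. by apply: (@pwC_eq (fun f p q => extends_continuously p q f)) => p q; exact: extends_eq. Qed.
Lemma pwC1_eq (E : seq R) f g : (forall t, t \notin E -> f t = g t) -> pwC1 f -> pwC1 g.
Proof. by apply: (@pwC_eq (fun f p q => C1_piece p q f)) => p q; exact: C1_piece_eq. Qed.

Lemma pwC_shift (P : (R -> R) -> R -> R -> Prop) a f :
  (forall p q, P f (p - a) (q - a) -> P (fun t => f (t - a)) p q) ->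
  pwC (P f) -> pwC (P (fun t => f (t - a))).
Proof.
move=> H [D PD]; exists [seq d + a | d <- D] => p q pq fr; apply: H.
apply: PD; first by lra.
move=> d dD /andP[? ?]; apply: (fr (d + a)); first exact: map_f.
by apply/andP; split; lra.
Qed.
Lemma pwC0_shift a f : pwC0 f -> pwC0 (fun t => f (t - a)).
Proof. by apply: (@pwC_shift (fun f p q => extends_continuously p q f)) => p q; exact: extends_shift. Qed.
Lemma pwC1_shift a f : pwC1 f -> pwC1 (fun t => f (t - a)).
Proof. by apply: (@pwC_shift (fun f p q => C1_piece p q f)) => p q; exact: C1_piece_shift. Qed.

Lemma extends_cst p q (c : R) : extends_continuously p q (cst c).
Proof.
by exists (cst c); split => //; apply: continuous_subspaceT => x; exact: cvg_cst.
Qed.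
Lemma C1_piece_cst p q (c : R) : C1_piece p q (cst c).
Proof.
apply/C1_pieceP; exists (cst 0); split; [|exact: extends_cst..].
by move=> t _; exact: is_derive_cst.
Qed.

Lemma pwC_win (P : (R -> R) -> R -> R -> Prop) u v f :
  (forall p q, P (cst 0) p q) ->
  (forall p q g h, {in `]p, q[, g =1 h} -> P g p q -> P h p q) ->
  pwC (P f) -> pwC (P (winf u v f)).
Proof.
move=> P0 PE; apply: (@pwC_imp _ _ [:: u; v]) => p q pq fr Pf.
have fu : u <= p \/ q <= u.
  have : ~ (p < u < q) by apply: fr; rewrite !inE eqxx.
  by move/negP; rewrite negb_and -!leNgt => /orP.
have fv : v <= p \/ q <= v.
  have : ~ (p < v < q) by apply: fr; rewrite !inE eqxx orbT.
  by move/negP; rewrite negb_and -!leNgt => /orP.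
have out : (q <= u \/ v <= p) -> P (winf u v f) p q.
  move=> uv; apply: (PE _ _ (cst 0)) => // t; rewrite in_itv/= => /andP[pt tq].
  by rewrite /winf; case: ifPn => // /andP[ut tv]; case: uv; lra.
case: fu => [up|]; last by move=> ?; apply: out; left.
case: fv => [|qv]; first by move=> ?; apply: out; right.
apply: (PE _ _ f) => // t; rewrite in_itv/= => /andP[pt tq].
by rewrite /winf ifT//; apply/andP; split; lra.
Qed.
Lemma pwC0_win u v f : pwC0 f -> pwC0 (winf u v f).
Proof.
by apply: (@pwC_win (fun f p q => extends_continuously p q f)) =>
  [p q|p q g h]; [exact: extends_cst|exact: extends_eq].
Qed.
Lemma pwC1_win u v f : pwC1 f -> pwC1 (winf u v f).
Proof.
by apply: (@pwC_win (fun f p q => C1_piece p q f)) =>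
  [p q|p q g h]; [exact: C1_piece_cst|exact: C1_piece_eq].
Qed.

Lemma pwC1_pwC0 f : pwC1 f -> pwC0 f.
Proof. by apply: (@pwC_imp _ _ [::]) => p q _ _ []. Qed.

Lemma continuous_pwC0 f : continuous f -> pwC0 f.
Proof.
move=> cf; exists [::] => p q _ _; apply: extends_continuous.
by apply: continuous_subspaceT => x; exact: cf.
Qed.

Lemma piece_pwC1 p q f : C1_piece p q f -> pwC1 (winf p q f).
Proof.
move=> fe; exists [:: p; q] => p' q' pq fr.
have fu : p <= p' \/ q' <= p.
  have : ~ (p' < p < q') by apply: fr; rewrite !inE eqxx.
  by move/negP; rewrite negb_and -!leNgt => /orP.
have fv : q <= p' \/ q' <= q.
  have : ~ (p' < q < q') by apply: fr; rewrite !inE eqxx orbT.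
  by move/negP; rewrite negb_and -!leNgt => /orP.
have out : (q' <= p \/ q <= p') -> C1_piece p' q' (winf p q f).
  move=> uv; apply: (@C1_piece_eq _ _ (cst 0)); last exact: C1_piece_cst.
  move=> t; rewrite in_itv/= => /andP[pt tq].
  by rewrite /winf; case: ifPn => // /andP[ut tv]; case: uv; lra.
case: fu => [up|]; last by move=> ?; apply: out; left.
case: fv => [|qv]; first by move=> ?; apply: out; right.
apply: (@C1_piece_eq _ _ f); last exact: C1_piece_sub fe.
move=> t; rewrite in_itv/= => /andP[pt tq].
by rewrite /winf ifT//; apply/andP; split; lra.
Qed.

(** The break points inside ]u, v[, once sorted and followed by v, form a
    subdivision of [u, v]. *)
Lemma pwC_piecewise (P : R -> R -> Prop) u v : u < v -> pwC P -> piecewise P u v.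
Proof.
move=> uv [D PD].
pose E := [seq d <- D | u < d < v].
pose s := sort <=%O (undup (v :: E)).
have us : uniq s by rewrite sort_uniq undup_uniq.
have ss : sorted <%O s by rewrite lt_sorted_uniq_le us sort_sorted//; exact: le_total.
have ms x : x \in s = (x == v) || (x \in E) by rewrite mem_sort mem_undup inE.
have us' x : x \in s -> u < x <= v.
  rewrite ms => /orP[/eqP ->|]; first by rewrite uv lexx.
  by rewrite mem_filter => /andP[/andP[-> /ltW]].
have vs : v \in s by rewrite ms eqxx.
have ps : sorted <%O (u :: s).
  by rewrite /= lt_path_sortedE ss andbT; apply/allP => x /us' /andP[].
have lv : last u s = v.
  have ls : last u s <= v.
    by have := mem_last u s; rewrite inE => /orP[/eqP ->|/us' /andP[]//]; exact: ltW.
  apply/eqP; rewrite eq_le ls /=.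
  have vin : v \in u :: s by rewrite inE vs orbT.
  rewrite -[leLHS](nth_index v vin) (last_nth v).
  have vi : (index v (u :: s) < (size s).+1)%N by rewrite -/(size (u :: s)) index_mem.
  by rewrite (lt_sorted_leq_nth v ps) ?inE.
exists s; split; first by split => //; rewrite lv.
move=> i is_.
have pq : nth v (u :: s) i < nth v (u :: s) i.+1.
  by rewrite (lt_sorted_ltn_nth v ps) ?inE/= ?ltnS// ltnW.
apply: PD => // d dD /andP[pd dq].
have up : u <= nth v (u :: s) i.
  by rewrite -[leLHS]/(nth v (u :: s) 0) (lt_sorted_leq_nth v ps) ?inE/= ?ltnS// ltnW.
have qv : nth v s i <= v by have := us' _ (mem_nth v is_) => /andP[].
have din : d \in u :: s.
  rewrite inE ms mem_filter dD.
  by rewrite (le_lt_trans up pd) (lt_le_trans dq qv) !orbT.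
move: pd dq; rewrite -(nth_index v din) -[nth v s i]/(nth v (u :: s) i.+1).
have jd : (index d (u :: s) < (size s).+1)%N by rewrite -/(size (u :: s)) index_mem.
rewrite !(lt_sorted_ltn_nth v ps) ?inE ?ltnS//=; last exact: ltnW.
by move=> ij; rewrite leqNgt ij.
Qed.

End PiecewiseClasses.

(** * Convolution with a piecewise differentiable kernel *)

Section Primitives.
Variable R : realType.
Local Notation mu := (@lebesgue_measure R).
Local Notation cfun := (cfun R).
Implicit Types (u v w f g : cfun).

Lemma heav_conv_lip w (C s t : R) : s <= t ->
  (forall y, s <= y <= t -> `|w y| <= C) ->
  `|(heav R ** w) t - (heav R ** w) s| <= C * (t - s).
Proof.
move=> st wC; rewrite convC !convE.
have C0 : 0 <= C by apply: le_trans (wC s _); rewrite ?lexx.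
have i1 := conv_integrable w (heav R) t; have i2 := conv_integrable w (heav R) s.
rewrite -RintegralB//.
have z y : ~ (s <= y <= t) -> w y * heav R (t - y) - w y * heav R (s - y) = 0.
  move=> /negP; rewrite negb_and -!ltNge !heavE !subr_gt0 => /orP[ys|ty].
    by rewrite ys (lt_le_trans ys st) subrr.
  have -> : (y < t) = false by apply/negbTE; rewrite -leNgt ltW.
  have -> : (y < s) = false by apply/negbTE; rewrite -leNgt; lra.
  by rewrite subrr.
apply: le_Rintegral_window => //.
- by apply: measurable_funB; exact: measurable_conv_integrand.
- move=> y; have [syt|/z ->] := pselect (s <= y <= t); last by rewrite normr0.
  have := wC y syt; rewrite !heavE !subr_gt0.
  case: ifP => _; case: ifP => _; rewrite ?mulr1 ?mulr0 ?subr0 ?sub0r ?normrN ?normr0 ?subrr ?normr0//.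
Qed.

Lemma heav_conv_continuous w : continuous (heav R ** w).
Proof.
move=> t; have [C C0 wC] := cfun_bounded w (t + 1).
have lip s s' : s <= t + 1 -> s' <= t + 1 ->
    `|(heav R ** w) s - (heav R ** w) s'| <= C * `|s - s'|.
  wlog ss : s s' / s' <= s.
    move=> H s1 s2; have [|/ltW] := leP s' s; first by move=> ?; exact: H.
    by move=> ?; rewrite distrC (distrC s); exact: H.
  move=> s1 s2; rewrite (ger0_norm (_ : 0 <= s - s')) ?subr_ge0//.
  by apply: heav_conv_lip => // y /andP[_ ys]; apply: wC; exact: le_trans s1.
apply/cvgrPdist_lt => e e0; near=> s.
have s1 : s <= t + 1.
  have : `|t - s| < 1 by near: s; apply: cvgr_dist_lt => //; exact: cvg_id.
  by rewrite ltr_norml => /andP[? ?]; lra.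
have s2 : `|t - s| < e / (C + 1).
  by near: s; apply: cvgr_dist_lt; [exact: cvg_id|rewrite divr_gt0// ltr_wpDl].
apply: le_lt_trans (lip _ _ _ s1) _; first by rewrite lerDl.
apply: (@le_lt_trans _ _ ((C + 1) * `|t - s|)).
  by rewrite ler_wpM2r// lerDl.
by rewrite mulrC -ltr_pdivlMr// ltr_wpDl.
Unshelve. all: by end_near. Qed.

Lemma free_nbhs (D : seq R) (t : R) : t \notin D ->
  exists2 e, 0 < e & free_of D (t - e) (t + e).
Proof.
elim: D => [|d D IH]; first by move=> _; exists 1.
rewrite inE negb_or => /andP[td /IH[e e0 eD]].
exists (Num.min e `|t - d|); first by rewrite lt_min e0 normr_gt0 subr_eq0.
move=> d'; rewrite inE => /orP[/eqP ->|d'D].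
  have : Num.min e `|t - d| <= `|t - d| by rewrite ge_min lexx orbT.
  move=> h /andP[h1 h2]; have : `|t - d| < `|t - d|; last by rewrite ltxx.
  by apply: lt_le_trans h; rewrite ltr_norml; apply/andP; split; lra.
have h : Num.min e `|t - d| <= e by rewrite ge_min lexx.
by move=> /andP[h1 h2]; apply: (eD _ d'D); apply/andP; split; lra.
Qed.

Lemma pwC0_continuous_off (f : R -> R) : pwC0 f ->
  exists D : seq R, forall t, t \notin D -> {for t, continuous f}.
Proof.
move=> [D fD]; exists D => t /free_nbhs[e e0 fr].
apply: (@extends_cont_at _ (t - e) (t + e)); first by apply: fD => //; lra.
by apply/andP; split; lra.
Qed.

(** Dominated convergence: v (s - y) tends to v (t - y) as s tends to t,
    except for the finitely many y at which t - y is a discontinuity of v. *)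
Lemma conv_continuous w v : pwC0 v -> continuous (w ** v).
Proof.
move=> /pwC0_continuous_off[D vD] t.
have [A A0 wA] := cfun_bounded w (t + 1); have [B B0 vB] := cfun_bounded v (t + 1).
apply/(@cvg_nbhsP _ R^o) => s st.
have [N _ sN] : \forall n \near \oo, s n <= t + 1.
  move/cvgrPdist_lt/(_ 1 ltr01) : (st); apply: filterS => n.
  by rewrite ltr_norml => /andP[? ?]; lra.
rewrite -(cvg_shiftn N) /=.
change ((fun n => \int[mu]_y (w y * v (s (n + N)%N - y))) @ \oo -->
  \int[mu]_y (w y * v (t - y))).
apply: fine_cvg; rewrite fineK; last exact: (integrable_fin_num measurableT (conv_integrable w v t)).
pose g := fun y : R => A * B * \1_(`[0, t + 1]%classic : set R) y.
have mg : measurable_fun setT g.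
  by apply: measurable_funM; [exact: measurable_cst|exact: measurable_indic].
have fle x y : x <= t + 1 -> `|w y * v (x - y)| <= g y.
  move=> xt; rewrite /g indicE; have [yt|yt] := boolP (y \in `[0, t + 1]%classic).
    rewrite mulr1; apply: (@conv_integrand_le _ w v x) => // z zx.
      by apply: wA; exact: le_trans xt.
    by apply: vB; exact: le_trans xt.
  rewrite mulr0 conv_integrand0 ?normr0// => /andP[y0 yx]; move: yt.
  by rewrite notin_setE/= in_itv/= y0 (le_trans yx).
have [] // := @dominated_convergence _ _ _ mu setT measurableT
  (fun n y => (w y * v (s (n + N)%N - y))%:E) (fun y => (w y * v (t - y))%:E) (EFin \o g).
- by move=> n; exact: (measurable_int _ (conv_integrable w v (s (n + N)%N))).
- exact: (measurable_int _ (conv_integrable w v t)).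
- exists [set` [seq t - d | d <- D]]; split.
  + exact/countable_measurable/finite_set_countable/finite_seq.
  + exact/countable_lebesgue_measure0/finite_set_countable/finite_seq.
  + move=> y /= ney; apply: contrapT => /negP yD; apply: ney => _.
    apply: cvg_EFin; first exact: nearW.
    apply: cvgM; first exact: cvg_cst.
    have tyD : t - y \notin D.
      by apply: contra yD => tyD; apply/mapP; exists (t - y) => //; ring.
    apply: (@cvg_comp _ _ _ (fun n => s (n + N)%N - y) v) (vD _ tyD).
    apply: cvgB; last exact: cvg_cst.
    by rewrite (cvg_shiftn N).
- apply: (@integrable_window _ g (A * B) 0 (t + 1)) => //.
  + move=> y; rewrite /g normrM ger0_norm ?mulr_ge0// ler_piMr ?mulr_ge0//.
    by rewrite indicE; case: (_ \in _); rewrite ?normr0 ?normr1.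
  + by move=> y yt; rewrite /g indicE memNset ?mulr0//= in_itv.
- by apply: aeW => y n _; rewrite lee_fin; apply: fle; apply: sN; rewrite /= leq_addl.
Qed.

(** Away from 0 and from the discontinuities of w, its primitive is
    differentiable with derivative w. *)
Lemma heav_conv_pwC1 w : pwC0 w -> pwC1 (heav R ** w).
Proof.
move=> w0; have [D wD] := w0.
exists (0 :: D) => p q pq fr.
have {}wD : extends_continuously p q w.
  by apply: wD => // d dD; apply: fr; rewrite inE dD orbT.
have : p >= 0 \/ q <= 0.
  have : ~ (p < 0 < q) by apply: fr; rewrite inE eqxx.
  by move/negP; rewrite negb_and -!leNgt => /orP.
case=> [p0|q0]; last first.
  apply: (@C1_piece_eq _ _ _ (cst 0)); last exact: C1_piece_cst.
  by move=> t; rewrite in_itv/= => /andP[_ tq]; rewrite cfun_le0// ltW// (lt_le_trans tq).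
apply/C1_pieceP; exists w; split => //.
- move=> t; rewrite in_itv/= => tpq; have /andP[pt tq] := tpq.
  have E : (fun x => \int[mu]_(y in `[0, x]) w y) = heav R ** w :> (R -> R).
    by apply/funext => x; rewrite heav_convE.
  have iw : mu.-integrable `[0, q] (EFin \o w).
    apply: measurable_bounded_integrable => //.
    + by rewrite /= lebesgue_measure_itv/=; case: ifPn => //; rewrite -EFinD ltry.
    + by apply: measurable_funTS; exact: cfun_measurable.
    + have [C C0 wC] := cfun_bounded w q; exists C; split; first by rewrite num_real.
      by move=> M CM x /=; rewrite in_itv/= => /andP[_ /wC h]; exact: le_trans h (ltW CM).
  have [] := continuous_FTC1_closed tq iw (le_lt_trans p0 pt) (extends_cont_at wD tpq).
  rewrite E => dF F'; apply: DeriveDef; first exact: dF.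
  by rewrite -derive1E; exact: F'.
- apply: extends_continuous; apply: continuous_subspaceT => x.
  exact: heav_conv_continuous.
Qed.

(** M and its derivative are unconstrained at the ends of the piece, so that
    the fundamental theorem is stated for their continuous extensions h and k.
    *)
Lemma C1_piece_ftc (p q : R) (M : R -> R) : p < q -> C1_piece p q M ->
  exists h k : R -> R, [/\ {in `]p, q[, M =1 h}, {in `]p, q[, derive1 M =1 k} &
    forall t, p < t <= q -> \int[mu]_(y in `[p, t]) k y = h t - h p].
Proof.
move=> pq [M1 M2 [h [ch Mh]] [k [ck Mk]]]; exists h, k; split => // t /andP[pt tq].
have sub x : x \in `]p, t[ -> x \in `]p, q[.
  by rewrite !in_itv/= => /andP[-> xt]; rewrite (lt_le_trans xt).
have sub' : `[p, t] `<=` `[p, q].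
  by move=> x /=; rewrite !in_itv/= => /andP[-> xt]; rewrite (le_trans xt).
have nMh x : x \in `]p, t[ -> \forall y \near x, M y = h y.
  by move=> /sub/near_in_itvoo; apply: filterS => y; exact: Mh.
have ch' : {within `[p, t], continuous h} by exact: continuous_subspaceW ch.
rewrite /Rintegral (@continuous_FTC2 R k h p t pt) => [//|||].
- exact: continuous_subspaceW ck.
- have [_ c1 c2] := (continuous_within_itvP h pt).1 ch'.
  split; [|exact: c1|exact: c2]; move=> x xpt; have Mx := M1 _ (sub _ xpt).
  exact: (near_eq_derivable (nMh _ xpt) Mx).
- move=> x xpt; rewrite -Mk; last exact: sub.
  by rewrite !derive1E; apply/esym/near_eq_derive; exact: nMh.
Qed.

(** The operator beta is the derivative of v |-> m ** v. A jump of m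
    contributes a delay to beta, a smooth stretch of m the convolution with
    its derivative. Thus convolution with m gains one order of regularity, and
    it kills v as soon as integration does. *)
Definition primitive_of (m : cfun) (beta : {linear cfun -> cfun}) :=
  [/\ forall v, m ** v = heav R ** beta v,
      forall v, beta (heav R ** v) = heav R ** beta v,
      forall v, pwC0 v -> pwC0 (beta v) &
      forall S, exists2 C : R, 0 <= C & forall v (c : R), (forall t, `|v t| <= c) ->
        forall t, t <= S -> `|beta v t| <= C * c].

Lemma winf_causal_gen (p q : R) (f : R -> R) : 0 <= p ->
  measurable_fun setT (winf p q f) -> (exists C, forall t, `|winf p q f t| <= C) ->
  is_causal (winf p q f).
Proof.
move=> p0 mf [C fC]; split => //.
- by move=> t t0; rewrite /winf ifF//; apply/negbTE/negP => /andP[pt _]; lra.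
- by move=> T; exists C.
Qed.

(** Off p and q, the restriction of M to ]p, q] is h(p) 1_{t > p} - h(q) 1_{t
    > q} plus the primitive of the restriction of M', where h is the
    continuous extension of M. Convolving with v gives beta v = h(p) v(t - p)
    - h(q) v(t - q) + M' ** v. *)
Lemma piece_primitive (p q : R) (M : R -> R) : 0 <= p -> p < q -> C1_piece p q M ->
  exists m : cfun, [/\ m =1 winf p q M, pwC1 m & exists beta, primitive_of m beta].
Proof.
move=> p0 pq M1; have [_ _ Me M'e] := M1.
have [mM bM] := extends_window pq Me; have [mM' bM'] := extends_window pq M'e.
pose m : cfun := CFun (mkcfun (winf_causal_gen p0 mM bM)).
pose w : cfun := CFun (mkcfun (winf_causal_gen p0 mM' bM')).
exists m; split => //; first exact: piece_pwC1.
have q0 : 0 <= q by lra.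
have [h [k [Mh M'k ftc]]] := C1_piece_ftc pq M1.
have wE t : w t = if p < t <= q then derive1 M t else 0 by [].
have mE t : m t = if p < t <= q then M t else 0 by [].
have hw t : (heav R ** w) t = if t <= p then 0 else if t <= q then h t - h p else h q - h p.
  rewrite convC convE; have [tp|pt] := leP t p.
    under eq_Rintegral => y _.
      have -> : w y * heav R (t - y) = 0.
        rewrite wE heavE subr_gt0; case: ifP => [/andP[py _]|]; last by rewrite mul0r.
        by rewrite ifF ?mulr0//; apply/negbTE; rewrite -leNgt; lra.
      over.
    by rewrite Rintegral_cst// mul0r.
  have key (s : R) : p < s <= q -> (s = t \/ (s = q /\ q <= t)) ->
      \int[mu]_y (w y * heav R (t - y)) = h s - h p.
    move=> psq st; rewrite -ftc//; apply/esym/Rintegral_cc.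
    - exact: measurable_conv_integrand.
    - move=> y /andP[py ys]; have /andP[ps sq] := psq.
      have yq : y < q by lra.
      have yt : y < t by case: st => [<-//|[? ?]]; lra.
      by rewrite wE heavE subr_gt0 py (ltW yq) yt mulr1 M'k// in_itv/= py yq.
    - move=> y ys; rewrite wE heavE subr_gt0; case: ifP => [/andP[py yq]|]; last by rewrite mul0r.
      rewrite ifF ?mulr0//; apply/negbTE; rewrite -leNgt.
      by case: ys => [?|sy]; [lra|case: st => [<-|[? ?]]; lra].
  case: ifP => tq; first by apply: key; [rewrite pt|left].
  apply: key; first by rewrite pq lexx.
  by right; split => //; rewrite ltW// ltNge tq.
have mJ t : t \notin [:: p; q] -> m t =
    (h p *: shift p (heav R) - h q *: shift q (heav R) + heav R ** w) t.
  rewrite !inE negb_or => /andP[tp tq].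
  rewrite !cfunE !shiftE// !heavE !subr_gt0 hw mE.
  have [pt|tp'] := ltP p t; last first.
    by rewrite ifF ?mulr0 ?subr0 ?addr0//; apply/negbTE; rewrite -leNgt; lra.
  have [tq'|qt] := leP t q => /=.
    have tq2 : t < q by rewrite lt_neqAle tq.
    by rewrite Mh ?in_itv/= ?pt//; ring.
  by ring.
pose bf v := h p *: shift p v - h q *: shift q v + w ** v.
have blin : linear bf.
  move=> a u v; rewrite /bf !linearP /=; apply: cfunP => t.
  by rewrite !cfunE; ring.
pose bmix := GRing.isLinear.Build R cfun cfun *:%R bf blin.
pose beta : {linear cfun -> cfun} := HB.pack bf bmix.
exists beta; split.
- move=> v; rewrite (conv_ae v mJ) /= /bf.
  rewrite !convDl convNl !convZl !convDr convNr !convZr -!convA.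
  by rewrite !shift_conv// convC shift_conv// [in X in _ - X]convC shift_conv// (convC v).
- by move=> v; rewrite /= /bf !convDr convNr !convZr convCA !shift_conv.
- move=> v v0; rewrite /= /bf.
  have c0 := continuous_pwC0 (@conv_continuous w _ v0).
  have s1 := pwC0_shift p v0; have s2 := pwC0_shift q v0.
  have := pwC0_lin (h p) s1 (pwC0_lin (- h q) s2 c0).
  apply: (@pwC0_eq _ [::]) => t _; rewrite !cfunE !shiftE//; ring.
- move=> S; have [A A0 wA] := cfun_bounded w S.
  exists (`|h p| + `|h q| + A * `|S|) => [|v c vc t tS].
    by rewrite !addr_ge0// mulr_ge0.
  have c0 : 0 <= c by apply: le_trans (vc 0).
  rewrite /= /bf !cfunE !mulrDl.
  apply: le_trans (ler_normD _ _) _; apply: lerD.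
    apply: le_trans (ler_normB _ _) _; apply: lerD.
      by rewrite normrM ler_wpM2l// shiftE.
    by rewrite normrM ler_wpM2l// shiftE.
  have [t0|t0] := leP t 0; first by rewrite cfun_le0// normr0 !mulr_ge0.
  apply: (@le_trans _ _ (A * c * t)).
    apply: conv_le => //; first by rewrite ltW.
    by move=> s st; apply: wA; exact: le_trans tS.
  rewrite mulrAC ler_wpM2r// ler_wpM2l//.
  by rewrite (le_trans tS)// ler_norm.
Qed.

Lemma kernel_primitive (tau : R) (M : R -> R) : 0 < tau -> piecewise_C1 0 tau M ->
  exists m : cfun, [/\ m =1 winf 0 tau M, pwC1 m & exists beta, primitive_of m beta].
Proof.
move=> tau0.
pose Q (p q : R) := 0 <= p /\ p <= q -> exists m : cfun,
  [/\ m =1 winf p q M, pwC1 m & exists beta, primitive_of m beta].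
move=> /(@piecewise_glue _ _ Q) H; apply: H => //; last by split => //; exact: ltW.
- by move=> p q p0 _ pq Mpq _; exact: piece_primitive.
- move=> p q r p0 pq qr Q1 Q2 _.
  have [|m1 [m1E c1 [b1 [P1 P2 P3 P4]]]] := Q1; first by split => //; exact: ltW.
  have [|m2 [m2E c2 [b2 [P1' P2' P3' P4']]]] := Q2; first by split; lra.
  exists (m1 + m2); split.
  + by move=> t; rewrite (winf_cat _ (ltW pq) (ltW qr)) cfunE m1E m2E.
  + apply: (@pwC1_eq _ [::] (fun t => 1 * m1 t + m2 t)); last exact: pwC1_lin.
    by move=> t _; rewrite mul1r.
  + exists (b1 \+ b2); split.
    * by move=> v /=; rewrite convDl P1 P1' convDr.
    * by move=> v /=; rewrite P2 P2' convDr.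
    * move=> v v0 /=; apply: (@pwC0_eq _ [::] (fun t => 1 * b1 v t + b2 v t)).
        by move=> t _; rewrite mul1r.
      by apply: pwC0_lin; [exact: P3|exact: P3'].
    * move=> S; have [C C0 bC] := P4 S; have [C' C0' bC'] := P4' S.
      exists (C + C') => [|v c vc t tS]; first exact: addr_ge0.
      rewrite /= cfunE mulrDl; apply: le_trans (ler_normD _ _) _.
      by apply: lerD; [exact: bC|exact: bC'].
Qed.

End Primitives.

(** * The delay operators and their Bezout equation *)

Section DelayOperators.
Variable R : realType.
Local Notation cfun := (cfun R).
Implicit Types (u v w f g r : cfun).

Variables (tau0 tau1 a b : R) (n m : cfun).
Hypothesis tau0_gt0 : 0 < tau0.
Hypothesis tau01 : tau0 <= tau1.
Hypothesis b_neq0 : b != 0.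
Hypothesis n_supp : supp_le tau0 n.
Hypothesis m_supp : supp_le tau1 m.

Let tau0_ge0 : 0 <= tau0. Proof. exact: ltW. Qed.
Let tau1_ge0 : 0 <= tau1. Proof. exact: le_trans tau01. Qed.
Let T := tau0 + tau1.

(** With n and m the kernels of the plant, plant_op and input_op are
    multiplication by F0 and by F1 in the Laplace domain. *)
Definition plant_op g : cfun := g - a *: shift tau0 g - n ** g.
Definition input_op f : cfun := b *: shift tau1 f + m ** f.
(** What remains of plant_op g + input_op f without the integral terms; unlike
    the latter it is explicitly invertible. *)
Definition principal f g : cfun := g - a *: shift tau0 g + b *: shift tau1 f.

Lemma plant_op_linear : linear plant_op.
Proof.
by move=> c u v; rewrite /plant_op !linearP; apply: cfunP => t; rewrite !cfunE; ring.
Qed.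
HB.instance Definition _ := GRing.isLinear.Build _ _ _ _ plant_op plant_op_linear.
Lemma input_op_linear : linear input_op.
Proof.
by move=> c u v; rewrite /input_op !linearP; apply: cfunP => t; rewrite !cfunE; ring.
Qed.
HB.instance Definition _ := GRing.isLinear.Build _ _ _ _ input_op input_op_linear.

Lemma plant_op_conv u g : plant_op (u ** g) = u ** plant_op g.
Proof. by rewrite /plant_op !convBr convZr shift_conv// convCA. Qed.
Lemma input_op_conv u f : input_op (u ** f) = u ** input_op f.
Proof. by rewrite /input_op convDr convZr shift_conv// convCA. Qed.
Lemma plant_op_shift p g : 0 <= p -> plant_op (shift p g) = shift p (plant_op g).
Proof.
move=> p0; apply: cfunP => t; rewrite shiftE// /plant_op !cfunE shift_conv// !shiftE//.
by have -> : t - tau0 - p = t - p - tau0 by ring.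
Qed.
Lemma plant_input f : plant_op (input_op f) = input_op (plant_op f).
Proof.
by rewrite {2}/input_op -plant_op_conv -plant_op_shift// -linearZ -linearD.
Qed.

Lemma supp_shift p q u : 0 <= p -> supp_le q u -> supp_le (p + q) (shift p u).
Proof. by move=> p0 uq t tpq; rewrite shiftE// uq//; lra. Qed.
Lemma supp_le_trans p q u : p <= q -> supp_le p u -> supp_le q u.
Proof. by move=> pq up t qt; apply: up; exact: le_lt_trans qt. Qed.

Lemma supp_plant q g : supp_le q g -> supp_le (tau0 + q) (plant_op g).
Proof.
move=> gq; apply: supp_add; first apply: supp_add.
- by apply: supp_le_trans gq; rewrite lerDr.
- by apply/supp_opp/supp_scale/supp_shift.
- exact/supp_opp/supp_conv.
Qed.
Lemma supp_input q f : supp_le q f -> supp_le (tau1 + q) (input_op f).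
Proof.
move=> fq; apply: supp_add; first exact/supp_scale/supp_shift.
exact: supp_conv.
Qed.

Lemma plant_input_principal f g :
  plant_op g + input_op f = principal f g + (m ** f - n ** g).
Proof. by apply: cfunP => t; rewrite /plant_op /input_op /principal !cfunE; ring. Qed.

(** Up to time tau1 the equation is g(t) = a g(t - tau0), which gives g = 0 by
    induction on the number of delays; f is then read off, as b is not zero.
    *)
Lemma principal_inj f g : supp_le tau0 f -> supp_le tau1 g -> principal f g = 0 ->
  f = 0 /\ g = 0.
Proof.
move=> fs gs P0; have t0p := tau0_gt0; have t1p := tau1_ge0.
have Pt t : g t - a * g (t - tau0) + b * f (t - tau1) = 0.
  by have := congr1 (fun u : cfun => u t) P0; rewrite /= !cfunE !shiftE.
have gn k t : t <= k%:R * tau0 -> t <= tau1 -> g t = 0.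
  elim: k t => [|k IH] t; first by rewrite mul0r => t0 _; exact: cfun_le0.
  rewrite -natr1 mulrDl mul1r => tk t1; have := Pt t.
  have -> : g (t - tau0) = 0 by apply: IH; lra.
  have -> : f (t - tau1) = 0 by apply: cfun_le0; lra.
  lra.
have g0 : g = 0.
  apply: cfunP => t; have [t1|t1] := leP t tau1; last by rewrite gs.
  pose k := Num.bound (tau1 / tau0); apply: (gn k) => //.
  rewrite (le_trans t1)// -ler_pdivrMr// ltW//.
  by apply: archi_boundP; rewrite divr_ge0.
split => //; apply: cfunP => t; have := Pt (t + tau1).
rewrite g0 !cfun0 mulr0 subr0 add0r addrK => /eqP.
by rewrite mulf_eq0 (negbTE b_neq0) => /eqP.
Qed.

Let depth := (Num.bound (T / tau0)).+1.
(** The series for (1 - a S)^-1 r, with S the delay tau0. As r is causal, its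
    terms from index depth on vanish on ]-oo, T]. *)
Definition geom r : cfun := \sum_(k < depth) a ^+ k *: shift (k%:R * tau0) r.
Definition state_part r : cfun := b^-1 *: win 0 tau0 (shift (- tau1) (geom r)).
Definition input_part r : cfun := win 0 tau1 (geom r).

Lemma geom_is_linear : linear geom.
Proof.
move=> c u v; rewrite /geom scaler_sumr -big_split; apply: eq_bigr => k _ /=.
by rewrite linearP; apply: cfunP => t; rewrite !cfunE; ring.
Qed.
HB.instance Definition _ := GRing.isLinear.Build _ _ _ _ geom geom_is_linear.
Lemma state_part_is_linear : linear state_part.
Proof.
by move=> c u v; rewrite /state_part !linearP; apply: cfunP => t; rewrite !cfunE; ring.
Qed.
HB.instance Definition _ := GRing.isLinear.Build _ _ _ _ state_part state_part_is_linear.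
Lemma input_part_is_linear : linear input_part.
Proof. by move=> c u v; rewrite /input_part !linearP. Qed.
HB.instance Definition _ := GRing.isLinear.Build _ _ _ _ input_part input_part_is_linear.

Let depth_ge : T <= depth%:R * tau0.
Proof.
rewrite -ler_pdivrMr// (le_trans (ltW (archi_boundP _)))//.
  by rewrite divr_ge0// addr_ge0.
by rewrite ler_nat.
Qed.

Lemma geomE r t : geom r t = \sum_(k < depth) a ^+ k * r (t - k%:R * tau0).
Proof.
rewrite /geom cfun_sum; apply: eq_bigr => k _.
by rewrite cfunE shiftE// mulr_ge0.
Qed.

Lemma geom_rec r t : t <= T -> geom r t = r t + a * geom r (t - tau0).
Proof.
move=> tT; rewrite !geomE big_ord_recl /= expr0 mul1r mul0r subr0; congr (_ + _).
rewrite mulr_sumr [RHS]big_ord_recr /= (@cfun_le0 _ r) ?mulr0 ?addr0; last first.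
  by have := le_trans tT depth_ge; rewrite /depth -natr1 mulrDl mul1r; lra.
apply: eq_bigr => k _; rewrite exprS mulrA /bump /= add1n.
by congr (_ * r _); rewrite -natr1; ring.
Qed.

Lemma geom_le r c : (forall t, `|r t| <= c) ->
  forall t, `|geom r t| <= (\sum_(k < depth) `|a| ^+ k) * c.
Proof.
move=> rc t; rewrite geomE mulr_suml; apply: le_trans (ler_norm_sum _ _ _) _.
by apply: ler_sum => k _; rewrite normrM normrX ler_wpM2l// exprn_ge0.
Qed.

Lemma state_part_supp r : supp_le tau0 (state_part r).
Proof.
by apply: supp_scale => t t0; rewrite winE ifF// [t <= _]leNgt t0 andbF.
Qed.
Lemma input_part_supp r : supp_le tau1 (input_part r).
Proof. by move=> t t0; rewrite /input_part winE ifF// [t <= _]leNgt t0 andbF. Qed.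

(** G = geom r solves G(t) = r(t) + a G(t - tau0) on ]0, T]. Its part on ]0,
    tau1] is g; the part of G beyond tau1 has to be produced by the term b f(t
    - tau1), which determines f. *)
Lemma principalK r : supp_le T r -> principal (state_part r) (input_part r) = r.
Proof.
move=> rT; apply: cfunP => t; have t0p := tau0_gt0; have t1p := tau1_ge0.
have t01 := tau01; rewrite /principal !cfunE !shiftE// !cfunE !winE shift0E.
have [t0|t0] := leP t 0.
  rewrite !ifF ?(cfun_le0 r)//=; first ring.
  - by apply/negbTE/negP => /andP[? ?]; lra.
  - by apply/negbTE/negP => /andP[? ?]; lra.
have [t1|t1] := leP t tau1.
  rewrite [X in b * (_ * X)](_ : _ = 0); last first.
    by rewrite ifF//; apply/negbTE/negP => /andP[? ?]; lra.
  rewrite [X in a * X](_ : _ = geom r (t - tau0)); last first.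
    case: ifPn => // /negP tt; rewrite cfun_le0// leNgt; apply/negP => ?.
    by apply: tt; apply/andP; split; lra.
  have tT : t <= T by rewrite (le_trans t1)// lerDr.
  by rewrite /= (geom_rec _ tT); ring.
have [tT|tT] := leP t T; last first.
  rewrite rT// !ifF ?mulr0 ?subr0 ?addr0//.
  - by apply/negbTE/negP => /andP[? ?]; rewrite /T in tT; lra.
  - by apply/negbTE/negP => /andP[? ?]; rewrite /T in tT; lra.
rewrite /= !ifT; first by rewrite opprK subrK (geom_rec _ tT); field.
- by rewrite subr_gt0.
- by apply/andP; split; rewrite /T in tT; lra.
- by apply/andP; split; rewrite /T in tT; lra.
Qed.

Lemma parts_principal f g : supp_le tau0 f -> supp_le tau1 g ->
  state_part (principal f g) = f /\ input_part (principal f g) = g.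
Proof.
move=> fs gs; set r := principal f g.
have rT : supp_le T r.
  apply: supp_add; last by rewrite /T addrC; exact/supp_scale/supp_shift.
  apply: supp_add; first by apply: supp_le_trans gs; rewrite lerDr.
  exact/supp_opp/supp_scale/supp_shift.
have [] := @principal_inj (state_part r - f) (input_part r - g).
- by apply: supp_add; [exact: state_part_supp|exact: supp_opp].
- by apply: supp_add; [exact: input_part_supp|exact: supp_opp].
- have := principalK rT; rewrite {2}/r => /eqP; rewrite -subr_eq0 => /eqP <-.
  by apply: cfunP => t; rewrite /principal !linearB !cfunE; ring.
- by move=> /eqP; rewrite subr_eq0 => /eqP -> /eqP; rewrite subr_eq0 => /eqP ->.
Qed.

(** Composed with the inverse of the principal part, plant_op g + input_op f
    becomes r + remainder r. *)
Definition remainder r : cfun := m ** state_part r - n ** input_part r.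
Lemma remainder_is_linear : linear remainder.
Proof.
by move=> c u v; rewrite /remainder !linearP; apply: cfunP => t; rewrite !cfunE; ring.
Qed.
HB.instance Definition _ := GRing.isLinear.Build _ _ _ _ remainder remainder_is_linear.

Lemma remainder_supp r : supp_le T (remainder r).
Proof.
apply: supp_add.
  by rewrite /T addrC; apply: supp_conv => //; exact: state_part_supp.
by apply/supp_opp/supp_conv => //; exact: input_part_supp.
Qed.

Variables (bn bm : {linear cfun -> cfun}).
Hypothesis n_prim : primitive_of n bn.
Hypothesis m_prim : primitive_of m bm.

Lemma win_le p q u c : 0 <= c -> (forall t, `|u t| <= c) -> forall t, `|win p q u t| <= c.
Proof. by move=> c0 uc t; rewrite winE; case: ifP; rewrite ?normr0. Qed.

Lemma remainder_lip : exists2 C : R, 0 <= C & forall u (c : R), supp_le T u ->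
  (forall t, `|u t| <= c) -> forall s t, 0 <= s <= t -> t <= T ->
  `|remainder u t - remainder u s| <= C * c * (t - s).
Proof.
have [n1 _ _ /(_ T)[Cn Cn0 nC]] := n_prim; have [m1 _ _ /(_ T)[Cm Cm0 mC]] := m_prim.
pose S := \sum_(k < depth) `|a| ^+ k.
have S0 : 0 <= S by apply: sumr_ge0 => k _; rewrite exprn_ge0.
exists ((Cm * `|b^-1| + Cn) * S) => [|u c us uc s t /andP[s0 st] tT].
  by rewrite mulr_ge0// addr_ge0// mulr_ge0.
have c0 : 0 <= c by apply: le_trans (uc 0).
have Sc : 0 <= S * c by rewrite mulr_ge0.
rewrite /remainder m1 n1 -convBr; apply: heav_conv_lip => // y /andP[_ yt].
rewrite cfunE; apply: le_trans (ler_normD _ _) _; rewrite cfunE normrN.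
rewrite -mulrA mulrDl; apply: lerD.
- rewrite -mulrA; apply: mC; last exact: le_trans tT.
  move=> x; rewrite cfunE normrM ler_wpM2l//; apply: win_le => // z.
  by rewrite shift0E; case: ifP => _; [exact: geom_le|rewrite normr0].
- apply: nC; last exact: le_trans tT.
  by apply: win_le => // z; exact: geom_le.
Qed.

(** In the Laplace domain, with ^ for the transform: F0 g^ + F1 f^ = 0 has no
    solution but zero among functions supported in ]0, tau0] and ]0, tau1]. *)
Definition no_kernel := forall f g, supp_le tau0 f -> supp_le tau1 g ->
  plant_op g + input_op f = 0 -> f = 0 /\ g = 0.

Lemma kernel_finite_dim : exists d (phi : cfun -> cfun -> 'rV[R]_d),
  (forall c f g f' g', phi (c *: f + f') (c *: g + g') = c *: phi f g + phi f' g') /\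
  forall f g, supp_le tau0 f -> supp_le tau1 g ->
    plant_op g + input_op f = 0 -> phi f g = 0 -> f = 0 /\ g = 0.
Proof.
have T0 : 0 < T by rewrite addr_gt0// (lt_le_trans tau0_gt0).
have [d [phi [phil phi0]]] := fredholm_kernel T0 (fun u _ => @remainder_supp u) remainder_lip.
exists d, (fun f g => phi (principal f g)); split.
  move=> c f g f' g'; rewrite -phil; congr phi.
  by rewrite /principal !linearP; apply: cfunP => t; rewrite !cfunE; ring.
move=> f g fs gs fg0 phifg; apply: principal_inj => //; apply: phi0 => //.
- apply: supp_add; last by rewrite /T addrC; exact/supp_scale/supp_shift.
  apply: supp_add; first by apply: supp_le_trans gs; rewrite lerDr.
  exact/supp_opp/supp_scale/supp_shift.
- have [e1 e2] := parts_principal fs gs.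
  change (principal f g + remainder (principal f g) = 0).
  by rewrite /remainder e1 e2 -plant_input_principal.
Qed.

Lemma bezout_solvable r : no_kernel -> supp_le T r ->
  exists f g, [/\ supp_le tau0 f, supp_le tau1 g & plant_op g + input_op f = r].
Proof.
move=> nk rT.
have T0 : 0 < T by rewrite addr_gt0// (lt_le_trans tau0_gt0).
have Kinj u : supp_le T u -> u + remainder u = 0 -> u = 0.
  move=> uT u0.
  have [|||f0 g0] := nk (state_part u) (input_part u).
  - exact: state_part_supp.
  - exact: input_part_supp.
  - by rewrite plant_input_principal principalK.
  rewrite -(principalK uT) f0 g0; apply: cfunP => t.
  by rewrite /principal !cfunE !shiftE// !cfunE; ring.
have [u uT ur] := fredholm_surj T0 (fun u _ => @remainder_supp u) remainder_lip Kinj rT.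
exists (state_part u), (input_part u); split.
- exact: state_part_supp.
- exact: input_part_supp.
- by rewrite plant_input_principal principalK.
Qed.

End DelayOperators.

(** * Exponentials *)

Section Exponentials.
Variable R : realType.
Local Notation mu := (@lebesgue_measure R).
Local Notation cfun := (cfun R).
Implicit Types (u v w f g r : cfun) (s o t : R).

(** ecosf and esinf are the real and imaginary parts of exp((s + i o) t) for t
    > 0. *)
Definition ecosf s o t : R := if 0 < t then expR (s * t) * cos (o * t) else 0.
Definition esinf s o t : R := if 0 < t then expR (s * t) * sin (o * t) else 0.

Lemma osc_derive s o t :
  is_derive t (1 : R) (fun x : R => expR (s * x) * cos (o * x))
    (s * (expR (s * t) * cos (o * t)) - o * (expR (s * t) * sin (o * t))) /\
  is_derive t (1 : R) (fun x : R => expR (s * x) * sin (o * x))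
    (o * (expR (s * t) * cos (o * t)) + s * (expR (s * t) * sin (o * t))).
Proof.
have lin c : is_derive t (1 : R) (fun x : R => c * x) c.
  have := is_deriveZ c (@is_derive_id R R t (1 : R)).
  by rewrite /GRing.scale /= mulr1.
have e : is_derive t (1 : R) (fun x : R => expR (s * x)) (expR (s * t) * s).
  exact: (is_derive1_comp (is_derive_expR (s * t)) (lin s)).
have c : is_derive t (1 : R) (fun x : R => cos (o * x)) (- sin (o * t) * o).
  exact: (is_derive1_comp (is_derive_cos (o * t)) (lin o)).
have sn : is_derive t (1 : R) (fun x : R => sin (o * x)) (cos (o * t) * o).
  exact: (is_derive1_comp (is_derive_sin (o * t)) (lin o)).
split.
- apply: is_derive_eq (is_deriveM e c) _; rewrite /GRing.scale /=; ring.
- apply: is_derive_eq (is_deriveM e sn) _; rewrite /GRing.scale /=; ring.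
Qed.

Lemma osc_continuous s o :
  continuous (fun x : R => expR (s * x) * cos (o * x)) /\
  continuous (fun x : R => expR (s * x) * sin (o * x)).
Proof.
split=> t; apply: differentiable_continuous; apply/derivable1_diffP.
- by case: (osc_derive s o t) => -[].
- by case: (osc_derive s o t) => _ [].
Qed.

Lemma osc_causal (k h : R -> R) s : continuous k -> (forall t, `|h t| <= 1) ->
  (forall t, k t = expR (s * t) * h t) -> is_causal (fun t => if 0 < t then k t else 0).
Proof.
move=> ck h1 kE; split.
- apply: measurable_fun_ifT; [|exact: continuous_measurable_fun|exact: measurable_cst].
  by apply: measurable_fun_ltr => //; exact: measurable_cst.
- by move=> t t0; rewrite ltNge t0.
- move=> T; exists (expR (`|s| * `|T|)) => t tT; case: ifPn => [t0|_]; last first.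
    by rewrite normr0 expR_ge0.
  rewrite kE normrM [`|expR _|]ger0_norm ?expR_ge0//.
  rewrite -[leRHS]mulr1 ler_pM ?expR_ge0//.
  rewrite ler_expR (le_trans (ler_norm _))// normrM ler_wpM2l//.
  by rewrite (ger0_norm (ltW t0)) (le_trans tT)// ler_norm.
Qed.

Lemma ecos_causal s o : is_causal (ecosf s o).
Proof.
apply: (@osc_causal _ (fun t => cos (o * t)) s); first by case: (osc_continuous s o).
- by move=> t; rewrite ler_norml cos_geN1 cos_le1.
- by [].
Qed.
Lemma esin_causal s o : is_causal (esinf s o).
Proof.
apply: (@osc_causal _ (fun t => sin (o * t)) s); first by case: (osc_continuous s o).
- by move=> t; rewrite ler_norml sin_geN1 sin_le1.
- by [].
Qed.
Definition ecos s o : cfun := CFun (mkcfun (ecos_causal s o)).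
Definition esin s o : cfun := CFun (mkcfun (esin_causal s o)).
Lemma ecosE s o t : ecos s o t = if 0 < t then expR (s * t) * cos (o * t) else 0.
Proof. by []. Qed.
Lemma esinE s o t : esin s o t = if 0 < t then expR (s * t) * sin (o * t) else 0.
Proof. by []. Qed.

Lemma heav_conv_ftc (F F' : R -> R) w t : 0 < t ->
  (forall x, is_derive x (1 : R) F (F' x)) -> continuous F' ->
  (forall y, 0 < y -> w y = F' y) -> (heav R ** w) t = F t - F 0.
Proof.
move=> t0 FF' cF' wF'.
have cF : continuous F.
  by move=> x; apply: differentiable_continuous; apply/derivable1_diffP; case: (FF' x).
transitivity (\int[mu]_(y in `[0, t]) F' y).
  rewrite convC convE; apply/esym/Rintegral_cc.
  - exact: measurable_conv_integrand.
  - by move=> y /andP[y0 yt]; rewrite heavE subr_gt0 yt mulr1 wF'.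
  - by move=> y yt; apply: conv_integrand0; case: yt => ? /andP[]; lra.
rewrite /Rintegral (@continuous_FTC2 R F' F 0 t t0) => [//|||].
- by apply: continuous_subspaceT => x; exact: cF'.
- split; first by move=> x _; case: (FF' x).
  + by apply: cvg_at_right_filter; exact: cF.
  + by apply: cvg_at_left_filter; exact: cF.
- by move=> x _; rewrite derive1E; case: (FF' x).
Qed.

(** With the next lemma, the equation e' = (s + i o) e, e(0) = 1, in
    integrated form. *)
Lemma ecos_heav s o :
  ecos s o = heav R + heav R ** (s *: ecos s o - o *: esin s o).
Proof.
apply: cfunP => t; have [t0|t0] := leP t 0; first by rewrite !cfun_le0.
have [c1 c2] := osc_continuous s o.
rewrite cfunE (@heav_conv_ftc _ _ _ t t0 (fun x => (osc_derive s o x).1)).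
- by rewrite ecosE heavE t0 !mulr0 expR0 cos0; ring.
- by move=> x; apply: cvgB; apply: cvgM; [exact: cvg_cst|exact: c1|exact: cvg_cst|exact: c2].
- by move=> y y0; rewrite !cfunE ecosE esinE y0.
Qed.
Lemma esin_heav s o :
  esin s o = heav R ** (o *: ecos s o + s *: esin s o).
Proof.
apply: cfunP => t; have [t0|t0] := leP t 0; first by rewrite !cfun_le0.
have [c1 c2] := osc_continuous s o.
rewrite (@heav_conv_ftc _ _ _ t t0 (fun x => (osc_derive s o x).2)).
- by rewrite esinE t0 !mulr0 expR0 sin0; ring.
- by move=> x; apply: cvgD; apply: cvgM; [exact: cvg_cst|exact: c1|exact: cvg_cst|exact: c2].
- by move=> y y0; rewrite !cfunE ecosE esinE y0.
Qed.

(** For complex x = u + i v and lam = s + i o, the hypotheses say x = lam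
    (heav ** x). Let e be the exponential of rate lam. Then lam (heav ** e **
    x) is e ** x by the equation of x, and (e - heav) ** x by that of e. Hence
    heav ** x = 0, and x = 0 by the equation again. *)
Lemma exponential_unique s o u v :
  u = heav R ** (s *: u - o *: v) -> v = heav R ** (o *: u + s *: v) -> u = 0 /\ v = 0.
Proof.
move=> uE vE; set c := ecos s o; set e := esin s o.
have cE : c = heav R + heav R ** (s *: c - o *: e) by exact: ecos_heav.
have eE : e = heav R ** (o *: c + s *: e) by exact: esin_heav.
have dc : c - heav R = heav R ** (s *: c - o *: e) by rewrite {1}cE addrAC subrr add0r.
have cu x y : x ** u = heav R ** (x ** (s *: u - o *: v)) /\
              y ** v = heav R ** (y ** (o *: u + s *: v)).
  by split; rewrite convCA -?uE -?vE.
have uc x y : (c - heav R) ** x = heav R ** ((s *: c - o *: e) ** x) /\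
              e ** y = heav R ** ((o *: c + s *: e) ** y).
  by split; rewrite convA -?dc -?eE.
have bil x y x' y' :
    x ** (s *: u - o *: v) - y ** (o *: u + s *: v) =
      (s *: x - o *: y) ** u - (o *: x + s *: y) ** v /\
    x' ** (s *: u - o *: v) + y' ** (o *: u + s *: v) =
      (s *: x' + o *: y') ** u + (s *: y' - o *: x') ** v.
  split; rewrite !(convBr, convDr, convBl, convDl, convZr, convZl);
    by apply: cfunP => t; rewrite !cfunE; ring.
have H1 : heav R ** u = 0.
  have E1 : c ** u - e ** v = (c - heav R) ** u - e ** v.
    rewrite (cu c e).1 (cu c e).2 -convBr (bil c e 0 0).1 convBr.
    by rewrite -(cu c e).2 -(uc u v).1 -(uc u v).2.
  apply: cfunP => t; have := congr1 (fun x : cfun => x t) E1.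
  by rewrite /= convBl !cfunE; lra.
have H2 : heav R ** v = 0.
  have E2 : e ** u + c ** v = e ** u + (c - heav R) ** v.
    rewrite (cu e c).1 (cu e c).2 -convDr (bil 0 0 e c).2 convDr.
    by rewrite -(cu e c).1 (uc v u).1 (uc v u).2 addrC [X in X ** u]addrC addrC.
  apply: cfunP => t; have := congr1 (fun x : cfun => x t) E2.
  by rewrite /= convBl !cfunE; lra.
by split; rewrite (uE, vE) ?convBr ?convDr !convZr H1 H2 !scaler0 ?subr0 ?addr0.
Qed.

(** In complex notation F = f1 + i f2, C = C1 + i C2, mu = al + i be, the
    hypothesis is heav ** F + C D(heav) = mu F. Let lam = s + i o = 1 / mu and
    let e be the exponential of rate lam. Since D e = D(heav) + lam (heav ** D
    e), the function mu F - C D e solves x = lam (heav ** x), so that it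
    vanishes. *)
Lemma eigen_exponential (D : {linear cfun -> cfun}) (C1 C2 al be : R) (f1 f2 : cfun) :
  (forall u v, D (u ** v) = u ** D v) -> al ^+ 2 + be ^+ 2 != 0 ->
  heav R ** f1 + C1 *: D (heav R) = al *: f1 - be *: f2 ->
  heav R ** f2 + C2 *: D (heav R) = be *: f1 + al *: f2 ->
  let s := al / (al ^+ 2 + be ^+ 2) in let o := - be / (al ^+ 2 + be ^+ 2) in
  al *: f1 - be *: f2 = C1 *: D (ecos s o) - C2 *: D (esin s o) /\
  be *: f1 + al *: f2 = C1 *: D (esin s o) + C2 *: D (ecos s o).
Proof.
move=> Dconv n0 E1 E2 s o.
set c := ecos s o; set e := esin s o.
have cE : D c = D (heav R) + heav R ** (s *: D c - o *: D e).
  by rewrite {1}/c ecos_heav linearD /= Dconv linearB !linearZ.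
have eE : D e = heav R ** (o *: D c + s *: D e).
  by rewrite {1}/e esin_heav Dconv linearD !linearZ.
pose P1 := al *: f1 - be *: f2 - (C1 *: D c - C2 *: D e).
pose P2 := be *: f1 + al *: f2 - (C1 *: D e + C2 *: D c).
suff [p1 p2] : P1 = 0 /\ P2 = 0.
  by split; apply/eqP; rewrite -subr_eq0; apply/eqP.
have id1 : s *: P1 - o *: P2 = f1 - C1 *: (s *: D c - o *: D e) + C2 *: (o *: D c + s *: D e).
  apply: cfunP => t; rewrite /P1 /P2 !cfunE /s /o; field.
  exact: n0.
have id2 : o *: P1 + s *: P2 = f2 - C1 *: (o *: D c + s *: D e) - C2 *: (s *: D c - o *: D e).
  apply: cfunP => t; rewrite /P1 /P2 !cfunE /s /o; field.
  exact: n0.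
apply: (@exponential_unique s o).
- rewrite id1 !convDr !convNr !convZr -eE.
  have -> : heav R ** (s *: D c - o *: D e) = D c - D (heav R) by rewrite {2}cE addrAC subrr add0r.
  rewrite /P1 -E1; apply: cfunP => t; rewrite !cfunE; ring.
- rewrite id2 !convDr !convNr !convZr -eE.
  have -> : heav R ** (s *: D c - o *: D e) = D c - D (heav R) by rewrite {2}cE addrAC subrr add0r.
  rewrite /P2 -E2; apply: cfunP => t; rewrite !cfunE; ring.
Qed.

End Exponentials.

(** * Triviality of the kernel *)

Section Kernel.
Variable R : realType.
Local Notation cfun := (cfun R).
Implicit Types (u v w f g r : cfun).

Lemma wide_dependent d (M : 'M[R]_(d.+1, d)) : exists2 y : 'rV_(d.+1), y != 0 & y *m M = 0.
Proof.
apply: contrapT => H.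
have : row_free M.
  apply: inj_row_free => y yM; apply/eqP; apply: contraT => y0.
  by case: H; exists y.
rewrite /row_free => /eqP Mr; have := rank_leq_col M.
by rewrite Mr ltnn.
Qed.

(** The primitive of a function is constant past its support, where it is the
    value at 0 of its Laplace transform. *)
Lemma heav_tail q u s t : supp_le q u -> q < s -> q < t ->
  (heav R ** u) s = (heav R ** u) t.
Proof.
move=> uq; wlog st : s t / s <= t.
  by move=> H qs qt; have [/H|/ltW/H] := leP s t; [exact|move/(_ qt qs)].
move=> qs qt; have := @heav_conv_lip _ u 0 s t st; rewrite mul0r => H.
apply/esym/eqP; rewrite -subr_eq0 -normr_le0; apply: H => y /andP[sy _].
by rewrite uq ?normr0// (lt_le_trans qs).
Qed.

Lemma heav_supp q u c : supp_le q u -> c = (heav R ** u) (q + 1) ->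
  0 <= q -> supp_le q (heav R ** u - c *: heav R).
Proof.
move=> uq cE q0 t qt; rewrite !cfunE heavE (le_lt_trans q0 qt) mulr1 cE.
by rewrite (@heav_tail q u (q + 1) t)// ?subrr// ltrDl.
Qed.

Variables (tau0 tau1 a b : R) (n m : cfun).
Hypothesis tau0_gt0 : 0 < tau0.
Hypothesis tau01 : tau0 <= tau1.
Hypothesis b_neq0 : b != 0.
Hypothesis n_supp : supp_le tau0 n.
Hypothesis m_supp : supp_le tau1 m.
Variables (bn bm : {linear cfun -> cfun}).
Hypothesis n_prim : primitive_of n bn.
Hypothesis m_prim : primitive_of m bm.

Local Notation D := (plant_op tau0 a n).
Local Notation E := (input_op tau1 b m).

Hypothesis no_common_zero : forall s o : R,
  D (ecos s o) (tau0 + 1) = 0 -> D (esin s o) (tau0 + 1) = 0 ->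
  E (ecos s o) (tau1 + 1) = 0 -> E (esin s o) (tau1 + 1) = 0 -> False.

Let tau0_ge0 : 0 <= tau0. Proof. exact: ltW. Qed.
Let tau1_ge0 : 0 <= tau1. Proof. exact: le_trans tau01. Qed.

Let Dconv u g : D (u ** g) = u ** D g. Proof. exact: plant_op_conv. Qed.
Let Econv u f : E (u ** f) = u ** E f.
Proof. exact: (input_op_conv b m tau0_gt0 tau01). Qed.
Let DE f : D (E f) = E (D f). Proof. exact: plant_input. Qed.
Let Dlin c u v : D (u + c *: v) = D u + c *: D v.
Proof. by rewrite addrC plant_op_linear addrC. Qed.
Let Elin c u v : E (u + c *: v) = E u + c *: E v.
Proof. by rewrite addrC input_op_linear addrC. Qed.

Let inK f g := [/\ supp_le tau0 f, supp_le tau1 g & D g + E f = 0].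

Lemma plant_heav_tail t : tau0 < t -> D (heav R) t = D (heav R) (tau0 + 1).
Proof.
move=> t0; have h : tau0 < tau0 + 1 by rewrite ltrDl.
rewrite /plant_op !cfunE (convC n) (heav_tail n_supp t0 h) !shiftE// !heavE.
by rewrite !subr_gt0 t0 h !(lt_trans tau0_gt0).
Qed.
Lemma input_heav_tail t : tau1 < t -> E (heav R) t = E (heav R) (tau1 + 1).
Proof.
move=> t0; have h : tau1 < tau1 + 1 by rewrite ltrDl.
rewrite /input_op !cfunE (convC m) (heav_tail m_supp t0 h) !shiftE// !heavE.
by rewrite !subr_gt0 t0 h.
Qed.

(** A0 and A1 are the values of F0 and F1 at s = 0. *)
Let A0 := D (heav R) (tau0 + 1).
Let A1 := E (heav R) (tau1 + 1).

(** Spectral controllability at s = 0. *)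
Let A01 : A0 ^+ 2 + A1 ^+ 2 != 0.
Proof.
apply/negP; rewrite paddr_eq0 ?sqr_ge0// !sqrf_eq0 => /andP[/eqP a0 /eqP a1].
have c0 : ecos 0 0 = heav R.
  by apply: cfunP => t; rewrite ecosE heavE !mul0r expR0 cos0 mulr1.
have s0 : esin 0 0 = 0 :> cfun.
  by apply: cfunP => t; rewrite esinE !mul0r sin0 mulr0 if_same.
by apply: (@no_common_zero 0 0); rewrite ?c0 ?s0 ?linear0.
Qed.

(** If and Ig stand for the total integrals, that is, for the Laplace
    transforms of f and g at s = 0. *)
Let If f := (heav R ** f) (tau0 + 1).
Let Ig g := (heav R ** g) (tau1 + 1).

(** F0 g^ + F1 f^ = 0 at s = 0. To stay within causal functions, the
    primitives of f and g are made of bounded support by subtracting multiples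
    of heav, and the primitive of the equation is read past all supports. *)
Let mass_balance f g : inK f g -> A0 * Ig g + A1 * If f = 0.
Proof.
move=> [fs gs fg0].
pose uf := heav R ** f - If f *: heav R; pose ug := heav R ** g - Ig g *: heav R.
have ufs : supp_le tau0 uf by exact: heav_supp.
have ugs : supp_le tau1 ug by exact: heav_supp.
have s1 := supp_plant a tau0_gt0 n_supp ugs; have s2 := supp_input b tau0_gt0 tau01 m_supp ufs.
have tt : tau0 + tau1 < tau0 + tau1 + 1 by rewrite ltrDl.
have e1 := s1 _ tt; have e2 := s2 (tau0 + tau1 + 1); rewrite addrC in e2.
have {}e2 := e2 _.
have : (D ug + E uf) (tau0 + tau1 + 1) = 0 by rewrite cfunE e1 [tau0 + _]addrC s2 ?addr0// ltrDl.
rewrite /ug /uf -!scaleNr Dlin Elin Dconv Econv.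
rewrite addrACA -convDr fg0 conv0r add0r cfunD !cfunZ plant_heav_tail ?input_heav_tail -/A0 -/A1.
- lra.
- by have t0p := tau0_gt0; lra.
- by have t1p := tau1_ge0; lra.
Qed.

(** Division by s acts on the kernel. The primitives of f and g have bounded
    support only if f and g have zero integral; adding a multiple c of the
    pair (F0 / s, - F1 / s), which also satisfies the equation, repairs this.
    The two conditions If f + c A0 = 0 and Ig g - c A1 = 0 are compatible by
    the mass balance, and c is their least-squares solution. *)
Let cst_of f g := - (A0 * If f - A1 * Ig g) / (A0 ^+ 2 + A1 ^+ 2).
Let step (x : cfun * cfun) : cfun * cfun :=
  let c := cst_of x.1 x.2 in
  (heav R ** x.1 + c *: D (heav R), heav R ** x.2 - c *: E (heav R)).

Let stepK f g : inK f g -> inK (step (f, g)).1 (step (f, g)).2.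
Proof.
move=> fgK; have [fs gs fg0] := fgK; have bal := mass_balance fgK.
rewrite /step /=; set c := cst_of f g.
have c0 : If f + c * A0 = 0.
  have : (If f + c * A0) * (A0 ^+ 2 + A1 ^+ 2) = A1 * (A0 * Ig g + A1 * If f).
    by rewrite /c /cst_of; field.
  by rewrite bal mulr0 => /eqP; rewrite mulf_eq0 (negbTE A01) orbF => /eqP.
have c1 : Ig g - c * A1 = 0.
  have : (Ig g - c * A1) * (A0 ^+ 2 + A1 ^+ 2) = A0 * (A0 * Ig g + A1 * If f).
    by rewrite /c /cst_of; field.
  by rewrite bal mulr0 => /eqP; rewrite mulf_eq0 (negbTE A01) orbF => /eqP.
split.
- move=> t t0; rewrite cfunD cfunZ plant_heav_tail// -/A0 -c0; congr (_ + _).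
  by apply: heav_tail fs t0 _; rewrite ltrDl.
- move=> t t0; rewrite cfunD cfunN cfunZ input_heav_tail// -/A1 -c1; congr (_ - _).
  by apply: heav_tail gs t0 _; rewrite ltrDl.
- rewrite -scaleNr Dlin Elin Dconv Econv DE.
  by rewrite addrACA -convDr fg0 conv0r add0r scaleNr addNr.
Qed.

Lemma complex_mul_eq0 (x1 x2 y1 y2 : R) :
  x1 * y1 - x2 * y2 = 0 -> x1 * y2 + x2 * y1 = 0 ->
  (x1 = 0 /\ x2 = 0) \/ (y1 = 0 /\ y2 = 0).
Proof.
move=> h1 h2; have [x0|x0] := eqVneq (x1 ^+ 2 + x2 ^+ 2) 0.
  by left; move/eqP: x0; rewrite paddr_eq0 ?sqr_ge0// !sqrf_eq0 => /andP[/eqP ? /eqP ?].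
right; split; apply: (mulfI x0); rewrite mulr0.
  transitivity (x1 * (x1 * y1 - x2 * y2) + x2 * (x1 * y2 + x2 * y1)); first ring.
  by rewrite h1 h2; ring.
transitivity (x1 * (x1 * y2 + x2 * y1) - x2 * (x1 * y1 - x2 * y2)); first ring.
by rewrite h1 h2; ring.
Qed.

(** If the primitives of f and g vanish then so do m ** f and n ** g, by the
    factorization of these convolutions through integration. Only the
    principal part of the equation remains, and it is injective. *)
Lemma heav_cancel f g : inK f g -> heav R ** f = 0 -> heav R ** g = 0 -> f = 0 /\ g = 0.
Proof.
move=> [fs gs fg0] f0 g0; have [n1 n2 _ _] := n_prim; have [m1 m2 _ _] := m_prim.
apply: (@principal_inj _ tau0 tau1 a b) => //.
have mf : m ** f = 0 by rewrite m1 -m2 f0 linear0.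
have ng : n ** g = 0 by rewrite n1 -n2 g0 linear0.
by move: fg0; rewrite plant_input_principal mf ng subrr addr0.
Qed.

(** Here Phi = (f1 + i f2, g1 + i g2) is an eigenvector of the division by s
    for mu = al + i be. If mu is not 0 then mu Phi = C (D e, - E e) with e the
    exponential of rate lam = 1 / mu. Past the supports, Phi vanishes whereas
    D e and E e are F0(lam) e and F1(lam) e. By hypothesis these are not both
    zero, so C = 0 and Phi = 0. If mu = 0 then letting t tend to 0 gives C =
    0, because D(heav) tends to 1, and Phi has vanishing primitives. *)
Lemma eigenvector_eq0 (al be C1 C2 : R) (f1 f2 g1 g2 : cfun) :
  inK f1 g1 -> inK f2 g2 ->
  heav R ** f1 + C1 *: D (heav R) = al *: f1 - be *: f2 ->
  heav R ** f2 + C2 *: D (heav R) = be *: f1 + al *: f2 ->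
  heav R ** g1 - C1 *: E (heav R) = al *: g1 - be *: g2 ->
  heav R ** g2 - C2 *: E (heav R) = be *: g1 + al *: g2 ->
  [/\ f1 = 0, f2 = 0, g1 = 0 & g2 = 0].
Proof.
move=> K1 K2 E1 E2 F1 F2; have [f1s g1s _] := K1; have [f2s g2s _] := K2.
have [ab0|ab0] := eqVneq (al ^+ 2 + be ^+ 2) 0.
  move/eqP: ab0; rewrite paddr_eq0 ?sqr_ge0// !sqrf_eq0 => /andP[/eqP al0 /eqP be0].
  move: E1 E2 F1 F2; rewrite al0 be0 !scale0r subr0 addr0 => E1 E2 F1 F2.
  (* On ]0, tau0] the equation reads C = C (n ** heav) - heav ** f, and the
     right-hand side is O(t) as t tends to 0. *)
  have C0 C f : heav R ** f + C *: D (heav R) = 0 -> C = 0.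
    move=> H.
    have [B B0 fB] := cfun_bounded f tau0; have [B' B0' nB] := cfun_bounded n tau0.
    have Ct t : 0 < t <= tau0 -> `|C| <= (B + `|C| * B') * t.
      move=> /andP[t0 tt]; have := congr1 (fun u : cfun => u t) H.
      rewrite /plant_op /= !cfunE heavE t0 !shiftE// (@cfun_le0 _ (heav R) (t - tau0)) ?subr_le0//.
      rewrite mulr0 subr0 => H1.
      have CE : C = C * (n ** heav R) t - (heav R ** f) t by lra.
      rewrite [X in `|X| <= _]CE.
      apply: le_trans (ler_normB _ _) _; rewrite addrC mulrDl; apply: lerD.
        rewrite -[B]mul1r; apply: conv_le => //; first exact: ltW.
        + by move=> s _; rewrite heavE; case: ifP; rewrite ?normr0 ?normr1.
        + by move=> s st; apply: fB; exact: le_trans tt.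
      rewrite normrM -mulrA ler_wpM2l// -[B']mulr1; apply: conv_le => //; first exact: ltW.
      + by move=> s st; apply: nB; exact: le_trans tt.
      + by move=> s _; rewrite heavE; case: ifP; rewrite ?normr0 ?normr1.
    apply/eqP; rewrite -normr_le0; apply/ler_addgt0Pr => e e0; rewrite add0r.
    set Q := B + `|C| * B' in Ct; have Q0 : 0 <= Q by rewrite addr_ge0// mulr_ge0.
    pose t := Num.min tau0 (e / (Q + 1)).
    have Q1 : 0 < Q + 1 by rewrite ltr_wpDl.
    apply: le_trans (Ct t _) _; first by rewrite lt_min tau0_gt0 divr_gt0//= ge_min lexx.
    apply: (@le_trans _ _ ((Q + 1) * (e / (Q + 1)))); last by rewrite mulrC divfK// gt_eqF.
    apply: ler_pM => //; first by rewrite le_min tau0_ge0 divr_ge0// ltW.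
      by rewrite lerDl.
    by rewrite ge_min lexx orbT.
  have C10 := C0 _ _ E1; have C20 := C0 _ _ E2.
  move: E1 E2 F1 F2; rewrite C10 C20 !scale0r !addr0 !subr0 => E1 E2 F1 F2.
  by have [? ?] := heav_cancel K1 E1 F1; have [? ?] := heav_cancel K2 E2 F2.
set s := al / (al ^+ 2 + be ^+ 2); set o := - be / (al ^+ 2 + be ^+ 2).
have [X1 X2] := eigen_exponential Dconv ab0 E1 E2.
have F1' : heav R ** g1 + (- C1) *: E (heav R) = al *: g1 - be *: g2 by rewrite scaleNr.
have F2' : heav R ** g2 + (- C2) *: E (heav R) = be *: g1 + al *: g2 by rewrite scaleNr.
have [Y1 Y2] := eigen_exponential Econv ab0 F1' F2'.
rewrite -/s -/o in X1 X2 Y1 Y2.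
have h0 : tau0 < tau0 + 1 by rewrite ltrDl.
have h1 : tau1 < tau1 + 1 by rewrite ltrDl.
have C0 : C1 = 0 /\ C2 = 0.
  apply: contrapT => C0; apply: (@no_common_zero s o).
  - have e1 := congr1 (fun u : cfun => u (tau0 + 1)) X1.
    have e2 := congr1 (fun u : cfun => u (tau0 + 1)) X2.
    move: e1 e2; rewrite /= !cfunE f1s// f2s// !mulr0 subr0 addr0 => e1 e2.
    by have [//|[]] := complex_mul_eq0 (esym e1) (esym e2).
  - have e1 := congr1 (fun u : cfun => u (tau0 + 1)) X1.
    have e2 := congr1 (fun u : cfun => u (tau0 + 1)) X2.
    move: e1 e2; rewrite /= !cfunE f1s// f2s// !mulr0 subr0 addr0 => e1 e2.
    by have [//|[]] := complex_mul_eq0 (esym e1) (esym e2).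
  - have e1 := congr1 (fun u : cfun => u (tau1 + 1)) Y1.
    have e2 := congr1 (fun u : cfun => u (tau1 + 1)) Y2.
    move: e1 e2; rewrite /= !cfunE g1s// g2s// !mulr0 subr0 addr0 => e1 e2.
    have [[/eqP + /eqP]|[]//] := complex_mul_eq0 (esym e1) (esym e2).
    by rewrite !oppr_eq0 => /eqP c1 /eqP c2; case: C0.
  - have e1 := congr1 (fun u : cfun => u (tau1 + 1)) Y1.
    have e2 := congr1 (fun u : cfun => u (tau1 + 1)) Y2.
    move: e1 e2; rewrite /= !cfunE g1s// g2s// !mulr0 subr0 addr0 => e1 e2.
    have [[/eqP + /eqP]|[]//] := complex_mul_eq0 (esym e1) (esym e2).
    by rewrite !oppr_eq0 => /eqP c1 /eqP c2; case: C0.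
case: C0 => c1 c2; move: X1 X2 Y1 Y2; rewrite c1 c2 !oppr0 !scale0r !subr0 !addr0.
have solve u v : al *: u - be *: v = 0 -> be *: u + al *: v = 0 -> u = 0 /\ v = 0.
  move=> e1 e2; have id (w : cfun) : (al ^+ 2 + be ^+ 2) *: w = 0 -> w = 0.
    by move=> /eqP; rewrite scaler_eq0 (negbTE ab0) => /eqP.
  split; apply: id; apply: cfunP => t.
  - have := congr1 (fun w : cfun => al * w t) e1; have := congr1 (fun w : cfun => be * w t) e2.
    by rewrite /= !cfunE => p1 p2; nra.
  - have := congr1 (fun w : cfun => be * w t) e1; have := congr1 (fun w : cfun => al * w t) e2.
    by rewrite /= !cfunE => p1 p2; nra.
move=> X1 X2 Y1 Y2.
by have [? ?] := solve _ _ X1 X2; have [? ?] := solve _ _ Y1 Y2.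
Qed.

(** Multiplication by X is the shift of the sequence w, so that c = X q - r
    between polynomials becomes an identity between combinations of w. *)
Lemma shifted_sum (w : nat -> cfun) (c q r : nat -> R) k :
  (forall i, c i = (if i is j.+1 then q j else 0) - r i) ->
  \sum_(i < k.+1) c i *: w i =
  \sum_(i < k) q i *: w i.+1 - \sum_(i < k.+1) r i *: w i.
Proof.
move=> cE; have -> : \sum_(i < k.+1) c i *: w i =
    \sum_(i < k.+1) (if i : nat is j.+1 then q j else 0) *: w i - \sum_(i < k.+1) r i *: w i.
  by rewrite -sumrB; apply: eq_bigr => i _; rewrite cE scalerBl.
by rewrite big_ord_recl scale0r add0r.
Qed.

(** The kernel is finite-dimensional and division by s acts on it linearly, so
    that the iterates v of a given element are linearly dependent. Let p be a
    real polynomial of minimal size that annihilates them, mu a complex root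
    of p and p = (X - mu) q. The real and imaginary parts q1 and q2 of q yield
    an eigenvector for mu. It vanishes, and q then contradicts the minimality
    of p, unless p is constant, in which case the element itself is zero. *)
Lemma kernel_trivial : no_kernel tau0 tau1 a b n m.
Proof.
move=> f0 g0 f0s g0s fg0.
have K0 : inK f0 g0 by split.
pose v k := iter k step (f0, g0).
have vK k : inK (v k).1 (v k).2.
  by elim: k => [//|k IH]; rewrite /v iterS -/(v k); move: IH; case: (v k) => x y; exact: stepK.
have [d [phi [phil phi0]]] := kernel_finite_dim a tau0_gt0 tau01 b_neq0 n_supp m_supp n_prim m_prim.
pose comb1 (p : {poly R}) k := \sum_(i < k) p`_i *: (v i).1.
pose comb2 (p : {poly R}) k := \sum_(i < k) p`_i *: (v i).2.
have combK p k : inK (comb1 p k) (comb2 p k).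
  split.
  - by apply: supp_sum => i; apply: supp_scale; case: (vK i).
  - by apply: supp_sum => i; apply: supp_scale; case: (vK i).
  - rewrite /comb1 /comb2 !linear_sum -big_split big1//= => i _.
    by rewrite !linearZ -scalerDr; case: (vK i) => _ _ ->; rewrite scaler0.
pose ann (p : {poly R}) := comb1 p (size p) = 0 /\ comb2 p (size p) = 0.
have comb_size (p : {poly R}) k : (size p <= k)%N ->
    comb1 p k = comb1 p (size p) /\ comb2 p k = comb2 p (size p).
  move=> pk; split; rewrite /comb1 /comb2 -(subnKC pk) big_split_ord /= [X in _ + X]big1 ?addr0// => i _;
    by rewrite nth_default ?scale0r// leq_addr.
have [p [p0 pann pmin]] : exists p : {poly R}, [/\ p != 0, ann p &
    forall q : {poly R}, q != 0 -> ann q -> (size p <= size q)%N].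
  suff [p p0 pann] : exists2 p : {poly R}, p != 0 & ann p.
    pose P k := `[< exists p : {poly R}, [/\ p != 0, ann p & size p = k] >].
    have ex : exists k, P k by exists (size p); apply/asboolP; exists p.
    case: (ex_minnP ex) => k /asboolP[q [q0 qa qk]] kmin.
    by exists q; split => // r r0 ra; rewrite qk; apply: kmin; apply/asboolP; exists r.
  have [y y0 yM] := wide_dependent (\matrix_(i < d.+1) phi (v i).1 (v i).2).
  pose p : {poly R} := \poly_(i < d.+1) (if insub i is Some j then y 0 j else 0).
  have pE (i : 'I_d.+1) : p`_i = y 0 i by rewrite coef_poly ltn_ord valK.
  exists p.
    apply: contra y0 => /eqP p0; apply/eqP/rowP => i; rewrite mxE -pE p0.
    by rewrite coef0.
  have psz : (size p <= d.+1)%N by exact: size_poly.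
  have [c1 c2] := comb_size _ _ psz; rewrite /ann -c1 -c2.
  have phi00 : phi 0 0 = 0.
    have := phil 1 0 0 0 0; rewrite !scaler0 !addr0 scale1r => e.
    by apply: (addrI (phi 0 0)); rewrite addr0 -e.
  have phiZ c f g : phi (c *: f) (c *: g) = c *: phi f g.
    by have := phil c f g 0 0; rewrite !addr0 phi00 addr0.
  have phiD f g f' g' : phi (f + f') (g + g') = phi f g + phi f' g'.
    by have := phil 1 f g f' g'; rewrite !scale1r.
  have [s1 s2 s3] := combK p d.+1.
  have [] := phi0 _ _ s1 s2 s3; last by [].
  transitivity (\sum_(i < d.+1) p`_i *: phi (v i).1 (v i).2).
    rewrite /comb1 /comb2.
    elim/big_rec3: _ => // i x x1 x2 _ <-.
    by rewrite phiD phiZ.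
  move: yM; rewrite mulmx_sum_row => yM; rewrite -[RHS]yM; apply: eq_bigr => i _.
  by rewrite pE rowK.
have ann_small (q : {poly R}) : (size q < size p)%N -> ann q -> q = 0.
  move=> qp qa; apply/eqP; apply: contraT => q0.
  by have := pmin q q0 qa; rewrite leqNgt qp.
have [sz1|sz1] := eqVneq (size p) 1%N.
  have [c1 c2] := pann; rewrite sz1 /comb1 /comb2 !big_ord1 /= in c1 c2.
  have pc : p`_0 != 0.
    by have := lead_coef_eq0 p; rewrite /lead_coef sz1 (negbTE p0) => /negbT.
  by split; [move/eqP: c1|move/eqP: c2]; rewrite scaler_eq0 (negbTE pc) => /eqP.
pose pC : {poly R[i]} := map_poly (real_complex R) p.
have szC : size pC = size p by exact: size_map_poly.
have [mu rmu] : exists mu, root pC mu by apply/closed_rootP; rewrite szC.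
have /factor_theorem[q pq] := rmu.
have q0 : q != 0.
  by apply: contra p0 => /eqP q0; rewrite -(map_poly_eq0 (real_complex R)) -/pC pq q0 mul0r.
have szq : size p = (size q).+1.
  by rewrite -szC pq size_mul ?polyXsubC_eq0// size_XsubC addn2.
pose k := size q.
pose q1 : {poly R} := \poly_(i < k) complex.Re q`_i.
pose q2 : {poly R} := \poly_(i < k) complex.Im q`_i.
set al := complex.Re mu; set be := complex.Im mu.
have q1E i : q1`_i = complex.Re q`_i.
  by rewrite coef_poly; case: ltnP => // ki; rewrite nth_default.
have q2E i : q2`_i = complex.Im q`_i.
  by rewrite coef_poly; case: ltnP => // ki; rewrite nth_default.
(* The coefficients of p = (X - mu) q, whose imaginary parts vanish. *)
have pcoef i : p`_i = (if i is j.+1 then q1`_j else 0) - (al * q1`_i - be * q2`_i) /\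
    0 = (if i is j.+1 then q2`_j else 0) - (be * q1`_i + al * q2`_i).
  have : (p`_i)%:C%C = (if i is j.+1 then q`_j else 0) - mu * q`_i.
    rewrite -[LHS](coef_map (real_complex R)) -/pC pq mulrBr coefB coefMX coefMC mulrC.
    by case: i.
  rewrite !q1E !q2E; case: i => [|j] /=.
    case: (q`_0) => x y; rewrite /al /be; case: (mu) => z w /=.
    by move=> h; have /= := congr1 (fun z : R[i] => complex.Re z) h;
      have /= := congr1 (fun z : R[i] => complex.Im z) h; split; lra.
  rewrite q1E q2E; case: (q`_j) => x' y'.
  case: (q`_j.+1) => x y; rewrite /al /be; case: (mu) => z w /=.
  by move=> h; have /= := congr1 (fun z : R[i] => complex.Re z) h;
      have /= := congr1 (fun z : R[i] => complex.Im z) h; split; lra.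
have q1k : q1`_k = 0 by rewrite q1E nth_default.
have q2k : q2`_k = 0 by rewrite q2E nth_default.
have rel (w : nat -> cfun) : \sum_(i < k.+1) p`_i *: w i = 0 ->
    \sum_(i < k) q1`_i *: w i.+1 =
      al *: (\sum_(i < k) q1`_i *: w i) - be *: (\sum_(i < k) q2`_i *: w i) /\
    \sum_(i < k) q2`_i *: w i.+1 =
      be *: (\sum_(i < k) q1`_i *: w i) + al *: (\sum_(i < k) q2`_i *: w i).
  have comb_lin (c d' : R) : \sum_(i < k.+1) (c * q1`_i + d' * q2`_i) *: w i =
      c *: (\sum_(i < k) q1`_i *: w i) + d' *: (\sum_(i < k) q2`_i *: w i).
    rewrite big_ord_recr /= q1k q2k !mulr0 addr0 scale0r addr0 !scaler_sumr -big_split.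
    by apply: eq_bigr => i _ /=; rewrite scalerDl !scalerA.
  move=> pw; split.
    have H1 : forall i, p`_i = (if i is j.+1 then q1`_j else 0)
        - (al * q1`_i + (- be) * q2`_i) by move=> i; rewrite mulNr; case: (pcoef i).
    have E1 := @shifted_sum w _ _ _ k H1.
    move: E1; rewrite pw comb_lin => /esym/eqP; rewrite subr_eq0 => /eqP ->.
    by rewrite scaleNr.
  have H2 : forall i, 0 = (if i is j.+1 then q2`_j else 0)
      - (be * q1`_i + al * q2`_i) by move=> i; case: (pcoef i).
  have E2 := @shifted_sum w (fun=> 0) _ _ k H2.
  move: E2; rewrite comb_lin big1 => [/esym/eqP|i _]; last by rewrite scale0r.
  by rewrite subr_eq0 => /eqP ->.
have [pa1 pa2] := pann; rewrite /comb1 /comb2 szq -/k in pa1 pa2.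
have [r1 r1'] := rel (fun i => (v i).1) pa1; have [r2 r2'] := rel (fun i => (v i).2) pa2.
pose cs i := cst_of (v i).1 (v i).2.
have nx1 (c : {poly R}) : \sum_(i < k) c`_i *: (v i.+1).1 =
    heav R ** comb1 c k + (\sum_(i < k) c`_i * cs i) *: D (heav R).
  rewrite /comb1 linear_sum scaler_suml -big_split; apply: eq_bigr => i _ /=.
  by rewrite convZr -scalerA -scalerDr.
have nx2 (c : {poly R}) : \sum_(i < k) c`_i *: (v i.+1).2 =
    heav R ** comb2 c k - (\sum_(i < k) c`_i * cs i) *: E (heav R).
  rewrite /comb2 linear_sum -scaleNr -sumrN scaler_suml -big_split; apply: eq_bigr => i _ /=.
  by rewrite convZr scalerBr (scalerA _ (cst_of _ _)) scaleNr.
rewrite nx1 in r1; rewrite nx1 in r1'; rewrite nx2 in r2; rewrite nx2 in r2'.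
have [x10 x20 y10 y20] := eigenvector_eq0 (combK q1 k) (combK q2 k) r1 r1' r2 r2'.
have zero (c : {poly R}) : (size c <= k)%N -> comb1 c k = 0 -> comb2 c k = 0 -> c = 0.
  move=> ck c1 c2; apply: ann_small; first by rewrite szq ltnS.
  by have [e1 e2] := comb_size _ _ ck; rewrite /ann -e1 -e2.
have q10 : q1 = 0 by apply: zero => //; exact: size_poly.
have q20 : q2 = 0 by apply: zero => //; exact: size_poly.
case/negP: q0; apply/eqP/polyP => i; apply/eqP; rewrite coef0 eq_complex /=.
by rewrite -q1E -q2E q10 q20 !coef0 !eqxx.
Qed.

End Kernel.

(** * Laplace transforms and spectral controllability *)

Section Spectral.
Variable R : realType.
Local Notation mu := (@lebesgue_measure R).
Local Notation cfun := (cfun R).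
Implicit Types (u v w f g r : cfun) (s o t : R).

(** Real (lapc) and imaginary (laps) part of the Laplace transform of u at s +
    i o. *)
Definition lapc s o u : R := \int[mu]_y (u y * (expR (- (y * s)) * cos (- (y * o)))).
Definition laps s o u : R := \int[mu]_y (u y * (expR (- (y * s)) * sin (- (y * o)))).

Let osc_measurable s o : measurable_fun setT (fun y : R => expR (- (y * s)) * cos (- (y * o))) /\
   measurable_fun setT (fun y : R => expR (- (y * s)) * sin (- (y * o))).
Proof.
have [c1 c2] := osc_continuous (- s) (- o).
have e (x y : R) : - (x * y) = - y * x by ring.
split.
- rewrite (_ : (fun y : R => _) = fun x => expR (- s * x) * cos (- o * x)).
    exact: continuous_measurable_fun.
  by apply/funext => y; rewrite !e.
- rewrite (_ : (fun y : R => _) = fun x => expR (- s * x) * sin (- o * x)).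
    exact: continuous_measurable_fun.
  by apply/funext => y; rewrite !e.
Qed.

Lemma lap_integrable (tau : R) s u (h : R -> R) : supp_le tau u -> (forall x, `|h x| <= 1) ->
  measurable_fun setT (fun y : R => expR (- (y * s)) * h y) ->
  mu.-integrable setT (EFin \o (fun y : R => u y * (expR (- (y * s)) * h y))).
Proof.
move=> us h1 mh; have [C C0 uC] := supp_bounded us.
apply: (@integrable_window _ _ (C * expR (`|tau| * `|s|)) 0 tau).
- by apply: measurable_funM => //; exact: cfun_measurable.
- move=> y; have [y0|y0] := leP y 0; first by rewrite cfun_le0// mul0r normr0 mulr_ge0// expR_ge0.
  have [yt|yt] := leP y tau; last by rewrite us// mul0r normr0 mulr_ge0// expR_ge0.
  rewrite normrM ler_pM// normrM -[leRHS]mulr1 ler_pM//.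
  rewrite ger0_norm ?expR_ge0// ler_expR (le_trans (ler_norm _))// normrN normrM.
  by rewrite ler_wpM2r// (ger0_norm (ltW y0)) (le_trans yt)// ler_norm.
- move=> y /negP; rewrite negb_and -!ltNge => /orP[y0|ty].
    by rewrite cfun_le0 ?mul0r// ltW.
  by rewrite us// mul0r.
Qed.

(** Past the support of u, convolution with an exponential multiplies it by
    the Laplace transform of u at its rate. *)
Lemma conv_exp (tau : R) s o u t : supp_le tau u -> tau < t ->
  (u ** ecos s o) t = expR (s * t) * cos (o * t) * lapc s o u - expR (s * t) * sin (o * t) * laps s o u /\
  (u ** esin s o) t = expR (s * t) * sin (o * t) * lapc s o u + expR (s * t) * cos (o * t) * laps s o u.
Proof.
move=> us tt; have [m1 m2] := osc_measurable s o.
have i1 := lap_integrable us (fun x => _ : `|cos (- (x * o))| <= 1) m1.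
have i2 := lap_integrable us (fun x => _ : `|sin (- (x * o))| <= 1) m2.
have {}i1 : mu.-integrable setT (EFin \o (fun y => u y * (expR (- (y * s)) * cos (- (y * o))))).
  by apply: i1 => x; rewrite ler_norml cos_geN1 cos_le1.
have {}i2 : mu.-integrable setT (EFin \o (fun y => u y * (expR (- (y * s)) * sin (- (y * o))))).
  by apply: i2 => x; rewrite ler_norml sin_geN1 sin_le1.
have iZ (h : R -> R) (c : R) : mu.-integrable setT (EFin \o h) ->
    mu.-integrable setT (EFin \o (fun y => c * h y)).
  by move=> ih; have := integrableZl measurableT c ih.
have key y : u y != 0 -> 0 < t - y.
  by move=> uy; rewrite subr_gt0 (le_lt_trans _ tt)// leNgt; apply: contra uy => /us ->.
have E1 y : o * (t - y) = o * t + - (y * o) by ring.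
have E2 y : s * (t - y) = s * t + - (y * s) by ring.
split; rewrite convE /lapc /laps -!RintegralZl//.
- rewrite -RintegralB//; [|exact: iZ|exact: iZ].
  apply: eq_Rintegral => y _; have [->|uy] := eqVneq (u y) 0; first by rewrite !mul0r !mulr0 subrr.
  by rewrite ecosE key// E1 E2 cosD expRD; ring.
- rewrite -RintegralD//; [|exact: iZ|exact: iZ].
  apply: eq_Rintegral => y _; have [->|uy] := eqVneq (u y) 0; first by rewrite !mul0r !mulr0 addr0.
  by rewrite esinE key// E1 E2 sinD expRD; ring.
Qed.

Lemma window_integral (tau : R) (N : R -> R) u (h : R -> R) : u =1 winf 0 tau N ->
  measurable_fun setT h ->
  \int[mu]_(y in `[0, tau]) (N y * h y) = \int[mu]_y (u y * h y).
Proof.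
move=> uN mh; apply: Rintegral_cc.
- by apply: measurable_funM => //; exact: cfun_measurable.
- by move=> y /andP[y0 yt]; rewrite uN /winf y0 (ltW yt).
- move=> y yt; rewrite uN /winf ifF ?mul0r//; apply/negbTE/negP => /andP[? ?].
  by case: yt; lra.
Qed.

Lemma winf_supp (tau : R) (N : R -> R) u : u =1 winf 0 tau N -> supp_le tau u.
Proof. by move=> uN t tt; rewrite uN /winf ifF// [t <= _]leNgt tt andbF. Qed.

Variables (tau0 tau1 a b : R) (N M : R -> R) (n m : cfun).
Hypothesis tau0_gt0 : 0 < tau0.
Hypothesis tau01 : tau0 <= tau1.
Hypothesis nN : n =1 winf 0 tau0 N.
Hypothesis mM : m =1 winf 0 tau1 M.

Lemma F0E s o : F0 tau0 a N (s +i* o)%C =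
  ((1 - a * (expR (- (tau0 * s)) * cos (- (tau0 * o))) - lapc s o n)
   +i* (- a * (expR (- (tau0 * s)) * sin (- (tau0 * o))) - laps s o n))%C.
Proof.
have [m1 m2] := osc_measurable s o.
rewrite /F0 /cintegral /lapc /laps -(window_integral nN m1) -(window_integral nN m2).
apply/eqP; rewrite eq_complex /=; apply/andP; split; apply/eqP.
- congr (_ - _); first by rewrite !(mul0r, mulr0, subr0, addr0, oppr0, add0r).
  by apply: eq_Rintegral => y _; rewrite !(mul0r, mulr0, subr0, addr0, oppr0, add0r).
- congr (_ - _); first by rewrite !(mul0r, mulr0, subr0, addr0, oppr0, add0r) mulNr.
  by apply: eq_Rintegral => y _; rewrite !(mul0r, mulr0, subr0, addr0, oppr0, add0r).
Qed.

Lemma F1E s o : F1 tau1 b M (s +i* o)%C =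
  ((b * (expR (- (tau1 * s)) * cos (- (tau1 * o))) + lapc s o m)
   +i* (b * (expR (- (tau1 * s)) * sin (- (tau1 * o))) + laps s o m))%C.
Proof.
have [m1 m2] := osc_measurable s o.
rewrite /F1 /cintegral /lapc /laps -(window_integral mM m1) -(window_integral mM m2).
apply/eqP; rewrite eq_complex /=; apply/andP; split; apply/eqP.
- congr (_ + _); first by rewrite !(mul0r, mulr0, subr0, addr0, oppr0, add0r).
  by apply: eq_Rintegral => y _; rewrite !(mul0r, mulr0, subr0, addr0, oppr0, add0r).
- congr (_ + _); first by rewrite !(mul0r, mulr0, subr0, addr0, oppr0, add0r).
  by apply: eq_Rintegral => y _; rewrite !(mul0r, mulr0, subr0, addr0, oppr0, add0r).
Qed.

Let exp_shift s o t x :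
  expR (s * (t - x)) * cos (o * (t - x)) =
    expR (s * t) * cos (o * t) * (expR (- (x * s)) * cos (- (x * o)))
    - expR (s * t) * sin (o * t) * (expR (- (x * s)) * sin (- (x * o))) /\
  expR (s * (t - x)) * sin (o * (t - x)) =
    expR (s * t) * sin (o * t) * (expR (- (x * s)) * cos (- (x * o)))
    + expR (s * t) * cos (o * t) * (expR (- (x * s)) * sin (- (x * o))).
Proof.
have -> : o * (t - x) = o * t + - (x * o) by ring.
have -> : s * (t - x) = s * t + - (x * s) by ring.
by split; rewrite expRD (cosD, sinD); ring.
Qed.

(** Past time tau0, plant_op maps the exponential of rate s + i o to its
    product with F0(s + i o); likewise with tau1, input_op and F1. An
    exponential has no zero, so that vanishing at one time past the delays
    means vanishing of F0 and F1, which makes the rank 0. *)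
Lemma controllable_no_common_zero : spectrally_controllable tau0 tau1 a b N M ->
  forall s o : R,
  plant_op tau0 a n (ecos s o) (tau0 + 1) = 0 -> plant_op tau0 a n (esin s o) (tau0 + 1) = 0 ->
  input_op tau1 b m (ecos s o) (tau1 + 1) = 0 -> input_op tau1 b m (esin s o) (tau1 + 1) = 0 -> False.
Proof.
move=> ctrl s o d1 d2 e1 e2.
have tau0_ge0 : 0 <= tau0 by exact: ltW.
have tau1_ge0 : 0 <= tau1 by exact: le_trans tau01.
have ex0 t : (expR (s * t) * cos (o * t)) ^+ 2 + (expR (s * t) * sin (o * t)) ^+ 2 != 0.
  rewrite !exprMn -mulrDr cos2Dsin2 mulr1 expf_neq0//.
  by rewrite gt_eqF// expR_gt0.
have rot (t X Y : R) : expR (s * t) * cos (o * t) * X - expR (s * t) * sin (o * t) * Y = 0 ->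
    expR (s * t) * cos (o * t) * Y + expR (s * t) * sin (o * t) * X = 0 -> X = 0 /\ Y = 0.
  move=> h1 h2; have [[c0 s0]|//] := complex_mul_eq0 h1 h2.
  by have := ex0 t; rewrite c0 s0 expr0n addr0 eqxx.
have ec (x : R) : 0 < x -> ecos s o x = expR (s * x) * cos (o * x) by move=> x0; rewrite ecosE x0.
have es (x : R) : 0 < x -> esin s o x = expR (s * x) * sin (o * x) by move=> x0; rewrite esinE x0.
have pos (x : R) : 0 <= x -> 0 < x + 1 /\ 0 < x + 1 - x by move=> x0; split; lra.
have f0 : F0 tau0 a N (s +i* o)%C = 0.
  have [c1 c2] := conv_exp s o (winf_supp nN) (ltr_pwDr ltr01 (lexx tau0)).
  have [x1 x2] := exp_shift s o (tau0 + 1) tau0.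
  have [p1 p2] := pos _ tau0_ge0.
  move: d1; rewrite /plant_op cfunD cfunN cfunD cfunN cfunZ c1 shiftE// !ec// x1 => d1.
  move: d2; rewrite /plant_op cfunD cfunN cfunD cfunN cfunZ c2 shiftE// !es// x2 => d2.
  rewrite F0E; set X := 1 - _ - _; set Y := - a * _ - _.
  have [-> ->//] : X = 0 /\ Y = 0.
  by apply: (@rot (tau0 + 1)); [rewrite -[RHS]d1|rewrite -[RHS]d2]; rewrite /X /Y; ring.
have f1 : F1 tau1 b M (s +i* o)%C = 0.
  have [c1 c2] := conv_exp s o (winf_supp mM) (ltr_pwDr ltr01 (lexx tau1)).
  have [x1 x2] := exp_shift s o (tau1 + 1) tau1.
  have [p1 p2] := pos _ tau1_ge0.
  move: e1; rewrite /input_op cfunD cfunZ c1 shiftE// !ec// x1 => e1.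
  move: e2; rewrite /input_op cfunD cfunZ c2 shiftE// !es// x2 => e2.
  rewrite F1E; set X := b * _ + _; set Y := b * _ + _.
  have [-> ->//] : X = 0 /\ Y = 0.
  by apply: (@rot (tau1 + 1)); [rewrite -[RHS]e1|rewrite -[RHS]e2]; rewrite /X /Y; ring.
have := ctrl (s +i* o)%C.
by rewrite f0 f1 !raddf0 row_mx0 mxrank0.
Qed.

End Spectral.

(** * The feedback kernels *)

Section Kernels.
Variable R : realType.
Local Notation mu := (@lebesgue_measure R).
Local Notation cfun := (cfun R).
Implicit Types (u v w r : cfun) (f g : R -> R) (t nu : R).

(** The integrand lives where both factors do; according to the position of nu
    this produces the bounds of the integrals in I1, I2 and I3. *)
Lemma conv_window (p q nu : R) (u v : cfun) (f M : R -> R) :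
  u =1 winf 0 p f -> v =1 winf 0 q M ->
  (u ** v) nu = \int[mu]_(eta in `[Num.max 0 (nu - q), Num.min p nu]) (f eta * M (nu - eta)).
Proof.
move=> uf vM; rewrite convE; apply/esym/Rintegral_cc.
- exact: measurable_conv_integrand.
- move=> t; rewrite gt_max lt_min => /andP[/andP[t0 tq] /andP[tp tn]].
  rewrite uf vM /winf t0 (ltW tp) ifT//; apply/andP; split; lra.
- move=> t tn; have : ~ (0 < t <= p) \/ ~ (0 < nu - t <= q).
    rewrite gt_min lt_max in tn; case: tn => /orP[?|?]; [left|right|left|right];
      by move=> /andP[]; lra.
  case=> /negP/negbTE h; first by rewrite uf /winf h mul0r.
  by rewrite vM /winf h mulr0.
Qed.

Variables (tau0 tau1 a b : R) (N M : R -> R) (n m : cfun).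
Hypothesis tau0_gt0 : 0 < tau0.
Hypothesis tau01 : tau0 <= tau1.
Hypothesis b_neq0 : b != 0.
Hypothesis nN : n =1 winf 0 tau0 N.
Hypothesis mM : m =1 winf 0 tau1 M.
Local Notation D := (plant_op tau0 a n).
Local Notation E := (input_op tau1 b m).

Section Identity.
Variables (f g : R -> R) (fc gc : cfun).
Hypothesis fE : fc =1 winf 0 tau0 f.
Hypothesis gE : gc =1 winf 0 tau1 g.
Let res := n + (D gc + E fc).

Let tau0_ge0 : 0 <= tau0. Proof. exact: ltW. Qed.
Let tau1_ge0 : 0 <= tau1. Proof. exact: le_trans tau01. Qed.

Let resE nu : res nu = n nu + (gc nu - a * gc (nu - tau0) - (gc ** n) nu
   + (b * fc (nu - tau1) + (fc ** m) nu)).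
Proof.
rewrite /res cfunD cfunD /plant_op cfunD cfunN cfunD cfunN cfunZ shiftE//.
by rewrite /input_op cfunD cfunZ shiftE// (convC n) (convC m).
Qed.

Let inside (p t : R) (h : R -> R) : 0 < t <= p -> winf 0 p h t = h t.
Proof. by rewrite /winf => ->. Qed.
Let below (p t : R) (h : R -> R) : t <= 0 -> winf 0 p h t = 0.
Proof. by rewrite /winf ltNge => ->. Qed.
Let above (p t : R) (h : R -> R) : p < t -> winf 0 p h t = 0.
Proof. by rewrite /winf andbC leNgt => ->. Qed.

Let res_I1 nu : 0 < nu <= tau0 -> res nu = I1 N M f g nu.
Proof.
have t01 := tau01; move=> /andP[n0 nt]; rewrite resE (conv_window nu gE nN) (conv_window nu fE mM).
have -> : Num.max 0 (nu - tau0) = 0 by apply/max_idPl; lra.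
have -> : Num.max 0 (nu - tau1) = 0 by apply/max_idPl; lra.
have -> : Num.min tau1 nu = nu by apply/min_idPr; lra.
have -> : Num.min tau0 nu = nu by apply/min_idPr; lra.
have e1 : winf 0 tau1 g (nu - tau0) = 0 by apply: below; lra.
have e2 : winf 0 tau0 f (nu - tau1) = 0 by apply: below; lra.
rewrite nN !gE fE e1 e2 !inside /I1; first by ring.
all: by apply/andP; split; lra.
Qed.

Let res_I2 nu : tau0 < nu <= tau1 -> res nu = I2 tau0 a N M f g nu.
Proof.
move=> /andP[n0 nt]; rewrite resE (conv_window nu gE nN) (conv_window nu fE mM).
have t00 := tau0_gt0.
have -> : Num.max 0 (nu - tau0) = nu - tau0 by apply/max_idPr; lra.
have -> : Num.max 0 (nu - tau1) = 0 by apply/max_idPl; lra.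
have -> : Num.min tau1 nu = nu by apply/min_idPr; lra.
have -> : Num.min tau0 nu = tau0 by apply/min_idPl; lra.
rewrite nN !gE fE above//.
have -> : winf 0 tau0 f (nu - tau1) = 0 by apply: below; lra.
rewrite !inside /I2; first by ring.
all: by apply/andP; split; lra.
Qed.

Let I3E nu : tau1 <= nu <= tau0 + tau1 -> I3 tau0 tau1 a b N M f g nu =
  b * f (nu - tau1) - a * g (nu - tau0) + (fc ** m) nu - (gc ** n) nu.
Proof.
move=> /andP[n0 nt]; rewrite (conv_window nu gE nN) (conv_window nu fE mM).
have t00 := tau0_gt0; have t01 := tau01.
have -> : Num.max 0 (nu - tau0) = nu - tau0 by apply/max_idPr; lra.
have -> : Num.max 0 (nu - tau1) = nu - tau1 by apply/max_idPr; lra.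
have -> : Num.min tau1 nu = tau1 by apply/min_idPl; lra.
have -> : Num.min tau0 nu = tau0 by apply/min_idPl; lra.
by rewrite /I3; ring.
Qed.

Let res_I3 nu : tau1 < nu <= tau0 + tau1 -> res nu = I3 tau0 tau1 a b N M f g nu.
Proof.
move=> /andP[n0 nt]; rewrite resE I3E; last by rewrite ltW.
have t00 := tau0_gt0; have t01 := tau01.
rewrite nN !gE fE (above N)//; last lra.
rewrite above// !inside; first by ring.
all: by apply/andP; split; lra.
Qed.

Let res_out nu : nu <= 0 \/ tau0 + tau1 < nu -> res nu = 0.
Proof.
case=> h; first by rewrite cfun_le0.
have t00 := tau0_gt0; have t01 := tau01.
rewrite resE nN !gE fE !(above _ (_ : _ < _ - _)) ?above; try lra.
have sf := winf_supp fE; have sg := winf_supp gE; have sm := winf_supp mM; have sn := winf_supp nN.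
rewrite (supp_conv sf sm h) (supp_conv sg sn); last lra.
by ring.
Qed.

Let I1_at0 : I1 N M f g 0 = g 0 + N 0.
Proof.
have h1 := conv_window 0 gE nN; have h2 := conv_window 0 fE mM; move: h1 h2.
have t00 := tau0_ge0; have t10 := tau1_ge0.
have -> : Num.max 0 (0 - tau0) = 0 by apply/max_idPl; lra.
have -> : Num.max 0 (0 - tau1) = 0 by apply/max_idPl; lra.
have -> : Num.min tau1 0 = 0 by apply/min_idPr; lra.
have -> : Num.min tau0 0 = 0 by apply/min_idPr; lra.
by rewrite !cfun_le0// /I1 => <- <-; ring.
Qed.

(** On ]0, tau0], ]tau0, tau1] and ]tau1, tau0 + tau1] the three integral
    equations are one and the same convolution equation, and outside ]0, tau0
    + tau1] this equation is trivial. *)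
Lemma feedback_identity :
  (forall nu, 0 <= nu <= tau0 -> I1 N M f g nu = 0) ->
  (forall nu, tau0 < nu <= tau1 -> I2 tau0 a N M f g nu = 0) ->
  (forall nu, tau1 <= nu <= tau0 + tau1 -> I3 tau0 tau1 a b N M f g nu = 0) ->
  n + (D gc + E fc) = 0.
Proof.
move=> i1 i2 i3; apply: cfunP => nu; rewrite cfun0 -/res.
have [n0|n0] := leP nu 0; first by apply: res_out; left.
have [nt|nt] := leP nu tau0; first by rewrite res_I1 ?n0// i1// ltW.
have [nt1|nt1] := leP nu tau1; first by rewrite res_I2 ?nt// i2// nt.
have [nt2|nt2] := leP nu (tau0 + tau1); first by rewrite res_I3 ?nt1// i3// ltW.
by apply: res_out; right.
Qed.

(** The values of f and g at 0 are invisible to the convolution equation. They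
    are fixed by I1 at nu = 0, where the integrals vanish, and by I3 at nu =
    tau1. *)
Lemma identity_feedback : n + (D gc + E fc) = 0 -> g 0 = - N 0 ->
  b * f 0 = a * g (tau1 - tau0) - (fc ** m) tau1 + (gc ** n) tau1 ->
  [/\ (forall nu, 0 <= nu <= tau0 -> I1 N M f g nu = 0),
  (forall nu, tau0 < nu <= tau1 -> I2 tau0 a N M f g nu = 0) &
  (forall nu, tau1 <= nu <= tau0 + tau1 -> I3 tau0 tau1 a b N M f g nu = 0)].
Proof.
move=> r0 g0 f0; have {}r0 nu : res nu = 0 by rewrite /res r0.
split=> nu.
- rewrite le_eqVlt => /andP[/orP[/eqP <- _|n0 nt]]; last by rewrite -res_I1 ?n0.
  by rewrite I1_at0 g0 addNr.
- by move=> h; rewrite -res_I2.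
- rewrite le_eqVlt => /andP[/orP[/eqP <- _|n0 nt]]; last by rewrite -res_I3 ?n0.
  rewrite I3E; last by rewrite lexx lerDr.
  by rewrite subrr f0; ring.
Qed.

End Identity.

Section Regularity.
Variable Q : (R -> R) -> Prop.
Hypothesis Q_lin : forall (c : R) f g, Q f -> Q g -> Q (fun t => c * f t + g t).
Hypothesis Q_shift : forall (p : R) f, Q f -> Q (fun t => f (t - p)).
Hypothesis Q_win : forall (p q : R) f, Q f -> Q (winf p q f).

(** Inverting the principal part only takes delays, truncations and linear
    combinations. *)
Lemma parts_regular r : Q r -> Q (state_part tau0 tau1 a b r) /\ Q (input_part tau0 tau1 a r).
Proof.
move=> Qr.
have Q0 : Q (fun=> 0).
  by have := Q_lin (-1) Qr Qr; congr Q; apply/funext => t; ring.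
have Qg : Q (geom tau0 tau1 a r).
  have -> : (geom tau0 tau1 a r : R -> R) = fun t =>
      \sum_(k < (Num.bound ((tau0 + tau1) / tau0)).+1) a ^+ k * r (t - k%:R * tau0).
    by apply/funext => t; exact: geomE.
  elim: _.+1 => [|d IH]; first by move: Q0; congr Q; apply/funext => t; rewrite big_ord0.
  have := Q_lin (a ^+ d) (Q_shift (d%:R * tau0) Qr) IH; congr Q.
  by apply/funext => t; rewrite big_ord_recr /= addrC.
split; last exact: Q_win.
have := Q_lin b^-1 (Q_win 0 tau0 (Q_shift (- tau1) Qg)) Q0; congr Q.
apply/funext => t; rewrite /state_part cfunZ winE addr0 /winf; congr (_ * _).
by case: ifP => // /andP[t0 _]; rewrite shift0E t0.
Qed.
End Regularity.

Variables (bn bm : {linear cfun -> cfun}).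
Hypothesis n_prim : primitive_of n bn.
Hypothesis m_prim : primitive_of m bm.
Hypothesis nC1 : pwC1 n.

(** The equation expresses the principal part of (f, g) as - n plus a
    primitive. A primitive is continuous, so f and g are piecewise continuous;
    then the integrand of the primitive is piecewise continuous, so f and g
    are piecewise C^1. *)
Lemma bezout_regular (f g : cfun) : supp_le tau0 f -> supp_le tau1 g -> D g + E f = - n ->
  pwC1 f /\ pwC1 g.
Proof.
move=> sf sg fg.
have [hm _ bm0 _] := m_prim; have [hn _ bn0 _] := n_prim.
(* The integral terms of the equation are the primitive of k, up to sign. *)
pose k := bn g - bm f.
have kE : heav R ** k = n ** g - m ** f by rewrite convBr hm hn.
pose r := principal tau0 tau1 a b f g.
have rE : r = - n + heav R ** k.
  rewrite kE -fg plant_input_principal /r; apply: cfunP => t; rewrite !cfunE; ring.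
have [rf rg] := parts_principal a tau0_gt0 tau01 b_neq0 sf sg.
have r0 : pwC0 (r : R -> R).
  have := pwC0_lin (-1) (pwC1_pwC0 nC1) (continuous_pwC0 (heav_conv_continuous (w := k))).
  by apply: (pwC0_eq (E := [::])) => t _; rewrite rE !cfunE /=; ring.
have [f0 g0] := parts_regular (@pwC0_lin R) (@pwC0_shift R) (@pwC0_win R) r0.
rewrite -/r in rf rg; rewrite rf in f0; rewrite rg in g0.
have k0 : pwC0 (k : R -> R).
  have := pwC0_lin (-1) (bm0 _ f0) (bn0 _ g0).
  by apply: (pwC0_eq (E := [::])) => t _; rewrite /k !cfunE; ring.
have r1 : pwC1 (r : R -> R).
  have := pwC1_lin (-1) nC1 (heav_conv_pwC1 k0).
  by apply: (pwC1_eq (E := [::])) => t _; rewrite rE !cfunE /=; ring.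
have [f1 g1] := parts_regular (@pwC1_lin R) (@pwC1_shift R) (@pwC1_win R) r1.
by rewrite rf in f1; rewrite rg in g1.
Qed.

Hypothesis nk : no_kernel tau0 tau1 a b n m.

(** The causal solution of the convolution equation is modified at 0 only,
    where it vanishes by convention whereas I1 and I3 prescribe other values.
    *)
Lemma feedback_kernels_exist : exists f g, feedback_kernels tau0 tau1 a b N M f g.
Proof.
have sn := winf_supp nN; have sm := winf_supp mM.
have sn' : supp_le (tau0 + tau1) (- n).
  by move=> t tt; rewrite cfunN sn ?oppr0//; have := tau0_gt0; have := tau01; lra.
have [fc [gc [sf sg fg]]] := bezout_solvable tau0_gt0 tau01 b_neq0 sn sm n_prim m_prim nk sn'.
have [f1 g1] := bezout_regular sf sg fg.
pose g (t : R) := if t == 0 then - N 0 else gc t.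
pose f (t : R) := if t == 0 then b^-1 * (a * g (tau1 - tau0) - (fc ** m) tau1 + (gc ** n) tau1) else fc t.
have fE : fc =1 winf 0 tau0 f.
  move=> t; rewrite /winf; case: ifPn => [/andP[t0 _]|]; first by rewrite /f gt_eqF.
  by rewrite negb_and -leNgt -ltNge => /orP[/cfun_le0//|/sf].
have gE : gc =1 winf 0 tau1 g.
  move=> t; rewrite /winf; case: ifPn => [/andP[t0 _]|]; first by rewrite /g gt_eqF.
  by rewrite negb_and -leNgt -ltNge => /orP[/cfun_le0//|/sg].
exists f, g; have [|||i1 i2 i3] := identity_feedback fE gE.
- by rewrite fg subrr.
- by rewrite /g eqxx.
- by rewrite /f eqxx mulVKf.
split; [split; apply: pwC_piecewise|exact: i1|exact: i2|exact: i3].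
- exact: tau0_gt0.
- apply: (pwC1_eq (E := [:: 0])) f1 => t; rewrite inE /f => /negbTE -> //.
- exact: lt_le_trans tau01.
- apply: (pwC1_eq (E := [:: 0])) g1 => t; rewrite inE /g => /negbTE -> //.
Qed.

Lemma feedback_kernels_unique f g f' g' :
  feedback_kernels tau0 tau1 a b N M f g -> feedback_kernels tau0 tau1 a b N M f' g' ->
  {ae mu, forall t : R, t \in `[0, tau0] -> f t = f' t} /\
  {ae mu, forall t : R, t \in `[0, tau1] -> g t = g' t}.
Proof.
move=> [[f1 g1] i1 i2 i3] [[f1' g1'] i1' i2' i3'].
have tau1_gt0 : 0 < tau1 by exact: lt_le_trans tau01.
have [fc [fE _ _]] := kernel_primitive tau0_gt0 f1.
have [gc [gE _ _]] := kernel_primitive tau1_gt0 g1.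
have [fc' [fE' _ _]] := kernel_primitive tau0_gt0 f1'.
have [gc' [gE' _ _]] := kernel_primitive tau1_gt0 g1'.
have h := feedback_identity fE gE i1 i2 i3.
have h' := feedback_identity fE' gE' i1' i2' i3'.
have supp_sub (p : R) u v : supp_le p u -> supp_le p v -> supp_le p (u - v).
  by move=> su sv t tp; rewrite !cfunE su// sv// subr0.
have [|||e1 e2] := nk (f := fc - fc') (g := gc - gc').
- by apply: supp_sub; [exact: winf_supp fE|exact: winf_supp fE'].
- by apply: supp_sub; [exact: winf_supp gE|exact: winf_supp gE'].
- have e : D gc + E fc = - n by apply/eqP; rewrite -addr_eq0 addrC h.
  have e' : D gc' + E fc' = - n by apply/eqP; rewrite -addr_eq0 addrC h'.
  by rewrite (linearB D) (linearB E) addrACA -opprD e e' subrr.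
have ae_of (p : R) (u v : R -> R) (uc vc : cfun) : uc =1 winf 0 p u -> vc =1 winf 0 p v -> uc - vc = 0 ->
    {ae mu, forall t : R, t \in `[0, p] -> u t = v t}.
  move=> ue ve uv; exists [set 0]; split => //; first by rewrite lebesgue_measure_set1.
  move=> t /= nt; apply: contrapT => t0; apply: nt; rewrite in_itv /= => /andP[t1 tp].
  have /eqP : (uc - vc) t = 0 by rewrite uv.
  have t2 : 0 < t by rewrite lt_neqAle t1 andbT eq_sym; apply/eqP.
  by rewrite cfunD cfunN ue ve /winf t2 tp subr_eq0 => /eqP.
by split; [exact: ae_of fE fE' e1|exact: ae_of gE gE' e2].
Qed.

End Kernels.

(** * Signals with piecewise continuous histories *)

Section Signals.
Variable R : realType.
Local Notation mu := (@lebesgue_measure R).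
Local Notation cfun := (cfun R).
Implicit Types (u v w : cfun) (s t tau : R) (phi : R -> R).

Let bounded_window p q phi :=
  measurable_fun setT (winf p q phi) /\ exists C, forall t, `|winf p q phi t| <= C.

Let bounded_window_cat p q r phi : p <= q -> q <= r ->
  bounded_window p q phi -> bounded_window q r phi -> bounded_window p r phi.
Proof.
move=> pq qr [m1 [C1 b1]] [m2 [C2 b2]]; split.
  by rewrite (winf_cat _ pq qr); exact: measurable_funD.
exists (C1 + C2) => t; rewrite (winf_cat _ pq qr) /=.
by apply: le_trans (ler_normD _ _) _; exact: lerD.
Qed.

Let Cpw_window tau t phi : 0 < tau -> Cpw tau (history phi t) ->
  bounded_window (t - tau) t phi.
Proof.
move=> tau0; pose Q (p q : R) := bounded_window (t + p) (t + q) phi.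
move=> /(@piecewise_glue _ _ Q) H.
have : Q (- tau) 0; last by rewrite /Q addr0.
apply: H; last by rewrite oppr_lt0.
- move=> p q _ _ pq /(extends_window pq)[mw [C wC]].
  have e s : winf (t + p) (t + q) phi s = winf p q (history phi t) (s - t).
    by rewrite /winf /history ltrBrDl lerBlDl subrKC.
  split; last by exists C => s; rewrite e.
  rewrite (_ : winf _ _ _ = winf p q (history phi t) \o (fun s => s - t)).
    by apply: measurableT_comp => //; exact: measurable_funB.
  by apply/funext => s; exact: e.
- by move=> p q r _ pq qr; apply: bounded_window_cat; rewrite lerD2l ltW.
Qed.

(** The signal delayed by tau', so that the part of its history on ]- tau, 0]
    falls in positive time. Each history being bounded and measurable, so is
    the signal on every bounded interval. *)
Lemma history_causal tau tau' phi : 0 < tau -> tau <= tau' ->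
  (forall t, 0 <= t -> Cpw tau (history phi t)) ->
  is_causal (fun t => if tau' - tau < t then phi (t - tau') else 0).
Proof.
move=> tau0 tt hphi.
have W (k : nat) : bounded_window (- tau) (k%:R * tau) phi.
  elim: k => [|k IH].
    by have := Cpw_window tau0 (hphi 0 (lexx _)); rewrite sub0r mul0r.
  apply: (@bounded_window_cat _ (k%:R * tau)) IH _.
  - by rewrite (@le_trans _ _ 0) ?oppr_le0 ?mulr_ge0// ltW.
  - by rewrite ler_pM2r// ler_nat.
  - have := Cpw_window tau0 (hphi (k.+1%:R * tau) (mulr_ge0 (ler0n _ _) (ltW tau0))).
    by rewrite -natr1 mulrDl mul1r addrK.
have big t : exists K : nat, forall k, (K <= k)%N -> t <= k%:R * tau.
  exists (Num.bound (`|t| / tau)) => k Kk.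
  have := archi_boundP (divr_ge0 (normr_ge0 t) (ltW tau0)).
  rewrite ltr_pdivrMr// => h; apply: le_trans (ler_norm _) _.
  by apply: le_trans (ltW h) _; rewrite ler_pM2r// ler_nat.
pose h (k : nat) t := winf (- tau) (k%:R * tau) phi (t - tau').
pose F t := if tau' - tau < t then phi (t - tau') else 0.
have hF t K : t - tau' <= K%:R * tau -> h K t = F t.
  by move=> tK; rewrite /h /F /winf tK andbT ltrBrDr addrC.
split.
(* The truncations of the signal at k tau are eventually equal to it. *)
- apply: (@measurable_fun_cvg _ _ _ _ h).
    move=> k; apply: (measurableT_comp (W k).1); exact: measurable_funB.
  move=> t _; have [K tK] := big (t - tau').
  apply: cvg_near_cst; exists K => // k /= Kk; apply: hF; exact: tK.
- by move=> t t0; rewrite ifF//; apply/negbTE; rewrite -leNgt; lra.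
- move=> T; have [K TK] := big (T - tau'); have [_ [C WC]] := W K.
  exists C => t tT; change (`|F t| <= C); rewrite -(@hF t K)//; first exact: WC.
  by apply: le_trans (TK K (leqnn K)); lra.
Qed.

(** A piecewise continuous function is bounded, so that the supremum defining
    the norm is an upper bound. *)
Lemma Cpw_norm_ge tau phi t : 0 < tau -> Cpw tau phi -> - tau <= t <= 0 ->
  `|phi t| <= Cpw_norm tau phi.
Proof.
move=> tau0 cphi tt; apply: ub_le_sup; last first.
  by exists t => //=; rewrite in_itv.
have [|_ [C phiC]] := @Cpw_window tau 0 phi tau0.
  by congr (Cpw tau _): cphi; apply/funext => s; rewrite /history add0r.
exists (Num.max C `|phi (- tau)|) => _ [s /= + <-]; rewrite in_itv/= => /andP[].
rewrite le_eqVlt => /orP[/eqP <- _|s1 s2]; first by rewrite le_max lexx orbT.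
by rewrite le_max; have := phiC s; rewrite /winf sub0r s1 s2 /= => ->.
Qed.

Lemma Cpw_norm_le tau phi (C : R) : 0 <= tau ->
  (forall t, - tau <= t <= 0 -> `|phi t| <= C) -> Cpw_norm tau phi <= C.
Proof.
move=> tau0 phiC; apply: ge_sup.
  by exists `|phi 0|, 0 => //=; rewrite in_itv/= lexx oppr_le0 tau0.
by move=> _ [t /= + <-]; rewrite in_itv/=; exact: phiC.
Qed.

Lemma conv_dominated u v u' v' t : (forall y, `|u y| <= u' y) ->
  (forall s, s <= t -> `|v s| <= v' s) -> `|(u ** v) t| <= (u' ** v') t.
Proof.
move=> uu vv; rewrite !convE.
have iuv := conv_integrable u v t.
apply: le_trans (le_normr_Rintegral _ _) _ => //.
apply: le_Rintegral => //.
- exact: (integrable_norm iuv).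
- exact: conv_integrable.
- move=> y _; have [y0|y0] := leP y 0; first by rewrite (cfun_le0 u y0) (cfun_le0 u' y0) !mul0r normr0.
  by rewrite normrM ler_pM// vv// gerBl ltW.
Qed.

(** Measured against the weight exp (ga t), convolution with a kernel bounded
    by C has norm at most C / ga: the integral terms of the closed loop are
    small for ga large. *)
Lemma conv_exp_le u v (C B ga t : R) : 0 < ga -> 0 <= C -> 0 <= B ->
  (forall y, `|u y| <= C) -> (forall s, 0 < s <= t -> `|v s| <= B * expR (ga * s)) ->
  `|(u ** v) t| <= C / ga * (B * expR (ga * t)).
Proof.
move=> ga0 C0 B0 uC vB; have [t0|t0] := leP t 0.
  by rewrite cfun_le0// normr0 mulr_ge0 ?divr_ge0 ?mulr_ge0 ?expR_ge0// ltW.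
have E s : 0 < s -> ecos ga 0 s = expR (ga * s).
  by move=> s0; rewrite ecosE s0 mul0r cos0 mulr1.
apply: le_trans (@conv_dominated u v (C *: heav R) (B *: ecos ga 0) t _ _) _.
- move=> y; rewrite cfunZ heavE; case: ltP => y0; first by rewrite mulr1.
  by rewrite cfun_le0// normr0 mulr0.
- move=> s st; rewrite cfunZ; have [s0|s0] := leP s 0.
    by rewrite !cfun_le0// normr0 mulr0.
  by rewrite E// vB// s0.
have e : (heav R ** ecos ga 0) t = (expR (ga * t) - 1) / ga.
  have := ecos_heav ga 0; rewrite scale0r subr0 convZr => /(congr1 (fun w : cfun => w t)).
  rewrite cfunD cfunZ heavE t0 E// => ->; field.
  by rewrite gt_eqF.
rewrite convZl convZr !cfunZ e.
rewrite -subr_ge0.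
rewrite (_ : _ - _ = C * B / ga); last by ring.
by rewrite divr_ge0 ?mulr_ge0// ltW.
Qed.

End Signals.

(** * Decay of the closed loop *)

Section Decay.
Variable R : realType.
Local Notation mu := (@lebesgue_measure R).
Local Notation cfun := (cfun R).
Implicit Types (s t nu : R).
Variables (tau0 tau1 a b : R) (N M f g : R -> R) (n m fc gc : cfun).
Hypothesis tau0_gt0 : 0 < tau0.
Hypothesis tau01 : tau0 <= tau1.
Hypothesis a_itv : -1 < a < 1.
Hypothesis nN : n =1 winf 0 tau0 N.
Hypothesis mM : m =1 winf 0 tau1 M.
Hypothesis fE : fc =1 winf 0 tau0 f.
Hypothesis gE : gc =1 winf 0 tau1 g.
Local Notation D := (plant_op tau0 a n).
Local Notation E := (input_op tau1 b m).
Hypothesis bezout : n + (D gc + E fc) = 0.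

Let tau0_ge0 : 0 <= tau0. Proof. exact: ltW. Qed.
Let tau1_gt0 : 0 < tau1. Proof. exact: lt_le_trans tau01. Qed.
Let tau1_ge0 : 0 <= tau1. Proof. exact: ltW. Qed.

(** The distributed delays of the closed loop, as convolutions evaluated at
    the delayed time. *)
Lemma delay_conv (tau t : R) (k phi : R -> R) (u v : cfun) : u =1 winf 0 tau k ->
  (forall nu, 0 < nu < tau -> v (t + tau1 - nu) = phi (t - nu)) ->
  \int[mu]_(nu in `[0, tau]) (k nu * phi (t - nu)) = (u ** v) (t + tau1).
Proof.
move=> uk vphi; rewrite convE; apply: Rintegral_cc.
- exact: measurable_conv_integrand.
- by move=> nu /andP[n0 nt]; rewrite uk /winf n0 (ltW nt) vphi// n0.
- move=> nu nt; rewrite uk /winf ifF ?mul0r//; apply/negbTE/negP => /andP[? ?].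
  by case: nt; lra.
Qed.

(** The defects p and q of the plant equation and of the control law vanish
    past tau1. Combining them with the kernels as multipliers, and using n + D
    gc + E fc = 0, one finds xs - a S xs = p - gc ** p + E q and us - a S us =
    D q + fc ** p, with S the delay tau0. The 2 x 2 system of the
    closed loop is thus multiplied by the adjugate of its matrix, and the
    determinant F0 (1 - g^) - F1 f^ = 1 - a exp (- tau0 s) appears. *)
Lemma closed_loop_supp (xs us : cfun) :
  supp_le tau1 (D xs - E us) -> supp_le tau1 (us - gc ** us - fc ** xs) ->
  supp_le (tau1 + tau1) (xs - a *: shift tau0 xs) /\
  supp_le (tau1 + tau1) (us - a *: shift tau0 us).
Proof.
set p := D xs - E us; set q := us - _ - _ => sp sq.
have sf := winf_supp fE; have sg := winf_supp gE; have sm := winf_supp mM; have sn := winf_supp nN.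
have Dg : D gc = - n - E fc.
  by apply/eqP; rewrite eq_sym subr_eq eq_sym -addr_eq0 addrC bezout.
have DR u v : D (u ** v) = u ** D v by exact: plant_op_conv.
have ER u v : E (u ** v) = u ** E v by exact: (input_op_conv b m tau0_gt0 tau01).
have DB u v : D (u - v) = D u - D v by exact: linearB.
have EB u v : E (u - v) = E u - E v by exact: linearB.
have DL u v : u ** D v = D u ** v by rewrite -DR convC DR convC.
have EL u v : u ** E v = E u ** v by rewrite -ER convC ER convC.
have Dgv v : D gc ** v = - (n ** v) - E fc ** v by rewrite Dg convBl convNl.
have hD u : D u = u - a *: shift tau0 u - n ** u by [].
have ex : xs - a *: shift tau0 xs = p - gc ** p + E q.
  have -> : E q = E us - gc ** E us - E fc ** xs by rewrite /q !EB !ER [fc ** E xs]EL.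
  rewrite /p convBr DL Dgv (hD xs).
  move: (gc ** E us) (E us) (E fc ** xs) => e1 e2 e3.
  by apply: cfunP => t; rewrite !cfunE; ring.
have eu : us - a *: shift tau0 us = D q + fc ** p.
  have -> : D q = D us + n ** us + E fc ** us - fc ** D xs.
    by rewrite /q !DB !DR [gc ** D us]DL Dgv opprD !opprK addrA.
  rewrite /p convBr [fc ** E us]EL (hD us).
  move: (fc ** D xs) (E fc ** us) => e1 e2.
  by apply: cfunP => t; rewrite !cfunE; ring.
rewrite ex eu; split.
- apply: supp_add; first apply: supp_add.
  + by apply: supp_le_trans sp; rewrite lerDl.
  + by apply/supp_opp/supp_conv.
  + exact: (supp_input b tau0_gt0 tau01 sm sq).
- apply: supp_add.
  + apply: (@supp_le_trans _ (tau0 + tau1)); first by rewrite lerD2r.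
    exact: (supp_plant a tau0_gt0 sn sq).
  + apply: (@supp_le_trans _ (tau0 + tau1)); first by rewrite lerD2r.
    exact: supp_conv.
Qed.

(** A delay makes a term small, like 1 / ga, when measured against the weight
    exp (ga s). *)
Lemma expR_delay (ga tau s : R) : 0 < ga -> 0 < tau ->
  expR (ga * (s - tau)) <= (ga * tau)^-1 * expR (ga * s).
Proof.
move=> ga0 tau_gt0; rewrite mulrBr expRD expRN mulrC ler_wpM2r ?expR_ge0//.
have gt0 : 0 < ga * tau by rewrite mulr_gt0.
by rewrite lef_pV2 ?posrE ?expR_gt0// ltW// (lt_le_trans _ (expR_ge1Dx _))// ltrDr.
Qed.

Section Solution.
Variables (x0 U0 x U : R -> R).
Hypothesis x0_pw : Cpw tau0 x0.
Hypothesis U0_pw : Cpw tau1 U0.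
Hypothesis sol : closed_loop_solution tau0 tau1 a b N M f g x0 U0 x U.

Let x_pw t : 0 <= t -> Cpw tau0 (history x t). Proof. by case: sol => _ _ h _ /h[]. Qed.
Let U_pw t : 0 <= t -> Cpw tau1 (history U t). Proof. by case: sol => _ _ h _ /h[]. Qed.
Let xs : cfun := CFun (mkcfun (history_causal tau0_gt0 tau01 x_pw)).
Let us : cfun := CFun (mkcfun (history_causal tau1_gt0 (lexx tau1) U_pw)).
Let xsE t : xs t = if tau1 - tau0 < t then x (t - tau1) else 0. Proof. by []. Qed.
Let usE t : us t = if 0 < t then U (t - tau1) else 0. Proof.
have -> : us t = if tau1 - tau1 < t then U (t - tau1) else 0 by [].
by rewrite subrr.
Qed.

Let xs_x s : - tau0 < s -> xs (s + tau1) = x s.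
Proof. by move=> st; rewrite xsE addrK ifT//; lra. Qed.
Let us_U s : - tau1 < s -> us (s + tau1) = U s.
Proof. by move=> st; rewrite usE addrK ifT//; lra. Qed.

Let x_eq s : 0 <= s -> x s = a * x (s - tau0) + (n ** xs) (s + tau1)
  + b * U (s - tau1) + (m ** us) (s + tau1).
Proof.
move=> s0; case: sol => _ _ _ /(_ _ s0)[-> _].
congr (_ + _ + _ + _); apply: delay_conv => // nu /andP[n0 nt].
- by rewrite -xs_x; [congr (xs _); ring|lra].
- by rewrite -us_U; [congr (us _); ring|lra].
Qed.
Let U_eq s : 0 <= s -> U s = (fc ** xs) (s + tau1) + (gc ** us) (s + tau1).
Proof.
move=> s0; case: sol => _ _ _ /(_ _ s0)[_ ->].
congr (_ + _); apply: delay_conv => // nu /andP[n0 nt].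
- by rewrite -xs_x; [congr (xs _); ring|lra].
- by rewrite -us_U; [congr (us _); ring|lra].
Qed.

(** The causal signals are x and U delayed by tau1, so that their equations
    start at time tau1 and [closed_loop_supp] applies. Its conclusion past
    2 tau1 is the difference equation for x and U past tau1. *)
Lemma closed_loop_difference s : tau1 < s -> x s = a * x (s - tau0) /\ U s = a * U (s - tau0).
Proof.
move=> st; have t00 := tau0_gt0; have t01 := tau01; have t10 := tau1_gt0.
have [||e1 e2] := @closed_loop_supp xs us _ _.
- move=> t tt; have s0 : 0 <= t - tau1 by lra.
  have := x_eq s0; rewrite subrK => xt.
  rewrite cfunD cfunN /plant_op /input_op cfunD cfunN cfunD cfunN cfunZ cfunD cfunZ !shiftE//.
  have e1 : xs t = x (t - tau1) by rewrite -xs_x ?subrK//; lra.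
  have e2 : xs (t - tau0) = x (t - tau1 - tau0) by rewrite -xs_x; [congr (xs _); ring|lra].
  have e3 : us (t - tau1) = U (t - tau1 - tau1) by rewrite -us_U; [congr (us _); ring|lra].
  by rewrite e1 e2 e3 xt; ring.
- move=> t tt; have s0 : 0 <= t - tau1 by lra.
  have := U_eq s0; rewrite subrK => Ut.
  have e1 : us t = U (t - tau1) by rewrite -us_U ?subrK//; lra.
  by rewrite cfunD cfunN cfunD cfunN e1 Ut; ring.
have st' : tau1 + tau1 < s + tau1 by rewrite ltrD2r.
move: (e1 _ st') (e2 _ st'); rewrite !(cfunD, cfunN, cfunZ) !shiftE//.
rewrite xs_x; last lra. rewrite us_U; last lra.
rewrite (_ : s + tau1 - tau0 = s - tau0 + tau1); last by ring.
rewrite xs_x; last lra. rewrite us_U; last lra.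
by move=> /eqP; rewrite subr_eq0 => /eqP -> /eqP; rewrite subr_eq0 => /eqP ->.
Qed.

Let S0 := Cpw_norm tau0 x0 + Cpw_norm tau1 U0.

Let x_hist s : - tau0 <= s < 0 -> `|x s| <= S0.
Proof.
move=> /andP[s1 s2]; case: sol => hx _ _ _; rewrite hx ?s1//.
have h1 : `|x0 s| <= Cpw_norm tau0 x0 by apply: Cpw_norm_ge => //; rewrite s1 ltW.
have h2 : `|U0 0| <= Cpw_norm tau1 U0 by apply: Cpw_norm_ge => //; rewrite lexx oppr_le0 tau1_ge0.
by apply: le_trans h1 _; rewrite lerDl (le_trans _ h2).
Qed.
Let U_hist s : - tau1 <= s < 0 -> `|U s| <= S0.
Proof.
move=> /andP[s1 s2]; case: sol => _ hU _ _; rewrite hU ?s1//.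
have h1 : `|U0 s| <= Cpw_norm tau1 U0 by apply: Cpw_norm_ge => //; rewrite s1 ltW.
have h2 : `|x0 0| <= Cpw_norm tau0 x0 by apply: Cpw_norm_ge => //; rewrite lexx oppr_le0 tau0_ge0.
by apply: le_trans h1 _; rewrite lerDr (le_trans _ h2).
Qed.
Let S0_ge0 : 0 <= S0.
Proof. by apply: le_trans (normr_ge0 _) (@x_hist (- tau0) _); rewrite lexx oppr_lt0. Qed.

Variables (Cn Cm Cf Cg : R).
Hypothesis C_ge0 : [/\ 0 <= Cn, 0 <= Cm, 0 <= Cf & 0 <= Cg].
Hypothesis n_le : forall t, `|n t| <= Cn.
Hypothesis m_le : forall t, `|m t| <= Cm.
Hypothesis f_le : forall t, `|fc t| <= Cf.
Hypothesis g_le : forall t, `|gc t| <= Cg.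
Variable ga : R.
Hypothesis ga_gt0 : 0 < ga.
Hypothesis ga_ge : 2 * (tau0^-1 + `|b| / tau1 + Cn + Cm + Cf + Cg) <= ga.

Let below_exp (B : R) :=
  (forall s, - tau0 <= s <= tau1 -> `|x s| <= B * expR (ga * (s + tau1))) /\
  (forall s, - tau1 <= s <= tau1 -> `|U s| <= B * expR (ga * (s + tau1))).

(** Up to time tau1 the histories enter the equations. All the terms on the
    right-hand sides, measured against the weight exp (ga (s + tau1)), are
    bounded by half of the bound assumed on x and U; for the integrals this is
    conv_exp_le, for the point delays expR_delay. *)
Let below_exp_half (B : R) : 0 <= B -> below_exp (S0 + B) -> below_exp (S0 + B / 2).
Proof.
move=> B0 [xB UB]; have t00 := tau0_gt0; have t01 := tau01; have t10 := tau1_gt0.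
have [Cn0 Cm0 Cf0 Cg0] := C_ge0.
have SB0 : 0 <= S0 + B by rewrite addr_ge0.
have xsB t s : s <= tau1 -> 0 < t <= s + tau1 -> `|xs t| <= (S0 + B) * expR (ga * t).
  move=> st /andP[t0 ts]; rewrite xsE; case: ifPn => [tt|_]; last first.
    by rewrite normr0 mulr_ge0// expR_ge0.
  by have := xB (t - tau1); rewrite subrK; apply; apply/andP; split; lra.
have usB t s : s <= tau1 -> 0 < t <= s + tau1 -> `|us t| <= (S0 + B) * expR (ga * t).
  move=> st /andP[t0 ts]; rewrite usE t0.
  by have := UB (t - tau1); rewrite subrK; apply; apply/andP; split; lra.
have small (k e : R) : k <= ga / 2 -> 0 <= e -> k / ga * ((S0 + B) * e) <= (S0 + B / 2) * e.
  move=> kga e0; rewrite mulrA ler_wpM2r//.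
  have h : k / ga <= 1 / 2 by rewrite ler_pdivrMr//; lra.
  by apply: le_trans (ler_wpM2r SB0 h) _; have := S0_ge0; lra.
have ti : 0 <= tau0^-1 by rewrite invr_ge0.
have bi : 0 <= `|b| / tau1 by rewrite divr_ge0.
have ga2 := ga_ge.
have delayed (c k tau s y : R) : 0 < tau -> `|c| / tau <= k -> `|y| <= (S0 + B) * expR (ga * (s - tau)) ->
    `|c * y| <= k / ga * ((S0 + B) * expR (ga * s)).
  move=> tau_gt0 ck yB; rewrite normrM.
  have e0 : 0 <= (S0 + B) * expR (ga * s) by rewrite mulr_ge0 ?expR_ge0.
  apply: (@le_trans _ _ (`|c| / tau / ga * ((S0 + B) * expR (ga * s)))); last first.
    by rewrite ler_wpM2r// ler_wpM2r// invr_ge0 ltW.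
  rewrite -!mulrA ler_wpM2l//; apply: le_trans yB _.
  rewrite mulrCA [tau^-1 * _]mulrCA; apply: le_trans (ler_wpM2l SB0 (expR_delay s ga_gt0 tau_gt0)) _.
  by rewrite invfM mulrCA -mulrA; rewrite le_eqVlt; apply/orP; left; apply/eqP; ring.
have hist s : 0 <= s + tau1 -> S0 <= (S0 + B / 2) * expR (ga * (s + tau1)).
  move=> s0; rewrite -[leLHS]mulr1 ler_pM//; first by rewrite lerDl divr_ge0.
  by rewrite -expR0 ler_expR mulr_ge0// ltW.
split=> s /andP[s1 s2].
- have [s0|s0] := ltP s 0.
    by apply: le_trans (x_hist _) (hist _ _); rewrite ?s1//; lra.
  have d1 : `|a * x (s - tau0)| <= tau0^-1 / ga * ((S0 + B) * expR (ga * (s + tau1))).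
    apply: (@delayed _ _ tau0) => //.
      by rewrite ler_pdivrMr// mulVf ?gt_eqF// ler_norml; move/andP: a_itv => [? ?]; lra.
    rewrite (_ : s + tau1 - tau0 = s - tau0 + tau1); last by ring.
    by apply: xB; apply/andP; split; lra.
  have d2 : `|(n ** xs) (s + tau1)| <= Cn / ga * ((S0 + B) * expR (ga * (s + tau1))).
    by apply: conv_exp_le => // t; exact: xsB.
  have d3 : `|b * U (s - tau1)| <= `|b| / tau1 / ga * ((S0 + B) * expR (ga * (s + tau1))).
    apply: (@delayed _ _ tau1) => //; rewrite addrK.
    by have := UB (s - tau1); rewrite subrK; apply; apply/andP; split; lra.
  have d4 : `|(m ** us) (s + tau1)| <= Cm / ga * ((S0 + B) * expR (ga * (s + tau1))).
    by apply: conv_exp_le => // t; exact: usB.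
  set V := (S0 + B) * _ in d1 d2 d3 d4.
  rewrite (x_eq s0); apply: le_trans (small (tau0^-1 + Cn + `|b| / tau1 + Cm) _ _ (expR_ge0 _)).
    rewrite -/V !mulrDl; apply: le_trans (ler_normD _ _) (lerD _ d4).
    apply: le_trans (ler_normD _ _) (lerD _ d3).
    exact: le_trans (ler_normD _ _) (lerD d1 d2).
  lra.
- have [s0|s0] := ltP s 0.
    by apply: le_trans (U_hist _) (hist _ _); rewrite ?s1//; lra.
  have d2 : `|(fc ** xs) (s + tau1)| <= Cf / ga * ((S0 + B) * expR (ga * (s + tau1))).
    by apply: conv_exp_le => // t; exact: xsB.
  have d4 : `|(gc ** us) (s + tau1)| <= Cg / ga * ((S0 + B) * expR (ga * (s + tau1))).
    by apply: conv_exp_le => // t; exact: usB.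
  set V := (S0 + B) * _ in d2 d4.
  rewrite (U_eq s0); apply: le_trans (small (Cf + Cg) _ _ (expR_ge0 _)).
    by rewrite -/V !mulrDl; exact: le_trans (ler_normD _ _) (lerD d2 d4).
  lra.
Qed.

(** Halving the excess B over the size S0 of the initial data again and again
    leaves a bound by S0 alone, whatever the first local bound was. *)
Let below_exp_S0 : below_exp S0.
Proof.
have t00 := tau0_gt0; have t01 := tau01; have t10 := tau1_gt0.
have [C C0 xC] := cfun_bounded xs (tau1 + tau1).
have [C' C'0 uC'] := cfun_bounded us (tau1 + tau1).
have init : below_exp (S0 + (C + C')).
  have le1 s (B : R) : 0 <= s + tau1 -> B <= S0 + (C + C') -> B <= (S0 + (C + C')) * expR (ga * (s + tau1)).
    move=> s0 h; apply: le_trans h _; rewrite -[leLHS]mulr1 ler_wpM2l//.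
      by apply: addr_ge0 => //; exact: addr_ge0.
    by rewrite -expR0 ler_expR mulr_ge0// ltW.
  split=> s /andP[s1 s2]; apply: le1; try lra.
  - have [s0|s0] := ltP s 0; first by have := x_hist; move=> /(_ s); rewrite s1 s0 => /(_ isT); lra.
    have := xC (s + tau1); rewrite xs_x; last lra.
    by rewrite lerD2r s2 => /(_ isT); have := S0_ge0; lra.
  - have [s0|s0] := ltP s 0; first by have := U_hist; move=> /(_ s); rewrite s1 s0 => /(_ isT); lra.
    have := uC' (s + tau1); rewrite us_U; last lra.
    by rewrite lerD2r s2 => /(_ isT); have := S0_ge0; lra.
have halves k : below_exp (S0 + (C + C') / 2 ^+ k).
  elim: k => [|k IH]; first by rewrite expr0 divr1.
  rewrite exprSr invfM mulrA; apply: below_exp_half => //.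
  by rewrite divr_ge0 ?addr_ge0// exprn_ge0.
have lim s (y : R) : (forall k, `|y| <= (S0 + (C + C') / 2 ^+ k) * expR (ga * (s + tau1))) ->
    `|y| <= S0 * expR (ga * (s + tau1)).
  move=> h; rewrite leNgt; apply/negP => lt.
  have := @le_half_pow_eq0 R (`|y| - S0 * expR (ga * (s + tau1))) ((C + C') * expR (ga * (s + tau1))).
  move=> H; have /eqP : `|y| - S0 * expR (ga * (s + tau1)) = 0.
    apply: H => k; rewrite ger0_norm ?subr_ge0 ?(ltW lt)// lerBlDl; apply: le_trans (h k) _.
    by rewrite mulrDl [(C + C') / _ * _]mulrAC.
  by rewrite subr_eq0 gt_eqF.
by split=> s ss; apply: lim => k; case: (halves k) => h1 h2; [exact: h1|exact: h2].
Qed.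

Variable ka : R.
Hypothesis ka_gt0 : 0 < ka.
Hypothesis ka_a : `|a| <= expR (- (ka * tau0)).
Let L := expR (ga * (tau1 + tau1)) * expR (ka * tau1).

(** The weighted bound holds up to time tau1; from then on each delay tau0
    costs a factor a, which is at most exp (- ka tau0) in absolute value. *)
Lemma solution_decay :
  (forall s, - tau0 <= s -> `|x s| <= L * S0 * expR (- (ka * s))) /\
  (forall s, - tau1 <= s -> `|U s| <= L * S0 * expR (- (ka * s))).
Proof.
have t00 := tau0_gt0; have t01 := tau01; have t10 := tau1_gt0.
have base s (y : R) : s <= tau1 -> `|y| <= S0 * expR (ga * (s + tau1)) ->
    `|y| <= L * S0 * expR (- (ka * s)).
  move=> s1 h; apply: le_trans h _.
  have -> : L * S0 * expR (- (ka * s)) =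
      S0 * (expR (ga * (tau1 + tau1)) * (expR (ka * tau1) * expR (- (ka * s)))) by rewrite /L; ring.
  rewrite ler_wpM2l//.
  rewrite -[leLHS]mulr1 ler_pM ?expR_ge0//.
    by rewrite ler_expR ler_wpM2l ?lerD2r// ltW.
  by rewrite -expRD -expR0 ler_expR -mulrBr mulr_ge0 ?subr_ge0// ltW.
have step (y z s : R) : y = a * z -> `|z| <= L * S0 * expR (- (ka * (s - tau0))) ->
    `|y| <= L * S0 * expR (- (ka * s)).
  move=> -> h; rewrite normrM.
  have -> : - (ka * s) = - (ka * tau0) + - (ka * (s - tau0)) by ring.
  by rewrite expRD mulrCA ler_pM// expR_ge0.
have all_k (k : nat) s : s <= tau1 + k%:R * tau0 ->
    (- tau0 <= s -> `|x s| <= L * S0 * expR (- (ka * s))) /\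
    (- tau1 <= s -> `|U s| <= L * S0 * expR (- (ka * s))).
  elim: k s => [|k IH] s sk.
    rewrite mul0r addr0 in sk; have [h1 h2] := below_exp_S0.
    by split => ss; apply: base => //; [apply: h1|apply: h2]; rewrite ss.
  have [s1|s1] := leP s tau1.
    by have [h1 h2] := below_exp_S0; split => ss; apply: base => //; [apply: h1|apply: h2]; rewrite ss.
  have [ex eu] := closed_loop_difference s1.
  have [|h1 h2] := IH (s - tau0); first by rewrite -natr1 mulrDl mul1r in sk; lra.
  by split => _; [apply: step ex (h1 _)|apply: step eu (h2 _)]; lra.
have big s : exists k : nat, s <= tau1 + k%:R * tau0.
  exists (Num.bound (`|s| / tau0)).
  have := archi_boundP (divr_ge0 (normr_ge0 s) (ltW t00)); rewrite ltr_pdivrMr// => h.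
  by have := ler_norm s; lra.
by split=> s; have [k /all_k[]] := big s.
Qed.

End Solution.

(** The rate ka is such that exp (- ka tau0) = max (|a|, 1 / 2); the lower
    bound 1 / 2 only serves to have a finite rate when a = 0. A window of
    length tau loses the factor exp (ka tau). *)
Lemma closed_loop_stable : exponentially_stable tau0 tau1 a b N M f g.
Proof.
have [Cn Cn0 nC] := supp_bounded (winf_supp nN); have [Cm Cm0 mC] := supp_bounded (winf_supp mM).
have [Cf Cf0 fC] := supp_bounded (winf_supp fE); have [Cg Cg0 gC] := supp_bounded (winf_supp gE).
(* Twice the sum of the gains of the six terms of the closed loop, so that the
   weighted gain is at most 1 / 2. *)
pose ga := 2 * (tau0^-1 + `|b| / tau1 + Cn + Cm + Cf + Cg).
have ti : 0 < tau0^-1 by rewrite invr_gt0.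
have bi : 0 <= `|b| / tau1 by rewrite divr_ge0.
have ga0 : 0 < ga by rewrite /ga; lra.
pose r := Num.max `|a| (1 / 2).
have r0 : 0 < r by rewrite lt_max; apply/orP; right; lra.
have r1 : r < 1 by rewrite gt_max ltr_norml a_itv /=; lra.
pose ka := - ln r / tau0.
have ka0 : 0 < ka by rewrite divr_gt0// oppr_gt0 ln_lt0// r0.
have ka_a : `|a| <= expR (- (ka * tau0)).
  by rewrite /ka divfK ?gt_eqF// opprK lnK ?posrE// le_max lexx.
pose L := expR (ga * (tau1 + tau1)) * expR (ka * tau1).
have L0 : 0 < L by rewrite mulr_gt0 ?expR_gt0.
exists ka, (L * (expR (ka * tau0) + expR (ka * tau1))); split => //.
  by rewrite mulr_gt0// addr_gt0 ?expR_gt0.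
move=> x0 U0 x0_pw U0_pw x U sol t t0.
have [xd Ud] := solution_decay x0_pw U0_pw sol (And4 Cn0 Cm0 Cf0 Cg0) nC mC fC gC ga0 (lexx _) ka0 ka_a.
set S := Cpw_norm tau0 x0 + _; rewrite -/S in xd Ud.
have S0 : 0 <= S.
  have := xd (- tau0) (lexx _) => /(le_trans (normr_ge0 _)).
  by rewrite pmulr_lge0 ?expR_gt0// pmulr_rge0.
have window (tau : R) (phi : R -> R) : 0 <= tau ->
    (forall s, - tau <= s -> `|phi s| <= L * S * expR (- (ka * s))) ->
    Cpw_norm tau (history phi t) <= L * expR (ka * tau) * expR (- (ka * t)) * S.
  move=> tau_ge0 phid; apply: Cpw_norm_le => // s /andP[s1 s2].
  apply: le_trans (phid _ _) _; first lra.
  have -> : L * expR (ka * tau) * expR (- (ka * t)) * S =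
      L * S * (expR (ka * tau) * expR (- (ka * t))) by ring.
  rewrite -expRD ler_wpM2l ?mulr_ge0 ?(ltW L0)// ler_expR.
  have : 0 <= ka * (tau + s) by rewrite mulr_ge0 ?(ltW ka0)//; lra.
  lra.
have -> : L * (expR (ka * tau0) + expR (ka * tau1)) * expR (- (ka * t)) * S =
    L * expR (ka * tau0) * expR (- (ka * t)) * S + L * expR (ka * tau1) * expR (- (ka * t)) * S by ring.
by apply: lerD; apply: window.
Qed.
End Decay.

(** * Stabilization *)

Theorem theorem1 (R : realType) (tau0 tau1 a b : R) (N M : R -> R)
    (tau0_gt0 : 0 < tau0) (le_tau01 : tau0 <= tau1)
    (a_itv : -1 < a < 1) (b_neq0 : b != 0)
    (N_C1 : piecewise_C1 0 tau0 N) (M_C1 : piecewise_C1 0 tau1 M)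
    (ctrl : spectrally_controllable tau0 tau1 a b N M) :
  [/\ exists f g : R -> R, feedback_kernels tau0 tau1 a b N M f g,
      forall f g f' g' : R -> R,
        feedback_kernels tau0 tau1 a b N M f g ->
        feedback_kernels tau0 tau1 a b N M f' g' ->
        {ae lebesgue_measure, forall t : R, t \in `[0, tau0] -> f t = f' t} /\
        {ae lebesgue_measure, forall t : R, t \in `[0, tau1] -> g t = g' t}
    & forall f g : R -> R,
        feedback_kernels tau0 tau1 a b N M f g ->
        exponentially_stable tau0 tau1 a b N M f g].
Proof.
have tau1_gt0 : 0 < tau1 by exact: lt_le_trans le_tau01.
have [n [nN n_C1 [bn n_prim]]] := kernel_primitive tau0_gt0 N_C1.
have [m [mM _ [bm m_prim]]] := kernel_primitive tau1_gt0 M_C1.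
have nk : no_kernel tau0 tau1 a b n m.
  apply: (kernel_trivial tau0_gt0 le_tau01 b_neq0 (winf_supp nN) (winf_supp mM) n_prim m_prim).
  exact: controllable_no_common_zero ctrl.
split.
- exact: (feedback_kernels_exist tau0_gt0 le_tau01 b_neq0 nN mM n_prim m_prim n_C1 nk).
- by move=> f g f' g'; exact: (feedback_kernels_unique tau0_gt0 le_tau01 nN mM nk).
- move=> f g [[f_C1 g_C1] i1 i2 i3].
  have [fc [fE _ _]] := kernel_primitive tau0_gt0 f_C1.
  have [gc [gE _ _]] := kernel_primitive tau1_gt0 g_C1.
  apply: (closed_loop_stable tau0_gt0 le_tau01 a_itv nN mM fE gE).
  exact: (feedback_identity tau0_gt0 le_tau01 nN mM fE gE i1 i2 i3).
Qed.
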